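(* Let $X$ be an infinite-dimensional closed subspace of $s$. Then the following assertions are equivalent: (i) For each two closed commutative ${}^*$-subalgebras $E,F$ of $\mathcal L(s',s)$ we have: if $E\cong F\cong X$ as Fréchet spaces, then $E\cong F$ as Fréchet ${}^*$-algebras. (ii) For each two basic sequences $(f_j)_{j\in\mathbb N}$ and $(g_j)_{j\in\mathbb N}$ of $s$ which are at the same time orthonormal sequences in $\ell_2$ we have: if $\lambda^2(|f_j|_q)\cong\lambda^2(|g_j|_q)\cong X$ as Fréchet spaces, then there is a bijection $\sigma\colon\mathbb N\to\mathbb N$ such that $(|f_j|_q)_{j\in\mathbb N,q\in\mathbb N_0}\sim(|g_{\sigma(j)}|_q)_{j\in\mathbb N,q\in\mathbb N_0}$. (iii) For each two Köthe matrices $A$ and $B$ such that $A\sim A^2$ and $B\sim B^2$ we have: if $\lambda^2(A)\cong\lambda^2(B)\cong X$ as Fréchet spaces, then there is a bijection $\sigma\colon\mathbb N\to\mathbb N$ such that $A\sim B_\sigma$. (iv) In $X$ all bases are quasi-equivalent.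
   Context: $\mathbb N=\{1,2,\dots\}$, $\mathbb N_0=\mathbb N\cup\{0\}$; all spaces are over $\mathbb C$. A Fréchet space is a complete metrizable locally convex space; a Fréchet ${}^*$-algebra is a Fréchet space which is an algebra with continuous multiplication and continuous involution. Isomorphisms ($\cong$) of Fréchet spaces are linear homeomorphisms; isomorphisms of Fréchet ${}^*$-algebras are moreover multiplicative and ${}^*$-preserving. The space of rapidly decreasing sequences is the Fréchet space $s=\{\xi\in\mathbb C^{\mathbb N}: |\xi|_q:=(\sum_{j}|\xi_j|^2j^{2q})^{1/2}<\infty \text{ for all } q\in\mathbb N_0\}$ with the norms $(|\cdot|_q)_{q\in\mathbb N_0}$. Its strong dual is identified with $s'=\{\xi\in\mathbb C^{\mathbb N}: |\xi|'_q:=(\sum_j|\xi_j|^2j^{-2q})^{1/2}<\infty\text{ for some }q\in\mathbb N_0\}$. $\mathcal L(s',s)$ is the Fréchet ${}^*$-algebra of all continuous linear operators $s'\to s$ with the topology of uniform convergence on bounded subsets of $s'$; since $s\subset\ell_2\subset s'$, each such operator restricts to a bounded operator on $\ell_2$, and the ${}^*$-algebra operations (composition and Hilbert space adjoint) are inherited from $\mathcal B(\ell_2)$. Bases are Schauder bases, indexed by $\mathbb N$; a basic sequence of $s$ is a sequence in $s$ that is a Schauder basis of its closed linear span in $s$. A Köthe matrix is a matrix $A=(a_{j,q})_{j\in\mathbb N,q\in\mathbb N_0}$ of nonnegative numbers such that for each $j$ there is $q$ with $a_{j,q}>0$, and $a_{j,q}\le a_{j,q+1}$ for all $j,q$. Then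 $\lambda^2(A)=\lambda^2(a_{j,q})=\{\xi\in\mathbb C^{\mathbb N}:(\sum_j|\xi_j|^2a_{j,q}^2)^{1/2}<\infty\text{ for all }q\in\mathbb N_0\}$, a Fréchet space with these seminorms. For Köthe matrices $A=(a_{j,q})$, $B=(b_{j,q})$ write $A\prec B$ if $\forall q\ \exists r\ \exists C>0\ \forall j:\ a_{j,q}\le C b_{j,r}$, and $A\sim B$ if $A\prec B$ and $B\prec A$. $A^2:=(a_{j,q}^2)_{j,q}$, and $B_\sigma:=(b_{\sigma(j),q})_{j,q}$ for a bijection $\sigma\colon\mathbb N\to\mathbb N$. Two bases $(x_j)_{j\in\mathbb N}$ and $(y_j)_{j\in\mathbb N}$ of a Fréchet space $X$ are quasi-equivalent if there are a bijection $\sigma\colon\mathbb N\to\mathbb N$ and a sequence $(\lambda_j)_{j\in\mathbb N}$ of nonzero scalars such that the operator $T\colon X\to X$ defined by $Tx_j=\lambda_jy_{\sigma(j)}$ is a Fréchet space isomorphism. *)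

(* Defs.v *)
From HB Require Import structures.
From mathcomp Require Import all_boot all_order all_algebra.
From mathcomp Require Import all_classical all_reals all_analysis.
From mathcomp Require Import complex ring lra.

Set Implicit Arguments.
Unset Strict Implicit.
Unset Printing Implicit Defensive.

Import Order.TTheory GRing.Theory Num.Theory.
Import ComplexField.Normc.
Import numFieldNormedType.Exports.

Local Open Scope classical_set_scope.
Local Open Scope ring_scope.
Local Open Scope complex_scope.

Lemma normrcE (R : realType) (z : R[i]) : `|z| = (normc z)%:C.
Proof. by case: z. Qed.

Lemma normc_ge0 (R : realType) (z : R[i]) : 0 <= normc z.
Proof. by case: z => u v; exact: sqrtr_ge0. Qed.

Section seminorm_topology.
Context {R : realType} {V : lmodType R[i]} (p : nat -> V -> R).
Hypothesis pD : forall q x y, p q (x + y) <= p q x + p q y.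
Hypothesis pZ : forall q a x, p q (a *: x) = normc a * p q x.

Definition semiball (n : nat) (e : R) (x : V) : set V :=
  [set y | forall q, (q <= n)%N -> p q (y - x) < e].

Definition seminbhs (x : V) : set_system V :=
  filter_from [set ne : nat * R | 0 < ne.2] (fun ne => semiball ne.1 ne.2 x).

Lemma seminorm0 q : p q 0 = 0.
Proof. by rewrite -(scale0r 0) pZ normc0 mul0r. Qed.

Lemma seminormN q x : p q (- x) = p q x.
Proof. by rewrite -scaleN1r pZ (normcN (1 : R[i])) normc1 mul1r. Qed.

Lemma seminorm_ge0 q x : 0 <= p q x.
Proof.
have := pD q x (- x); rewrite subrr seminorm0 seminormN -mulr2n.
by rewrite pmulrn_lge0.
Qed.

Lemma semiball_center n e x : 0 < e -> semiball n e x x.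
Proof. by move=> e0 q _; rewrite subrr seminorm0. Qed.

Lemma seminbhs_filter x : ProperFilter (seminbhs x).
Proof.
apply: filter_from_proper; last first.
  by move=> [n e] /= e0; exists x; exact: semiball_center.
apply: filter_from_filter; first by exists (0%N, 1) => /=.
move=> [n e] [m f] /= e0 f0; exists (maxn n m, Num.min e f) => /=.
  by rewrite lt_min e0 f0.
move=> y yB; split => q qn.
  by have := yB q (leq_trans qn (leq_maxl _ _)); rewrite lt_min => /andP[].
by have := yB q (leq_trans qn (leq_maxr _ _)); rewrite lt_min => /andP[].
Qed.

Lemma seminbhs_singleton x A : seminbhs x A -> A x.
Proof. by move=> [[n e] /= e0]; apply; exact: semiball_center. Qed.

Lemma semiball_fin n e x y : semiball n e x y ->
  exists2 d, 0 < d & forall q, (q <= n)%N -> p q (y - x) < e - d.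
Proof.
elim: n => [|n IH] yB.
  have h := yB 0%N (leqnn _); exists ((e - p 0%N (y - x)) / 2).
    by rewrite divr_gt0// subr_gt0.
  move=> q; rewrite leqn0 => /eqP->; lra.
have [d d0 dB] : exists2 d, 0 < d &
    forall q, (q <= n)%N -> p q (y - x) < e - d.
  by apply: IH => q qn; apply: yB; exact: leqW.
have h := yB n.+1 (leqnn _).
exists (Num.min d ((e - p n.+1 (y - x)) / 2)).
  by rewrite lt_min d0 divr_gt0// subr_gt0.
move=> q; rewrite leq_eqVlt => /predU1P[->|].
  have : Num.min d ((e - p n.+1 (y - x)) / 2) <= (e - p n.+1 (y - x)) / 2.
    by rewrite ge_min lexx orbT.
  by lra.
rewrite ltnS => /dB; have : Num.min d ((e - p n.+1 (y - x)) / 2) <= d.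
  by rewrite ge_min lexx.
by lra.
Qed.

Lemma semiball_open n e x y : semiball n e x y -> seminbhs y (semiball n e x).
Proof.
move=> /semiball_fin[d d0 dB]; exists (n, d) => //= z zB q qn.
have := dB q qn; have := zB q qn; have := pD q (z - y) (y - x).
by rewrite addrA subrK; lra.
Qed.

Lemma seminbhs_nbhs x A : seminbhs x A -> seminbhs x (seminbhs^~ A).
Proof.
move=> [[n e] /= e0 eA]; exists (n, e) => //= y /semiball_open[ne ne0 B].
by exists ne => //; exact: subset_trans eA.
Qed.


Definition seminormed : Type := (fun=> fun=> V : Type) pD pZ.

HB.instance Definition _ := GRing.Lmodule.copy seminormed V.
HB.instance Definition _ := hasNbhs.Build seminormed seminbhs.
HB.instance Definition _ := Nbhs_isNbhsTopological.Build seminormed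
  seminbhs_filter seminbhs_singleton seminbhs_nbhs.

Lemma seminormed_add_continuous :
  continuous (fun x : seminormed * seminormed => x.1 + x.2).
Proof.
move=> [x y] A [[n e] /= e0 eA].
have e20 : 0 < e / 2 by rewrite divr_gt0.
simpl; exists (semiball n (e / 2) x, semiball n (e / 2) y).
  by split; [exists (n, e / 2)|exists (n, e / 2)].
move=> [a b] /= [aB bB]; apply: eA => q qn.
have := aB q qn; have := bB q qn; have := pD q (a - x) (b - y).
by rewrite opprD addrACA; lra.
Qed.

Lemma seminormed_scale_continuous :
  continuous (fun z : R[i]^o * seminormed => z.1 *: z.2).
Proof.
move=> [a x] A [[n e] /= e0 eA].
pose M := \sum_(q < n.+1) p q x.
have M0 : 0 <= M by apply: sumr_ge0 => q _; exact: seminorm_ge0.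
have pM q : (q <= n)%N -> p q x <= M.
  move=> qn; rewrite /M (bigD1 (Ordinal (qn : (q < n.+1)%N)))//= lerDl.
  by apply: sumr_ge0 => i _; exact: seminorm_ge0.
pose d := Num.min 1 (e / (M + normc a + 2)).
have na : 0 <= normc a := normc_ge0 _.
have D0 : 0 < M + normc a + 2 by lra.
have d0 : 0 < d by rewrite lt_min ltr01 divr_gt0.
have d1 : d <= 1 by rewrite ge_min lexx.
have de : d * (M + normc a + 2) <= e.
  by rewrite -ler_pdivlMr// ge_min lexx orbT.
simpl; exists ([set b : R[i]^o | normc (b - a) < d], semiball n d x).
  split => /=; last by exists (n, d).
  exists d%:C => /=; first by rewrite ltcR.
  by move=> b; rewrite /ball_ /= distrC normrcE ltcR.
move=> [b y] /= [ba yB]; apply: eA => q qn.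
have h1 := yB q qn; have h2 := pM q qn.
have h3 : p q (b *: y - a *: x) <=
    normc (b - a) * p q (y - x) + normc (b - a) * p q x
    + normc a * p q (y - x).
  have -> : b *: y - a *: x = (b - a) *: (y - x) + (b - a) *: x + a *: (y - x).
    by rewrite -scalerDr subrK scalerBl scalerBr addrA subrK.
  by rewrite -!pZ (le_trans (pD _ _ _))// lerD2r pD.
have n0 : 0 <= normc (b - a) := normc_ge0 _.
have p0 : 0 <= p q (y - x) := seminorm_ge0 _ _.
have px0 : 0 <= p q x := seminorm_ge0 _ _.
have : normc (b - a) * p q (y - x) <= d * 1.
  by apply: ler_pM => //; lra.
have : normc (b - a) * p q x <= d * M by apply: ler_pM => //; lra.
have : normc a * p q (y - x) <= normc a * d by apply: ler_wpM2l => //; lra.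
by nra.
Qed.

Lemma seminormed_locally_convex :
  exists2 B : set_system seminormed, (forall b, b \in B -> convex_set b) & basis B.
Proof.
exists [set A | exists n e x, 0 < e /\ A = semiball n e x].
  move=> B; rewrite inE => -[n [e [x [e0 ->]]]] y z l; rewrite !inE => yB zB.
  move=> q qn.
  have l0 : (0 : R[i]) <= l%:inum by [].
  have l1 : l%:inum <= (1 : R[i]) by [].
  move: l0 l1; set a : R[i] := l%:inum => l0 l1.
  have -> : conv l y z - x = a *: (y - x) + (1 - a) *: (z - x).
    rewrite -[conv l y z]/(a *: (y : V) + (1 - a) *: (z : V)) !scalerBr addrACA -opprD -scalerDl.
    by rewrite [a + _]addrC subrK scale1r.
  move: l0 l1; case: (a) => u v; rewrite lecE/= => /andP[/eqP -> u0].
  rewrite lecE/= => /andP[_ u1].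
  rewrite (le_lt_trans (pD _ _ _))// !pZ.
  have -> : normc (u +i* 0) = u.
    by rewrite /normc expr0n addr0 sqrtr_sqr ger0_norm.
  have -> : normc (1 - u +i* 0) = 1 - u.
    rewrite /= oppr0 addr0 expr0n addr0 sqrtr_sqr ger0_norm//.
    by rewrite subr_ge0.
  have := yB q qn; have := zB q qn => h1 h2.
  have [->|u1'] := eqVneq u 1; first by rewrite subrr mul0r addr0 mul1r.
  have {}u1' : 0 < 1 - u by rewrite subr_gt0 lt_neqAle u1' u1.
  have : (1 - u) * p q (z - x) < (1 - u) * e by rewrite ltr_pM2l.
  have : u * p q (y - x) <= u * e by rewrite ler_wpM2l// ltW.
  lra.
split.
  move=> B [n [e [x [e0 ->]]]]; rewrite openE => y; exact: semiball_open.
move=> x A [[n e] /= e0 eA]; exists (semiball n e x) => //; split.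
  by exists n, e, x.
exact: semiball_center.
Qed.

HB.instance Definition _ :=
  PreTopologicalNmodule_isTopologicalNmodule.Build seminormed
    seminormed_add_continuous.
HB.instance Definition _ :=
  TopologicalNmodule_isTopologicalLmodule.Build R[i] seminormed
    seminormed_scale_continuous.
HB.instance Definition _ := PreTopologicalLmod_isTvs.Build R[i] seminormed
  seminormed_add_continuous seminormed_scale_continuous
  seminormed_locally_convex.
HB.instance Definition _ := Uniform_isTvs.Build R[i] seminormed
  seminormed_locally_convex.

End seminorm_topology.

Section weighted_l2.
Context {R : realType}.
Implicit Types (w : nat -> R) (x y : nat -> R[i]).

Definition wsum w x : \bar R :=
  \sum_(0 <= j <oo) ((normc (x j) * w j) ^+ 2)%:E.

Definition wnorm w x : R := Num.sqrt (fine (wsum w x)).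

Lemma wsum_ge0 w x : (0 <= wsum w x)%E.
Proof. by apply: nneseries_ge0 => j _ _; rewrite lee_fin sqr_ge0. Qed.

Lemma wsumZ w a x : wsum w (a *: x) = ((normc a ^+ 2)%:E * wsum w x)%E.
Proof.
rewrite /wsum -nneseriesZl; last by move=> j _; rewrite lee_fin sqr_ge0.
by apply: eq_eseriesr => j _; rewrite -EFinM -exprMn mulrA -normcM.
Qed.

Lemma wsumD_le w x y (a b : R) : 0 < a -> 0 < b ->
  (wsum w x <= (a ^+ 2)%:E)%E -> (wsum w y <= (b ^+ 2)%:E)%E ->
  (wsum w (x + y)%R <= ((a + b) ^+ 2)%:E)%E.
Proof.
move=> a0 b0 xa yb.
have ab0 : 0 < b / a by rewrite divr_gt0.
have ba0 : 0 < a / b by rewrite divr_gt0.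
apply: (@le_trans _ _ ((1 + b / a)%:E * wsum w x + (1 + a / b)%:E * wsum w y)%E).
  rewrite /wsum -!nneseriesZl; try by move=> j _; rewrite lee_fin sqr_ge0.
  rewrite -nneseriesD; try by
    move=> j _ _; rewrite -EFinM lee_fin mulr_ge0 ?sqr_ge0// addr_ge0// ltW.
  apply: lee_nneseries => [j _ _|j _]; first by rewrite lee_fin sqr_ge0.
  rewrite -!EFinM -EFinD lee_fin !exprMn (mulrA (1 + b / a)) (mulrA (1 + a / b)).
  rewrite -mulrDl.
  apply: ler_wpM2r; first exact: sqr_ge0.
  apply: (@le_trans _ _ ((normc (x j) + normc (y j)) ^+ 2)).
    rewrite ler_sqr ?nnegrE ?addr_ge0 ?normc_ge0//.
    exact: (le_normcD (x j) (y j)).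
  set u := normc _; set v := normc _.
  have -> : (1 + b / a) * u ^+ 2 + (1 + a / b) * v ^+ 2 =
      (u + v) ^+ 2 + (b * u - a * v) ^+ 2 / (a * b).
    by field; rewrite (gt_eqF a0) (gt_eqF b0).
  by rewrite lerDl divr_ge0 ?sqr_ge0// mulr_ge0// ltW.
have -> : (a + b) ^+ 2 = (1 + b / a) * a ^+ 2 + (1 + a / b) * b ^+ 2.
  by field; rewrite (gt_eqF a0) (gt_eqF b0).
rewrite [X in (_ <= X)%E]EFinD [X in (_ <= X + _)%E]EFinM [X in (_ <= _ + X)%E]EFinM.
by apply: leeD; rewrite lee_pmul2l ?lte_fin ?addr_gt0.
Qed.

Lemma wnorm_ge0 w x : 0 <= wnorm w x.
Proof. exact: sqrtr_ge0. Qed.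

Lemma wsumE w x : (wsum w x < +oo)%E -> wsum w x = (wnorm w x ^+ 2)%:E.
Proof.
move=> xoo; rewrite sqr_sqrtr ?fine_ge0 ?wsum_ge0// fineK//.
by rewrite ge0_fin_numE// wsum_ge0.
Qed.

Lemma wnorm_le w x (a : R) : 0 <= a -> (wsum w x <= (a ^+ 2)%:E)%E ->
  wnorm w x <= a.
Proof.
move=> a0 xa; rewrite -(ler_sqr (_ : _ \is Num.nneg)) ?nnegrE ?wnorm_ge0//.
by rewrite -lee_fin -wsumE// (le_lt_trans xa)// ltry.
Qed.

Lemma wnormE w x (e : R) : 0 < e -> (wsum w x < +oo)%E ->
  (wsum w x <= ((wnorm w x + e) ^+ 2)%:E)%E.
Proof.
move=> e0 /wsumE ->; have := wnorm_ge0 w x => h.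
by rewrite lee_fin ler_sqr ?nnegrE; lra.
Qed.

Lemma wsumD_lty w x y : (wsum w x < +oo)%E -> (wsum w y < +oo)%E ->
  (wsum w (x + y)%R < +oo)%E.
Proof.
move=> /(wnormE ltr01) hx /(wnormE ltr01) hy.
have := wnorm_ge0 w x; have := wnorm_ge0 w y => h1 h2.
apply: le_lt_trans (wsumD_le _ _ hx hy) (ltry _); lra.
Qed.

Lemma wsumZ_lty w a x : (wsum w x < +oo)%E -> (wsum w (a *: x) < +oo)%E.
Proof.
by move=> /wsumE h; rewrite wsumZ h -EFinM ltry.
Qed.

Lemma wsum0 w : wsum w 0 = 0%E.
Proof. by rewrite -(scale0r (0 : nat -> R[i])) wsumZ normc0 expr0n mul0e. Qed.

Lemma wnormD w x y : (wsum w x < +oo)%E -> (wsum w y < +oo)%E ->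
  wnorm w (x + y) <= wnorm w x + wnorm w y.
Proof.
move=> xoo yoo; apply/ler_addgt0Pr => e e0.
have e20 : 0 < e / 2 by rewrite divr_gt0.
have := wnorm_ge0 w x; have := wnorm_ge0 w y => h1 h2.
have h := wsumD_le _ _ (wnormE e20 xoo) (wnormE e20 yoo).
apply: le_trans (wnorm_le _ (h _ _)) _; lra.
Qed.

Lemma wnormZ w a x : (wsum w x < +oo)%E ->
  wnorm w (a *: x) = normc a * wnorm w x.
Proof.
move=> /wsumE h; rewrite {1}/wnorm wsumZ h -EFinM/= -exprMn sqrtr_sqr ger0_norm//.
by rewrite mulr_ge0// ?normc_ge0// wnorm_ge0.
Qed.

End weighted_l2.

Section tvs_notions.
Context {K : numFieldType}.

(* Bounded in the sense of von Neumann: absorbed by every neighbourhood of 0. *)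
Definition vbounded {V : preTopologicalLmodType K} (B : set V) : Prop :=
  forall U : set V, nbhs 0 U ->
    exists2 r : K, 0 < r & forall a : K, r <= `|a| -> B `<=` *:%R a @` U.

Lemma continuous_linear_comb {U : topologicalType} {V : tvsType K}
  (a : K) (f g : U -> V) :
  continuous f -> continuous g -> continuous (fun x => a *: f x + g x).
Proof.
move=> fc gc x.
have afc : a *: f y @[y --> x] --> a *: f x.
  apply: (@continuous_comp U (K^o * V)%type V (fun y => (a, f y))
    (fun z => z.1 *: z.2)); last exact: scale_continuous.
  apply: (@cvg_pair _ _ _ _ (nbhs (a : K^o)) (nbhs (f x))).
  exact: cvg_cst.
  exact: fc.
apply: (@continuous_comp U (V * V)%type V (fun y => (a *: f y, g y))
  (fun z => z.1 + z.2)); last exact: add_continuous.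
by apply: cvg_pair => /=; [exact: afc|exact: gc].
Qed.

End tvs_notions.

Section complex_series.
Context {R : realType}.
Implicit Types u x y : nat -> R[i].

Definition csum u : R[i] := limn (series (u : nat -> R[i]^o)).

Lemma cvg_csum u (M : R) : (\sum_(0 <= j <oo) (normc (u j))%:E <= M%:E)%E ->
  series (u : nat -> R[i]^o) @ \oo --> (csum u : R[i]^o).
Proof.
move=> uM.
have part n : \sum_(0 <= j < n) normc (u j) <= M.
  rewrite -lee_fin (le_trans _ uM)// -sumEFin.
  by apply: nneseries_lim_ge => k _; rewrite lee_fin normc_ge0.
have cvgF (f : R[i] -> R) : (forall z, `|f z| <= normc z) ->
    cvgn (series (f \o u)).
  move=> fn; apply: normed_cvg; apply: nondecreasing_is_cvgn.
    apply/nondecreasing_seqP => n.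
    by rewrite /series/= [leRHS]big_nat_recr//= lerDl.
  exists M => _ [n _ <-]; apply: le_trans (part n); rewrite /series/=.
  by apply: ler_sum => j _; exact: fn.
have cRe : cvgn (series (@complex.Re R \o u)).
  by apply: cvgF => z; have := normc_ge_Re z; rewrite normrcE lecR.
have cIm : cvgn (series (@complex.Im R \o u)).
  apply: cvgF => -[a b] /=; rewrite -sqrtr_sqr ler_wsqrtr// lerDr.
  exact: sqr_ge0.
set a := limn (series (@complex.Re R \o u)).
set b := limn (series (@complex.Im R \o u)).
have uE n : series (u : nat -> R[i]^o) n =
    series (@complex.Re R \o u) n +i* series (@complex.Im R \o u) n.
  rewrite /series/=; elim: n => [|n IH]; first by rewrite !big_geq.
  by rewrite !big_nat_recr//= IH; case: (u n).
have ul : series (u : nat -> R[i]^o) @ \oo --> ((a +i* b) : R[i]^o).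
  apply/(@cvgrPdist_lt R[i] R[i]^o) => -[e e'].
  rewrite ltcE/= => /andP[/eqP -> e0] {e'}.
  have e20 : 0 < e / 2 by rewrite divr_gt0.
  move/cvgrPdist_lt : cRe => /(_ _ e20) cRe.
  move/cvgrPdist_lt : cIm => /(_ _ e20) cIm.
  near=> n.
  have h1 : `|a - series (@complex.Re R \o u) n| < e / 2 by near: n.
  have h2 : `|b - series (@complex.Im R \o u) n| < e / 2 by near: n.
  rewrite uE normrcE ltcR /=.
  rewrite -(ltr_sqr (_ : _ \is Num.nneg)) ?nnegrE ?sqrtr_ge0 ?(ltW e0)//.
  rewrite sqr_sqrtr ?addr_ge0 ?sqr_ge0//.
  move: h1 h2; set c := a - _; set d := b - _.
  rewrite !ltr_norml => /andP[c1 c2] /andP[d1 d2]; nra.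
by have -> : csum u = a +i* b by apply: (@cvg_lim R[i]^o).
Unshelve. all: by end_near. Qed.

Lemma normc_csum_le u (M : R) :
  (\sum_(0 <= j <oo) (normc (u j))%:E <= M%:E)%E -> normc (csum u) <= M.
Proof.
move=> uM; have ul := cvg_csum uM.
have part n : \sum_(0 <= j < n) normc (u j) <= M.
  rewrite -lee_fin (le_trans _ uM)// -sumEFin.
  by apply: nneseries_lim_ge => k _; rewrite lee_fin normc_ge0.
apply/ler_addgt0Pr => e e0.
have ee : 0 < e%:C by rewrite ltcR.
move/(@cvgrPdist_lt R[i] R[i]^o) : ul => /(_ _ ee) [n _ /(_ n (leqnn n))] /=.
rewrite normrcE ltcR => ne.
have := le_normcD (csum u - series (u : nat -> R[i]^o) n) (series (u : nat -> R[i]^o) n).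
rewrite subrK => /le_trans; apply; rewrite addrC lerD ?(ltW ne)//.
apply: le_trans (part n); rewrite /series/=; clear.
elim: n => [|n IH]; first by rewrite !big_geq// normc0.
by rewrite !big_nat_recr//= (le_trans (le_normcD _ _))// lerD2r.
Qed.

Lemma csumB u v (M N : R) :
  (\sum_(0 <= j <oo) (normc (u j))%:E <= M%:E)%E ->
  (\sum_(0 <= j <oo) (normc (v j))%:E <= N%:E)%E ->
  csum u - csum v = csum (fun j => u j - v j).
Proof.
move=> /cvg_csum uM /cvg_csum vN.
have h : series ((fun j => u j - v j) : nat -> R[i]^o) @ \oo -->
    (csum u - csum v : R[i]^o).
  have -> : series ((fun j => u j - v j) : nat -> R[i]^o) =
      (fun n => series (u : nat -> R[i]^o) n - series (v : nat -> R[i]^o) n).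
    by apply/funext => n; rewrite /series/= sumrB.
  exact: (@cvgB R[i] R[i]^o nat \oo _ _ _ _ _ uM vN).
by have := @cvg_lim R[i]^o _ _ _ _ _ _ h; rewrite /csum => ->.
Qed.

End complex_series.

Section lambda2.
Context {R : realType} (A : nat -> nat -> R).

Definition lambda2_mem : {pred nat -> R[i]} :=
  fun x => `[< forall q, (wsum (A ^~ q) x < +oo)%E >].

Record lambda2 := Lambda2 {
  lambda2_seq :> nat -> R[i] ;
  lambda2_seqP : lambda2_seq \in lambda2_mem }.

HB.instance Definition _ := [isSub for lambda2_seq].
HB.instance Definition _ := [Choice of lambda2 by <:].

Lemma lambda2_submod_closed : submod_closed lambda2_mem.
Proof.
split=> [|a x y /asboolP xA /asboolP yA]; apply/asboolP => q.
  by rewrite wsum0 ltry.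
by apply: wsumD_lty => //; exact: wsumZ_lty.
Qed.

HB.instance Definition _ := GRing.SubChoice_isSubLmodule.Build R[i]
  (nat -> R[i]) lambda2_mem lambda2 lambda2_submod_closed.

Definition lnorm (q : nat) (x : lambda2) : R := wnorm (A ^~ q) x.

Lemma lambda2_lty q (x : lambda2) : (wsum (A ^~ q) x < +oo)%E.
Proof. by have /asboolP := lambda2_seqP x. Qed.

Lemma lnormD q x y : lnorm q (x + y) <= lnorm q x + lnorm q y.
Proof. by apply: wnormD; exact: lambda2_lty. Qed.

Lemma lnormZ q a x : lnorm q (a *: x) = normc a * lnorm q x.
Proof. by apply: wnormZ; exact: lambda2_lty. Qed.

HB.instance Definition _ := Tvs.copy lambda2 (seminormed lnormD lnormZ).

End lambda2.

Section rapidly_decreasing.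
Context (R : realType).

Definition s_space := @lambda2 R (fun j q => j.+1%:R ^+ q).
HB.instance Definition _ := Tvs.on s_space.

Definition s_dual_mem : {pred nat -> R[i]} :=
  fun x => `[< exists q, (wsum (fun j => j.+1%:R ^- q) x < +oo)%E >].

Record s_dual := SDual {
  s_dual_seq :> nat -> R[i] ;
  s_dual_seqP : s_dual_seq \in s_dual_mem }.

HB.instance Definition _ := [isSub for s_dual_seq].
HB.instance Definition _ := [Choice of s_dual by <:].

Lemma wsum_le (w v : nat -> R) x : (forall j, 0 <= w j <= v j) ->
  (wsum w x <= wsum v x)%E.
Proof.
move=> wv; apply: lee_nneseries => [j _ _|j _]; rewrite lee_fin ?sqr_ge0//.
have /andP[w0 wvj] := wv j.
by rewrite ler_sqr ?nnegrE ?mulr_ge0 ?normc_ge0 ?ler_wpM2l ?normc_ge0// (le_trans w0).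
Qed.

Lemma s_dual_submod_closed : submod_closed s_dual_mem.
Proof.
split=> [|a x y /asboolP[q xq] /asboolP[r yr]]; apply/asboolP.
  by exists 0%N; rewrite wsum0 ltry.
have le k l : (forall j : nat, 0 <= (j.+1%:R ^- (k + l) : R) <= j.+1%:R ^- k).
  move=> j; rewrite invr_ge0 exprn_ge0//= lef_pV2 ?posrE ?exprn_gt0//.
  by rewrite ler_weXn2l ?leq_addr// ler1n.
exists (q + r)%N; apply: wsumD_lty.
  by apply: wsumZ_lty; apply: le_lt_trans xq; apply: wsum_le => j; exact: le.
by apply: le_lt_trans yr; apply: wsum_le => j; rewrite addnC; exact: le.
Qed.

HB.instance Definition _ := GRing.SubChoice_isSubLmodule.Build R[i]
  (nat -> R[i]) s_dual_mem s_dual s_dual_submod_closed.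


Definition dual_pair (x : s_dual) : s_space -> R[i]^o :=
  fun y => csum (fun j => x j * y j).

HB.instance Definition _ := Uniform.copy s_dual
  (initial_topology (dual_pair : s_dual -> {family @vbounded _ s_space, s_space -> R[i]^o})).

Lemma s_sub_dual (x : s_space) : (x : nat -> R[i]) \in s_dual_mem.
Proof.
apply/asboolP; exists 0%N; apply: le_lt_trans (lambda2_lty 0 x).
by apply: wsum_le => j; rewrite !expr0 invr1 ler01 lexx.
Qed.

Definition s_incl (x : s_space) : s_dual := SDual (s_sub_dual x).

Lemma wsum_mul_le (w v : nat -> R) (x y : nat -> R[i]) (a b : R) :
  0 < a -> 0 < b -> (forall j, w j * v j = 1) ->
  (wsum w x <= (a ^+ 2)%:E)%E -> (wsum v y <= (b ^+ 2)%:E)%E ->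
  (\sum_(0 <= j <oo) (normc (x j * y j))%:E <= (a * b)%:E)%E.
Proof.
move=> a0 b0 wv xa yb.
have c0 : 0 < b / a / 2 by rewrite !divr_gt0.
have d0 : 0 < a / b / 2 by rewrite !divr_gt0.
apply: (@le_trans _ _
    ((b / a / 2)%:E * wsum w x + (a / b / 2)%:E * wsum v y)%E).
  rewrite /wsum -!nneseriesZl; try by move=> j _; rewrite lee_fin sqr_ge0.
  rewrite -nneseriesD; try by
    move=> j _ _; rewrite -EFinM lee_fin mulr_ge0 ?sqr_ge0// ltW.
  apply: lee_nneseries => [j _ _|j _]; first by rewrite lee_fin normc_ge0.
  rewrite -!EFinM -EFinD lee_fin normcM.
  have -> : normc (x j) * normc (y j) = (normc (x j) * w j) * (normc (y j) * v j).
    by rewrite mulrACA wv mulr1.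
  set z := normc _ * w j; set t := normc _ * v j.
  have -> : b / a / 2 * z ^+ 2 + a / b / 2 * t ^+ 2 =
      z * t + (b * z - a * t) ^+ 2 / (2 * (a * b)).
    by field; rewrite (gt_eqF a0) (gt_eqF b0).
  by rewrite lerDl divr_ge0 ?sqr_ge0// !mulr_ge0// ltW.
have -> : a * b = (b / a / 2) * a ^+ 2 + (a / b / 2) * b ^+ 2.
  by field; rewrite (gt_eqF a0) (gt_eqF b0).
rewrite [X in (_ <= X)%E]EFinD [X in (_ <= X + _)%E]EFinM.
rewrite [X in (_ <= _ + X)%E]EFinM.
by apply: leeD; rewrite lee_pmul2l ?lte_fin.
Qed.


Lemma s_incl_continuous : continuous s_incl.
Proof.
suff : continuous ((dual_pair : s_dual -> {family @vbounded _ s_space, s_space -> R[i]^o})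
    \o s_incl) by apply: continuous_comp_initial.
move=> x; apply/fam_cvgP => [|B Bb].
  apply: (@fmap_filter s_space (s_space -> R[i]^o) (dual_pair \o s_incl) (nbhs x)); exact: nbhs_filter.  
have [K K0 BK] : exists2 K : R, 0 < K & forall y, B y -> lnorm 0 y <= K.
  have U0 : nbhs (0 : s_space) [set y : s_space | lnorm 0 y < 1].
    by exists (0%N, 1) => //= y /(_ 0%N isT); rewrite subr0.
  have [r r0 rB] := Bb _ U0.
  have nr0 : 0 < normc r by rewrite -ltcR -normrcE gtr0_norm.
  exists (normc r) => // y /(rB r); rewrite gtr0_norm// => /(_ (lexx _)).
  by move=> [u u1 <-]; rewrite lnormZ ler_piMr ?normc_ge0// ltW.
move=> P /uniform_nbhs[E [+ EP]].
rewrite -entourage_ballE => -[/= e e0 eE].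
have [f f0 ef] : exists2 f : R, 0 < f & e = f%:C.
  by case: (e) e0 => f g; rewrite ltcE/= => /andP[/eqP -> ?]; exists f.
have d0 : 0 < f / K / 2 by rewrite !divr_gt0.
exists (0%N, f / K / 2) => //= y /(_ 0%N isT) xy; apply: EP => z Bz; apply: eE.
rewrite -ball_normE/= ef normrcE ltcR.
have one j : (j.+1%:R ^+ 0 : R) * j.+1%:R ^+ 0 = 1 by rewrite mulr1.
have bd (x1 y1 : s_space) := wsum_mul_le
  (ltr_wpDl (wnorm_ge0 _ _) ltr01) (ltr_wpDl (wnorm_ge0 _ _) ltr01) one
  (wnormE ltr01 (lambda2_lty 0 x1)) (wnormE ltr01 (lambda2_lty 0 y1)).
rewrite /dual_pair (csumB (bd x z) (bd y z)).
have zK : (wsum (fun j => j.+1%:R ^+ 0)%R z <= (K ^+ 2)%:E)%E.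
  rewrite wsumE ?(lambda2_lty 0 z)// lee_fin ler_sqr ?nnegrE ?wnorm_ge0 ?(ltW K0)//.
  exact: BK.
have xyd : (wsum (fun j => j.+1%:R ^+ 0)%R (x - y)%R <= ((f / K / 2) ^+ 2)%:E)%E.
  rewrite wsumE ?(lambda2_lty 0 (x - y))// lee_fin ler_sqr ?nnegrE ?wnorm_ge0 ?(ltW d0)//.
  by rewrite -[wnorm _ _]/(lnorm 0 (x - y)) -(seminormN (@lnormZ _ _)) opprB ltW.
apply: (@le_lt_trans _ _ (f / K / 2 * K)).
  apply: normc_csum_le; apply: le_trans (wsum_mul_le d0 K0 one xyd zK).
  apply: lee_nneseries => [j _ _|j _]; rewrite lee_fin ?normc_ge0//.
  by rewrite -mulrBl.
have -> : f / K / 2 * K = f / 2 by field; rewrite gt_eqF.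
lra.
Qed.

Lemma s_incl_linear : linear s_incl.
Proof. by move=> a x y; apply: val_inj. Qed.

Definition Lss_mem : {pred s_dual -> s_space} :=
  fun T => `[< linear T /\ continuous T >].

Record Lss := MkLss {
  Lss_fun :> s_dual -> s_space ;
  Lss_funP : Lss_fun \in Lss_mem }.

HB.instance Definition _ := [isSub for Lss_fun].
HB.instance Definition _ := [Choice of Lss by <:].

Lemma Lss_submod_closed : submod_closed Lss_mem.
Proof.
split=> [|a T S /asboolP[Tl Tc] /asboolP[Sl Sc]]; apply/asboolP; split.
- by move=> b x y; rewrite scaler0 addr0.
- exact: cst_continuous.
- move=> b x y.
  rewrite -![(_ + _ : s_dual -> s_space) _]/(a *: T _ + S _).
  by rewrite Tl Sl !scalerDr !scalerA [a * b]mulrC addrACA.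
- exact: continuous_linear_comb.
Qed.

HB.instance Definition _ := GRing.SubChoice_isSubLmodule.Build R[i]
  (s_dual -> s_space) Lss_mem Lss Lss_submod_closed.

HB.instance Definition _ := Uniform.copy Lss
  (initial_topology (Lss_fun : Lss -> {family @vbounded _ s_dual, s_dual -> s_space})).

Lemma Lss_mul_subproof (S T : Lss) : S \o s_incl \o T \in Lss_mem.
Proof.
have /asboolP[Sl Sc] := Lss_funP S; have /asboolP[Tl Tc] := Lss_funP T.
apply/asboolP; split.
  by move=> a x y; rewrite /= Tl s_incl_linear Sl.
move=> x; apply: continuous_comp; first exact: Tc.
by apply: continuous_comp; [exact: s_incl_continuous|exact: Sc].
Qed.

Definition Lss_mul (S T : Lss) : Lss := MkLss (Lss_mul_subproof S T).

End rapidly_decreasing.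

Section frechet_isomorphisms.
Context {K : numFieldType}.
Implicit Types U V : preTopologicalLmodType K.

Definition linear_subspace {V} (X : set V) : Prop :=
  X 0 /\ forall (a : K) x y, X x -> X y -> X (a *: x + y).

Definition lin_span {V} (S : set V) : set V :=
  [set x | exists (n : nat) (a : 'I_n -> K) (v : 'I_n -> V),
    (forall i, S (v i)) /\ x = \sum_(i < n) a i *: v i].

Definition infinite_dimensional {V} (X : set V) : Prop :=
  ~ exists (n : nat) (v : 'I_n -> V), X `<=` lin_span (range v).

(* T is only relevant on E, and the topologies on E and F are those induced
   by U and V. *)
Definition frechet_iso_map {U V} (E : set U) (F : set V) (T : U -> V) : Prop :=
  [/\ forall (a : K) x y, E x -> E y -> T (a *: x + y) = a *: T x + T y,
      set_bij E F T,
      {within E, continuous T} &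
      exists2 S : V -> U,
        forall x, E x -> S (T x) = x & {within F, continuous S}].

Definition frechet_iso {U V} (E : set U) (F : set V) : Prop :=
  exists T : U -> V, frechet_iso_map E F T.

Definition schauder_basis {V} (X : set V) (x : nat -> V) : Prop :=
  (forall j, X (x j)) /\
  forall y, X y ->
    exists! t : nat -> K, series (fun j => t j *: x j) @ \oo --> y.

Definition basic_sequence {V} (x : nat -> V) : Prop :=
  schauder_basis (closure (lin_span (range x))) x.

Definition quasi_equivalent {V} (X : set V) (x y : nat -> V) : Prop :=
  exists (sigma : nat -> nat) (lambda : nat -> K),
    [/\ bijective sigma, forall j, lambda j != 0 &
        exists2 T : V -> V, frechet_iso_map X X T &
          forall j, T (x j) = lambda j *: y (sigma j)].

End frechet_isomorphisms.

Section operator_algebras.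
Context {R : realType}.

Definition l2_mem (x : nat -> R[i]) : Prop := (wsum (fun=> 1%R) x < +oo)%E.

Definition l2_dot (x y : nat -> R[i]) : R[i] := csum (fun j => x j * (y j)^*).

Definition orthonormal_seq (f : nat -> s_space R) : Prop :=
  forall j k, l2_dot (f j) (f k) = (j == k)%:R.

(* The restriction of T' to l2 is the Hilbert space adjoint of the restriction
   of T to l2. *)
Definition Lss_adjoint (T T' : Lss R) : Prop :=
  forall x y : s_dual R, l2_mem x -> l2_mem y ->
    l2_dot (T x) y = l2_dot x (T' y).

Definition star_subalgebra (E : set (Lss R)) : Prop :=
  [/\ linear_subspace E,
      forall S T, E S -> E T -> E (Lss_mul S T) &
      forall T, E T -> exists2 T', E T' & Lss_adjoint T T'].

Definition commutative_set (E : set (Lss R)) : Prop :=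
  forall S T, E S -> E T -> Lss_mul S T = Lss_mul T S.

Definition closed_commutative_star_subalgebra (E : set (Lss R)) : Prop :=
  [/\ star_subalgebra E, commutative_set E & closed E].

Definition frechet_star_iso (E F : set (Lss R)) : Prop :=
  exists Phi : Lss R -> Lss R,
    [/\ frechet_iso_map E F Phi,
        forall S T, E S -> E T -> Phi (Lss_mul S T) = Lss_mul (Phi S) (Phi T) &
        forall T T', E T -> E T' -> Lss_adjoint T T' ->
          Lss_adjoint (Phi T) (Phi T')].

End operator_algebras.

Section kothe_matrices.
Context {R : realType}.
Implicit Types A B : nat -> nat -> R.

Definition kothe_matrix A : Prop :=
  [/\ forall j q, 0 <= A j q, forall j, exists q, 0 < A j q &
      forall j q, A j q <= A j q.+1].

Definition kothe_prec A B : Prop :=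
  forall q, exists r, exists2 c : R, 0 < c & forall j, A j q <= c * B j r.

Definition kothe_equiv A B : Prop := kothe_prec A B /\ kothe_prec B A.

Definition kothe_sqr A : nat -> nat -> R := fun j q => A j q ^+ 2.

Definition kothe_perm (sigma : nat -> nat) A : nat -> nat -> R :=
  fun j q => A (sigma j) q.

Definition norm_matrix (f : nat -> s_space R) : nat -> nat -> R :=
  fun j q => lnorm q (f j).

End kothe_matrices.

(* Main.v *)
Require Import Defs.
From HB Require Import structures.
From mathcomp Require Import all_boot all_order all_algebra.
From mathcomp Require Import all_classical all_reals all_analysis.
From mathcomp Require Import complex ring lra zify.
Set Implicit Arguments.
Unset Strict Implicit.
Unset Printing Implicit Defensive.
Import Order.TTheory GRing.Theory Num.Theory.
Import ComplexField.Normc.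
Import numFieldNormedType.Exports.
Local Open Scope classical_set_scope.
Local Open Scope ring_scope.
Local Open Scope complex_scope.

(** All four conditions say that the isomorphism class of a space
    $\lambda^2(A)$ with $A \sim A^2$ and $\lambda^2(A) \cong X$ determines the
    matrix $A$ up to $\sim$ and a permutation of the indices; they say it for
    commutative operator algebras, for orthonormal sequences, for matrices and
    for bases. The proof translates each language into the next one.

    Throughout, operators are handled through their columns $T e_k$ and the
    weighted Hilbert-Schmidt norms
    $hs_{p,q}(T) = (\sum_k (k+1)^{2p} |T e_k|_q^2)^{1/2}$, which define the
    topology of $L(s',s)$ (Lss_nbhsP). On a closed commutative
    $*$-subalgebra $E$ all operators are normal, so that
    $|T e_k|_0 = |T^* e_k|_0$, and already the norms $hs_{q,0}$ suffice
    (alg_graded). These are Hilbert norms for which mutually orthogonal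
    projections are orthogonal. Hence, if $E$ has a spectral basis, that is a
    complete sequence $(e_j)$ of pairwise orthogonal minimal projections, then
    $E$ is isometric to $\lambda^2(hs_{q,0}(e_j))$ for all norms at once
    (spectral_model), with $*$-algebra operations acting coordinatewise.

    From algebras to orthonormal sequences (algebras_orthonormal). An
    orthonormal sequence $f$ in $s$ gives the rank-one projections
    $x \mapsto \langle x, f_j \rangle f_j$. They form a spectral basis of the
    closed algebra which they span, and $hs_{q,0}$ of the $j$-th one is exactly
    $|f_j|_q$. An isomorphism of such algebras permutes the minimal
    projections, and its continuity in both directions is the equivalence of
    the two norm matrices.

    From orthonormal sequences to matrices (orthonormal_kothe). Each $A$ as
    above is equivalent to the norm matrix of an orthonormal basic sequence
    (kothe_realization). As $X$ lies in $s$, its norms satisfy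
    $|x|_q^2 \le |x|_0 |x|_{2q}$, and among $n+1$ linearly independent vectors
    some combination vanishes in the first $n$ coordinates and is therefore
    small in all norms; with $A \sim A^2$ this forces
    $\sum_j a_{j,r}^{-2} < \infty$ for some $r$
    (kothe_inverse_square_summable). So there is room for distinct indices
    $m_{j,k} \ge a_{j,k}$ which are bounded by polynomials in the entries of
    the row $j$, and vectors $f_j$ with rapidly decreasing coefficients on the
    disjoint blocks $\{m_{j,k} : k\}$ do the job.

    From matrices to bases (kothe_quasi_equivalence). A basis $(x_j)$ of $X$
    has equicontinuous expansions, and $X$ is then $\lambda^2(|x_j|_q)$ as in
    the theorem of Dynin and Mityagin (basis_model); both steps are proved
    here by hand inside $s$, by a Baire category argument and by a count of
    linearly independent vectors. If moreover $|x_j|_0 = 1$, the norm matrix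
    $A$ satisfies $A \sim A^2$, again because $|x|_q^2 \le |x|_0 |x|_{2q}$.

    From bases to algebras (quasi_equivalence_algebras). An infinite-dimensional
    closed commutative $*$-subalgebra has a spectral basis (spectral_exists):
    after a normalisation the even powers of a self-adjoint element converge to
    a projection, and each projection dominates a minimal one because $hs_{0,0}$
    is at least 1 on nonzero projections and its square is additive. Two
    algebras isomorphic to $X$ thus yield two bases of $X$. Quasi-equivalence
    compares the two matrices up to scalar factors, and these are absorbed since
    the matrices have entries at least 1 and dominate their squares
    (submult_scale). The resulting equivalence of matrices is an isomorphism of
    the algebras, as their operations are coordinatewise. *)

(** * Weighted square sums of complex sequences *)

Section weighted_sums.
Context {R : realType}.
Implicit Types (w v : nat -> R) (x y : nat -> R[i]).

Definition wpsum w x n : R := \sum_(j < n) (normc (x j) * w j) ^+ 2.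

(** Reduces every statement on the extended-real series to its finite partial
    sums, which is how the weighted norms are handled below. *)
Lemma wsum_leP w x M : (wsum w x <= M%:E)%E <-> forall n, wpsum w x n <= M.
Proof.
have t0 j : (0 <= ((normc (x j) * w j) ^+ 2)%:E)%E by rewrite lee_fin sqr_ge0.
split=> [xM n|xM].
  rewrite -lee_fin (le_trans _ xM)// /wpsum -sumEFin.
  rewrite -(big_mkord xpredT (fun j => ((normc (x j) * w j) ^+ 2)%:E)).
  exact: nneseries_lim_ge.
apply: lime_le; first exact: is_cvg_nneseries.
by apply: nearW => n; rewrite big_mkord sumEFin lee_fin; exact: xM.
Qed.

Lemma wsum_lty w x M : (forall n, wpsum w x n <= M) -> (wsum w x < +oo)%E.
Proof. by move=> xM; apply: le_lt_trans ((wsum_leP w x _).2 xM) _; rewrite ltry. Qed.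

Lemma wpsum_le_wnorm w x n : (wsum w x < +oo)%E ->
  wpsum w x n <= wnorm w x ^+ 2.
Proof. by move=> /wsumE h; apply: (wsum_leP w x _).1; rewrite h. Qed.

Lemma wnorm_leP w x a : (wsum w x < +oo)%E -> 0 <= a ->
  wnorm w x <= a <-> forall n, wpsum w x n <= a ^+ 2.
Proof.
move=> xoo a0; split=> [xa n|xa]; last by apply: wnorm_le => //; exact: (wsum_leP w x _).2.
by rewrite (le_trans (wpsum_le_wnorm _ xoo))// ler_sqr ?nnegrE ?wnorm_ge0.
Qed.

Lemma wpsum_term w x j n : (j < n)%N -> (normc (x j) * w j) ^+ 2 <= wpsum w x n.
Proof.
move=> jn; rewrite /wpsum (bigD1 (Ordinal jn))//= lerDl.
by apply: sumr_ge0 => i _; rewrite sqr_ge0.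
Qed.

Lemma normc_le_wnorm w x j : (wsum w x < +oo)%E -> 0 <= w j ->
  normc (x j) * w j <= wnorm w x.
Proof.
move=> xoo w0; rewrite -(ler_sqr (_ : _ \is Num.nneg)) ?nnegrE ?wnorm_ge0//.
  exact: le_trans (wpsum_term _ _ (ltnSn j)) (wpsum_le_wnorm _ xoo).
by rewrite mulr_ge0 ?normc_ge0.
Qed.

Lemma wpsumSr w x n : wpsum w x n.+1 = wpsum w x n + (normc (x n) * w n) ^+ 2.
Proof. by rewrite /wpsum big_ord_recr. Qed.

Lemma wpsum_homo w x n m : (n <= m)%N -> wpsum w x n <= wpsum w x m.
Proof.
elim: m => [|m IH]; first by rewrite leqn0 => /eqP->.
rewrite leq_eqVlt => /predU1P[->//|]; rewrite ltnS => /IH /le_trans; apply.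
by rewrite wpsumSr lerDl sqr_ge0.
Qed.

Lemma wpsum_tail w x e : (wsum w x < +oo)%E -> 0 < e ->
  exists n0, forall n, (n0 <= n)%N -> wnorm w x ^+ 2 - e < wpsum w x n.
Proof.
move=> xoo e0; apply: contrapT => h.
have hM n : wpsum w x n <= wnorm w x ^+ 2 - e.
  rewrite leNgt; apply/negP => hn; apply: h; exists n => m nm.
  exact: lt_le_trans hn (wpsum_homo _ _ nm).
have := (wsum_leP w x _).2 hM; rewrite wsumE// lee_fin; lra.
Qed.

(** Comparison test: the only way in which boundedness between weighted spaces
    is obtained below, since it gives summability and the norm estimate
    together. *)
Lemma wnorm_mono w v x y c : (wsum v y < +oo)%E -> 0 <= c ->
  (forall j, 0 <= normc (x j) * w j <= c * (normc (y j) * v j)) ->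
  (wsum w x < +oo)%E /\ wnorm w x <= c * wnorm v y.
Proof.
move=> yoo c0 h.
have b n : wpsum w x n <= (c * wnorm v y) ^+ 2.
  rewrite exprMn; apply: le_trans (_ : c ^+ 2 * wpsum v y n <= _); last first.
    by rewrite ler_wpM2l ?sqr_ge0// wpsum_le_wnorm.
  rewrite mulr_sumr; apply: ler_sum => j _; have /andP[h0 h1] := h j.
  by rewrite -exprMn ler_sqr ?nnegrE// (le_trans h0).
have xoo : (wsum w x < +oo)%E by exact: wsum_lty b.
by split=> //; apply/wnorm_leP => //; rewrite mulr_ge0 ?wnorm_ge0.
Qed.

Lemma ReIm_le (z : R[i]) :
  [/\ `|complex.Re z| <= normc z, `|complex.Im z| <= normc z &
    normc z <= `|complex.Re z| + `|complex.Im z|].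
Proof.
case: z => a b /=; split.
- by rewrite -sqrtr_sqr ler_wsqrtr// lerDl sqr_ge0.
- by rewrite -sqrtr_sqr ler_wsqrtr// lerDr sqr_ge0.
- rewrite -[leRHS]ger0_norm ?addr_ge0// -sqrtr_sqr ler_wsqrtr//.
  have := normr_ge0 a; have := normr_ge0 b.
  rewrite -(real_normK (num_real a)) -(real_normK (num_real b)).
  nra.
Qed.

(** The Cauchy condition is stated against a fixed index n0; this is the form
    that is produced by a nested or monotone construction. *)
Lemma real_cauchy (u : nat -> R) :
  (forall e, 0 < e -> exists n0, forall n, (n0 <= n)%N -> `|u n - u n0| < e) ->
  exists l, forall e, 0 < e -> exists n0, forall n, (n0 <= n)%N -> `|u n - l| < e.
Proof.
move=> uC.
have cu : cvgn u.
  apply/cauchy_cvgP/cauchyP => e e0.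
  have [n0 h] := uC e e0; exists (u n0); exists n0 => // n /= n0n.
  by rewrite /ball/= distrC h.
exists (limn u) => e e0; move/cvgrPdist_lt : cu => /(_ e e0)[n0 _ h].
by exists n0 => n n0n; rewrite distrC; exact: h.
Qed.

Lemma complex_cauchy (u : nat -> R[i]) :
  (forall e : R, 0 < e -> exists n0, forall n, (n0 <= n)%N -> normc (u n - u n0) < e) ->
  exists l, forall e : R, 0 < e -> exists n0, forall n, (n0 <= n)%N -> normc (u n - l) < e.
Proof.
move=> uC.
have [a ha] : exists l : R, forall e, 0 < e ->
    exists n0, forall n, (n0 <= n)%N -> `|complex.Re (u n) - l| < e.
  apply: real_cauchy => e /uC[n0 h]; exists n0 => n /h; apply: le_lt_trans.
  by have [+ _ _] := ReIm_le (u n - u n0); case: (u n) => ? ?; case: (u n0).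
have [b hb] : exists l : R, forall e, 0 < e ->
    exists n0, forall n, (n0 <= n)%N -> `|complex.Im (u n) - l| < e.
  apply: real_cauchy => e /uC[n0 h]; exists n0 => n /h; apply: le_lt_trans.
  by have [_ + _] := ReIm_le (u n - u n0); case: (u n) => ? ?; case: (u n0).
exists (a +i* b) => e e0.
have e20 : 0 < e / 2 by rewrite divr_gt0.
have [n1 h1] := ha _ e20; have [n2 h2] := hb _ e20.
exists (maxn n1 n2) => n; rewrite geq_max => /andP[/h1 + /h2].
have [_ _] := ReIm_le (u n - (a +i* b)); case: (u n) => c d /=; lra.
Qed.

End weighted_sums.
Arguments normc_le_wnorm {R w x} j.

(** * Completeness of lambda2 and the scalar product of l2 *)

Section completeness.
Context {R : realType}.
Implicit Types (w v : nat -> R) (x y : nat -> R[i]).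

(** Convergence of complex sequences in epsilon form, free of the several
    topologies that the type of complex numbers carries. *)
Definition ccvg (u : nat -> R[i]) (l : R[i]) : Prop :=
  forall e : R, 0 < e -> exists n0, forall n, (n0 <= n)%N -> normc (u n - l) < e.

Lemma normcB (a b : R[i]) : normc (a - b) = normc (b - a).
Proof. by rewrite -(normcN (a - b : R[i])) opprB. Qed.

Lemma normc_lerB_dist (a b : R[i]) : `|normc a - normc b| <= normc (a - b).
Proof.
rewrite ler_norml; apply/andP; split.
  have := le_normcD (b - a) a; rewrite subrK (normcB b a); lra.
have := le_normcD (a - b) b; rewrite subrK; lra.
Qed.

Lemma ccvg_normc u l : ccvg u l -> normc (u n) @[n --> \oo] --> normc l.
Proof.
move=> ul; apply/cvgrPdist_lt => e /ul[n0 h].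
exists n0 => // n /= /h; apply: le_lt_trans.
by rewrite distrC; exact: normc_lerB_dist.
Qed.

Lemma wpsum_limit w (y : nat -> nat -> R[i]) z n c :
  (forall j, ccvg (fun m => y m j) (z j)) ->
  (exists m0, forall m, (m0 <= m)%N -> wpsum w (y m) n <= c) ->
  wpsum w z n <= c.
Proof.
move=> yz [m0 h].
have : wpsum w (y m) n @[m --> \oo] --> wpsum w z n.
  apply: cvg_big => [|j _]; first by move=> ? ; exact: add_continuous.
  have h1 : normc (y m j) * w j @[m --> \oo] --> normc (z j) * w j.
    by apply: cvgM; [exact: (ccvg_normc (yz j))|exact: cvg_cst].
  by rewrite expr2; under eq_fun do rewrite expr2; exact: cvgM.
move=> /cvgr_to_le; apply; exists m0 => // m /=; exact: h.
Qed.

(** Fatou's lemma for weighted square sums: finite partial sums pass to the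
    coordinatewise limit, so bounds on the norm do. *)
Lemma wnorm_limit w (y : nat -> nat -> R[i]) z c : 0 <= c ->
  (forall j, ccvg (fun m => y m j) (z j)) ->
  (exists m0, forall m, (m0 <= m)%N -> (wsum w (y m) < +oo)%E /\ wnorm w (y m) <= c) ->
  (wsum w z < +oo)%E /\ wnorm w z <= c.
Proof.
move=> c0 yz [m0 h].
have b n : wpsum w z n <= c ^+ 2.
  apply: wpsum_limit yz _; exists m0 => m /h[yoo yc].
  by apply: (wnorm_leP _ _).1.
have zoo : (wsum w z < +oo)%E by exact: wsum_lty b.
by split=> //; apply: (wnorm_leP _ _).2.
Qed.

Lemma lambda2_ext (A : nat -> nat -> R) (x y : lambda2 A) :
  (forall j, x j = y j) -> x = y.
Proof. by move=> xy; apply: val_inj; apply/funext => j /=; exact: xy. Qed.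

Lemma lambda2D (A : nat -> nat -> R) (x y : lambda2 A) j : (x + y) j = x j + y j.
Proof. by []. Qed.

Lemma lambda2B (A : nat -> nat -> R) (x y : lambda2 A) j : (x - y) j = x j - y j.
Proof. by []. Qed.

Lemma lambda2Z (A : nat -> nat -> R) a (x : lambda2 A) j : (a *: x) j = a * x j.
Proof. by []. Qed.

Lemma lambda20 (A : nat -> nat -> R) j : (0 : lambda2 A) j = 0.
Proof. by []. Qed.

Lemma lambda2_sum (A : nat -> nat -> R) (I : Type) (r : seq I) (P : pred I) (F : I -> lambda2 A) j :
  (\sum_(i <- r | P i) F i) j = \sum_(i <- r | P i) F i j.
Proof. by elim/big_rec2 : _ => // i y x _ <-. Qed.

(** The coordinatewise limit of a Cauchy sequence exists since each coordinate
    is controlled by a seminorm with positive weight there; it is the limit in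
    all seminorms by lower semicontinuity. *)
Lemma lambda2_complete (A : nat -> nat -> R) (u : nat -> lambda2 A) :
  (forall j q, 0 <= A j q) -> (forall j, exists q, 0 < A j q) ->
  (forall q e, 0 < e -> exists n0, forall n m, (n0 <= n)%N -> (n0 <= m)%N ->
     lnorm q (u n - u m) <= e) ->
  exists x : lambda2 A, forall q e, 0 < e ->
    exists n0, forall n, (n0 <= n)%N -> lnorm q (u n - x) <= e.
Proof.
move=> A0 Apos uC.
have /choice[x xP] : forall j, exists l, ccvg (fun n => u n j) l.
  move=> j; apply: complex_cauchy => e e0; have [q q0] := Apos j.
  have eq0 : 0 < e * A j q / 2 by rewrite divr_gt0// mulr_gt0.
  have [n0 h] := uC q _ eq0; exists n0 => n n0n.
  have := normc_le_wnorm j (lambda2_lty q (u n - u n0)) (ltW q0).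
  have := h n n0 n0n (leqnn _); rewrite /lnorm => h1 h2.
  rewrite -(ltr_pM2r q0) (le_lt_trans h2)// (le_lt_trans h1)//.
  by rewrite ltr_pdivrMr// ltr_pMr ?ltr1n// mulr_gt0.
have dlim (n j : nat) : ccvg (fun m => (u n - u m) j) (u n j - x j).
  move=> e /(xP j)[n0 h]; exists n0 => m /h.
  rewrite normcB lambda2B.
  by have -> : u n j - u m j - (u n j - x j) = x j - u m j by ring.
have key q e : 0 < e -> exists n0, forall n, (n0 <= n)%N ->
   (wsum (A ^~ q) (fun j => u n j - x j)%R < +oo)%E /\
    wnorm (A ^~ q) (fun j => u n j - x j) <= e.
  move=> e0; have [n0 h] := uC q e e0; exists n0 => n n0n.
  apply: (wnorm_limit (ltW e0) (dlim n)); exists n0 => m n0m.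
  by split; [exact: lambda2_lty|exact: h].
have xA : x \in lambda2_mem A.
  apply/asboolP => q; have [n0 /(_ n0 (leqnn _))[h _]] := key q 1 ltr01.
  have -> : x = (u n0 : nat -> R[i]) + (-1) *: (fun j => u n0 j - x j).
    by apply/funext => j; rewrite !fctE scaleN1r opprB addrC subrK.
  by apply: wsumD_lty; [exact: lambda2_lty|exact: wsumZ_lty].
exists (Lambda2 xA) => q e /(key q)[n0 h]; exists n0 => n /h[_]; exact.
Qed.

End completeness.

Lemma normc_conj {R : realType} (z : R[i]) : normc z^* = normc z.
Proof. by case: z => a b /=; rewrite sqrrN. Qed.

Section dot.
Context {R : realType}.
Implicit Types (x y z : nat -> R[i]) (a b : R[i]).

Definition l2_norm x : R := wnorm (fun=> 1) x.

(** Absolute convergence of the series of the scalar product. The summands 1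
    only serve to have positive bounds. *)
Lemma dot_abs x y : l2_mem x -> l2_mem y ->
  (\sum_(0 <= j <oo) (normc (x j * (y j)^*))%:E <= ((l2_norm x + 1) * (l2_norm y + 1))%:E)%E.
Proof.
move=> hx hy.
have hy' : l2_mem (fun j => (y j)^*).
  by rewrite /l2_mem /wsum; under eq_eseriesr do rewrite normc_conj.
have ny : l2_norm (fun j => (y j)^*) = l2_norm y.
  rewrite /l2_norm /wnorm /wsum; congr (Num.sqrt (fine _)).
  by apply: eq_eseriesr => j _; rewrite normc_conj.
have p0 z : 0 < l2_norm z + 1 by rewrite ltr_wpDl ?wnorm_ge0.
have := @wsum_mul_le R (fun=> 1) (fun=> 1) x (fun j => (y j)^*) _ _ (p0 x) (p0 (fun j => (y j)^*)) (fun=> mulr1 _) (wnormE ltr01 hx) (wnormE ltr01 hy').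
by rewrite ny.
Qed.

Lemma ccvg_unique u l m : @ccvg R u l -> ccvg u m -> l = m.
Proof.
move=> ul um; apply/eqP; rewrite -subr_eq0; apply/eqP/eq0_normc/eqP.
rewrite eq_le normc_ge0 andbT; apply/ler_addgt0Pr => e e0; rewrite add0r.
have e20 : 0 < e / 2 by rewrite divr_gt0.
have [n1 h1] := ul _ e20; have [n2 h2] := um _ e20.
have {h1}h1 := h1 (maxn n1 n2) (leq_maxl _ _).
have {h2}h2 := h2 (maxn n1 n2) (leq_maxr _ _).
have -> : l - m = (u (maxn n1 n2) - m) - (u (maxn n1 n2) - l) by ring.
have := le_normcD (u (maxn n1 n2) - m) (- (u (maxn n1 n2) - l)).
rewrite normcN; lra.
Qed.

Lemma ccvg_lin u v a l m : @ccvg R u l -> ccvg v m ->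
  ccvg (fun n => a * u n + v n) (a * l + m).
Proof.
move=> ul vm e e0; have na := normc_ge0 a.
have a0 : 0 < normc a + 1 by lra.
have e1 : 0 < e / 2 / (normc a + 1) by rewrite !divr_gt0.
have e2 : 0 < e / 2 by rewrite divr_gt0.
have [n1 h1] := ul _ e1; have [n2 h2] := vm _ e2.
exists (maxn n1 n2) => n; rewrite geq_max => /andP[/h1 + /h2].
have -> : a * u n + v n - (a * l + m) = a * (u n - l) + (v n - m) by ring.
rewrite ltr_pdivlMr// => {}h1 {}h2.
apply: le_lt_trans (le_normcD _ _) _; rewrite normcM.
have := normc_ge0 (u n - l); nra.
Qed.

Lemma ccvg_conj u l : @ccvg R u l -> ccvg (fun n => (u n)^*) l^*.
Proof.
move=> ul e /ul[n0 h]; exists n0 => n /h.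
by rewrite -normc_conj rmorphB.
Qed.

Lemma ccvg_cst (l : R[i]) : ccvg (fun=> l) l.
Proof. by move=> e e0; exists 0%N => n _; rewrite subrr normc0. Qed.

Lemma ccvg_eq u v l : @ccvg R u l -> u =1 v -> ccvg v l.
Proof. by move=> ul uv e /ul[n0 h]; exists n0 => n /h; rewrite uv. Qed.

(** The scalar product is given by a series in the complex plane; its partial
    sums are the finite sums with which all identities are checked. *)
Lemma dot_ccvg x y : l2_mem x -> l2_mem y ->
  ccvg (fun n => \sum_(j < n) x j * (y j)^*) (l2_dot x y).
Proof.
move=> hx hy; have /cvg_csum h := dot_abs hx hy => e e0.
have e0' : 0 < e%:C by rewrite ltcR.
move/(@cvgrPdist_lt R[i] R[i]^o) : h => /(_ _ e0')[n0 _ h]; exists n0 => n /h.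
by rewrite /series/= big_mkord normrcE ltcR normcB.
Qed.

Lemma dot_eq x y l : l2_mem x -> l2_mem y ->
  ccvg (fun n => \sum_(j < n) x j * (y j)^*) l -> l2_dot x y = l.
Proof. by move=> hx hy; apply: ccvg_unique; exact: dot_ccvg. Qed.

Lemma l2_memD x y : l2_mem x -> l2_mem y -> l2_mem (x + y).
Proof. exact: wsumD_lty. Qed.

Lemma l2_memZ a x : l2_mem x -> l2_mem (a *: x).
Proof. exact: wsumZ_lty. Qed.

Lemma l2_mem0 : l2_mem (0 : nat -> R[i]).
Proof. by rewrite /l2_mem wsum0 ltry. Qed.

Lemma dotDl a x y z : l2_mem x -> l2_mem y -> l2_mem z ->
  l2_dot (a *: x + y) z = a * l2_dot x z + l2_dot y z.
Proof.
move=> hx hy hz; apply: dot_eq => //; first by apply: l2_memD => //; exact: l2_memZ.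
apply: ccvg_eq (ccvg_lin a (dot_ccvg hx hz) (dot_ccvg hy hz)) _ => n /=.
rewrite mulr_sumr -big_split/=; apply: eq_bigr => j _.
by rewrite fctE/= mulrDl mulrA.
Qed.

Lemma dotC x y : l2_mem x -> l2_mem y -> l2_dot y x = (l2_dot x y)^*.
Proof.
move=> hx hy; apply: dot_eq => //; apply: ccvg_eq (ccvg_conj (dot_ccvg hx hy)) _ => n /=.
by rewrite rmorph_sum; apply: eq_bigr => j _; rewrite rmorphM/= conjcK mulrC.
Qed.

Lemma dot0l x : l2_mem x -> l2_dot 0 x = 0.
Proof.
move=> hx; apply: dot_eq => //; first exact: l2_mem0.
by apply: ccvg_eq (ccvg_cst 0) _ => n /=; rewrite big1// => j _; rewrite mul0r.
Qed.

Lemma mulc_conj (z : R[i]) : z * z^* = (normc z ^+ 2)%:C.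
Proof.
case: z => a b /=; rewrite sqr_sqrtr ?addr_ge0 ?sqr_ge0//.
by congr (_ +i* _); ring.
Qed.

Lemma dotxx x : l2_mem x -> l2_dot x x = (l2_norm x ^+ 2)%:C.
Proof.
move=> hx; apply: dot_eq => // e e0; have [n0 h] := wpsum_tail hx e0.
exists n0 => n /h.
have -> : \sum_(j < n) x j * (x j)^* = (wpsum (fun=> 1) x n)%:C.
  by rewrite /wpsum rmorph_sum; apply: eq_bigr => j _; rewrite mulc_conj mulr1.
have := wpsum_le_wnorm n hx; rewrite -rmorphB /l2_norm => h1 h2.
rewrite /= expr0n addr0 sqrtr_sqr ler0_norm; lra.
Qed.

Lemma l2_norm_eq0 x : l2_mem x -> l2_norm x = 0 -> x = 0.
Proof.
move=> hx x0; apply/funext => j; apply: eq0_normc; apply/eqP.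
rewrite eq_le normc_ge0 andbT.
by have := normc_le_wnorm j hx ler01; rewrite mulr1 -/(l2_norm x) x0.
Qed.

Lemma dot_CS x y : l2_mem x -> l2_mem y -> normc (l2_dot x y) <= l2_norm x * l2_norm y.
Proof.
move=> hx hy.
have [x0|x0] := eqVneq (l2_norm x) 0.
  by rewrite (l2_norm_eq0 hx x0) dot0l// normc0 mulr_ge0// wnorm_ge0.
have [y0|y0] := eqVneq (l2_norm y) 0.
  by rewrite (l2_norm_eq0 hy y0) dotC ?dot0l ?normc_conj ?normc0 ?mulr_ge0 ?wnorm_ge0//; exact: l2_mem0.
have hy' : wsum (fun=> 1) (fun j => (y j)^*) = wsum (fun=> 1) y.
  by apply: eq_eseriesr => j _; rewrite normc_conj.
apply: normc_csum_le.
apply: (@wsum_mul_le R (fun=> 1) (fun=> 1) x (fun j => (y j)^*)).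
- by rewrite lt_neqAle eq_sym x0 wnorm_ge0.
- by rewrite lt_neqAle eq_sym y0 wnorm_ge0.
- by move=> _; rewrite mulr1.
- by rewrite wsumE.
- by rewrite hy' wsumE.
Qed.

End dot.

(** * Neighbourhoods in s, in lambda2 and in the dual of s *)

Lemma initial_nbhsE (S : choiceType) (T : topologicalType) (f : S -> T)
    (x : S) (A : set S) :
  nbhs (x : initial_topology f) A <->
  exists2 C, nbhs (f x) C & f @^-1` C `<=` A.
Proof.
split=> [|[C xC CA]]; last first.
  by apply: filterS CA _; exact: (@initial_continuous _ _ f).
rewrite (@nbhsE (initial_topology f)) => -[B [[C Co CB] Bx] BA].
exists C; last by rewrite CB.
by rewrite nbhsE; exists C => //; split=> //; rewrite -CB in Bx.
Qed.

(** If the family of sets is directed, one set and one entourage suffice to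
    describe a neighbourhood of uniform convergence on the family. *)
Lemma fam_nbhs_base (U : choiceType) (V : uniformType) (fam : set U -> Prop)
    (f : U -> V) (P : set (U -> V)) :
  (exists A, fam A) ->
  (forall A B, fam A -> fam B -> exists2 C, fam C & A `|` B `<=` C) ->
  nbhs (f : {family fam, U -> V}) P <->
  exists A (E : set (V * V)), [/\ fam A, entourage E &
    [set h | forall y, A y -> E (f y, h y)] `<=` P].
Proof.
move=> [A0 fA0] famU; split=> [|[A [E [fA entE EP]]]]; last first.
  by apply: filterS EP _; exact: (@fam_nbhs U V fam A E f).
pose D := [set AE : set U * set (V * V) | fam AE.1 /\ entourage AE.2].
pose B (AE : set U * set (V * V)) := [set h : U -> V | forall y, AE.1 y -> AE.2 (f y, h y)].
have FF : Filter (filter_from D B).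
  apply: filter_from_filter.
    by exists (A0, setT); split => //=; exact: entourageT.
  move=> [A E] [A' E'] [/= fA eE] [/= fA' eE'].
  have [C fC ACC] := famU _ _ fA fA'.
  exists (C, E `&` E'); first by split => //=; exact: filterI.
  move=> h hC; split=> y /= Ay.
    by have [] := hC y (ACC _ (or_introl Ay)).
  by have [] := hC y (ACC _ (or_intror Ay)).
have : {family fam, filter_from D B --> f}.
  apply/fam_cvgP => A fA Q /uniform_nbhs[E [entE EQ]].
  by exists (A, E) => //=; split.
by move=> /(_ P) h /h [[A E] [/= fA eE] AEP]; exists A, E.
Qed.

Section s_topology.
Context {R : realType}.
Local Notation S := (s_space R).
Local Notation D := (s_dual R).
Implicit Types (q p k j n : nat) (x y z : S).

Lemma lnorm_ge0 (A : nat -> nat -> R) q (x : lambda2 A) : 0 <= lnorm q x.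
Proof. exact: wnorm_ge0. Qed.

Lemma lnorm0 (A : nat -> nat -> R) q : lnorm q (0 : lambda2 A) = 0.
Proof. exact: (seminorm0 (@lnormZ R A)). Qed.

Lemma lnormN (A : nat -> nat -> R) q (x : lambda2 A) : lnorm q (- x) = lnorm q x.
Proof. exact: (seminormN (@lnormZ R A)). Qed.

Lemma lnormB (A : nat -> nat -> R) q (x y : lambda2 A) :
  lnorm q (x - y) = lnorm q (y - x).
Proof. by rewrite -(lnormN q (x - y)) opprB. Qed.

Lemma lnorm_sum (A : nat -> nat -> R) q (I : Type) (r : seq I) (P : pred I) (F : I -> lambda2 A) :
  lnorm q (\sum_(i <- r | P i) F i) <= \sum_(i <- r | P i) lnorm q (F i).
Proof.
elim/big_rec2: _ => [|i a u _ h]; first by rewrite lnorm0.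
by rewrite (le_trans (lnormD _ _ _))// lerD2l.
Qed.

Lemma lnorm_homo x : {homo (fun q => lnorm q x) : p q / (p <= q)%N >-> p <= q}.
Proof.
move=> p q pq; have := @wnorm_mono R (fun j => j.+1%:R ^+ p) (fun j => j.+1%:R ^+ q) x x 1
  (lambda2_lty q x) ler01; rewrite mul1r => -[j|_]; last exact.
rewrite mul1r mulr_ge0 ?normc_ge0 ?exprn_ge0//=.
by rewrite ler_wpM2l ?normc_ge0// ler_weXn2l// ler1n.
Qed.

(** The norms of s increase with q, so that a single norm describes a
    neighbourhood. *)
Lemma s_nbhsP x (A : set S) : nbhs x A <->
  exists n, exists2 e : R, 0 < e & forall y, lnorm n (y - x) < e -> A y.
Proof.
split=> [[[n e] /= e0 eA]|[n [e e0 eA]]].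
  exists n, e => // y yx; apply: eA => q qn.
  exact: le_lt_trans (lnorm_homo _ qn) yx.
by exists (n, e) => //= y /(_ n (leqnn n)); exact: eA.
Qed.

Lemma lambda2_nbhsP (A : nat -> nat -> R) (x : lambda2 A) (P : set (lambda2 A)) :
  (forall j q, 0 <= A j q <= A j q.+1) ->
  nbhs x P <->
  exists n, exists2 e : R, 0 < e & forall y : lambda2 A, lnorm n (y - x) < e -> P y.
Proof.
move=> Am; have Ah j : {homo A j : p q / (p <= q)%N >-> p <= q}.
  by apply: homo_leq; [exact: lexx|exact: le_trans|move=> q; have /andP[] := Am j q].
split=> [[[n e] /= e0 eA]|[n [e e0 eA]]].
  exists n, e => // y yx; apply: eA => q qn.
  apply: le_lt_trans yx; have := @wnorm_mono R (A ^~ q) (A ^~ n) (y - x) (y - x) 1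
    (lambda2_lty n _) ler01; rewrite mul1r => -[j|_]; last exact.
  have /andP[A0 _] := Am j q.
  rewrite mul1r mulr_ge0 ?normc_ge0 ?exprn_ge0//=.
  by rewrite ler_wpM2l ?normc_ge0// Ah.
by exists (n, e) => //= y /(_ n (leqnn n)); exact: eA.
Qed.

(** These sets, one bound for each norm, form a fundamental system of the
    bounded subsets of s. *)
Definition s_ball (M : nat -> R) : set S := [set y | forall q, lnorm q y <= M q].

Lemma vbounded_s_ball (M : nat -> R) : vbounded (s_ball M).
Proof.
move=> U /s_nbhsP[n [e e0 eU]].
pose r : R := `|M n| / e + 1.
have r0 : 0 < r by rewrite /r ltr_wpDl// divr_ge0// ltW.
exists r%:C; first by rewrite ltcR.
move=> a; rewrite normrcE lecR => ra y yM.
have na0 : 0 < normc a by exact: lt_le_trans ra.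
have a0 : a != 0 by apply: contraTneq na0 => ->; rewrite normc0 ltxx.
exists (a^-1 *: y); last by rewrite scalerA divff// scale1r.
apply: eU; rewrite subr0 lnormZ normcV mulrC ltr_pdivrMr//.
have : lnorm n y <= `|M n| by rewrite (le_trans (yM n))// ler_norm.
move=> /le_lt_trans; apply.
rewrite -ltr_pdivrMl// mulrC; apply: lt_le_trans ra; rewrite /r; lra.
Qed.

Lemma vbounded_s (B : set S) : vbounded B -> exists M, B `<=` s_ball M.
Proof.
move=> Bb.
have /choice[M MP] : forall q, exists m : R, forall y, B y -> lnorm q y <= m.
  move=> q; have U0 : nbhs (0 : S) [set y | lnorm q y < 1].
    by apply/s_nbhsP; exists q, 1 => // y; rewrite subr0.
  have [r r0 rB] := Bb _ U0; exists (normc r) => y /(rB r).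
  rewrite gtr0_norm// => /(_ (lexx _))[u u1 <-].
  by rewrite lnormZ ler_piMr ?normc_ge0// ltW.
by exists M => y By q; exact: MP.
Qed.

(** The bounded sets are directed, so the neighbourhoods of uniform
    convergence on them reduce to those for a single bounded set. *)
Lemma s_dual_nbhsP (x : D) (A : set D) : nbhs x A <->
  exists M, exists2 e : R, 0 < e & forall y : D,
    (forall z, s_ball M z -> normc (dual_pair y z - dual_pair x z) < e) -> A y.
Proof.
have famD (B C : set S) : vbounded B -> vbounded C ->
    exists2 F, vbounded F & B `|` C `<=` F.
  move=> /vbounded_s[M BM] /vbounded_s[N CN].
  exists (s_ball (fun q => Num.max (M q) (N q))); first exact: vbounded_s_ball.
  by move=> y [/BM h|/CN h] q; rewrite le_max h ?orbT.
have famE : exists B : set S, vbounded B by exists (s_ball (fun=> 0)); exact: vbounded_s_ball.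
split.
  move=> /(@initial_nbhsE D {family @vbounded _ S, S -> R[i]^o} (@dual_pair R))[C].
  move=> /(fam_nbhs_base _ _ famE famD)[B [E [Bb + EC]]] CA.
  rewrite -entourage_ballE => -[e e0 eE].
  have [f f0 ef] : exists2 f : R, 0 < f & e = f%:C.
    by case: (e) e0 => f g; rewrite /= ltcE/= => /andP[/eqP -> ?]; exists f.
  have [M BM] := vbounded_s Bb; exists M, f => // y yM; apply: CA; apply: EC => z /BM /yM h.
  by apply: eE; rewrite -ball_normE/= ef normrcE ltcR normcB.
move=> [M [e e0 h]].
apply/(@initial_nbhsE D {family @vbounded _ S, S -> R[i]^o} (@dual_pair R)).
exists [set h : S -> R[i]^o | forall z, s_ball M z -> normc (h z - dual_pair x z) < e] => //.
apply/(fam_nbhs_base _ _ famE famD).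
exists (s_ball M), [set ab : R[i]^o * R[i]^o | ball ab.1 e%:C ab.2]; split.
- exact: vbounded_s_ball.
- by rewrite -entourage_ballE; exists e%:C => //=; rewrite ltcR.
- move=> g gM z /gM /=; rewrite -ball_normE/= normrcE ltcR normcB; exact.
Qed.

End s_topology.

(** * Limits, unit vectors and bounded sets *)

Section operators.
Context {R : realType}.
Local Notation S := (s_space R).
Local Notation D := (s_dual R).
Local Notation L := (Lss R).
Implicit Types (q p k j n : nat) (x y z : S).

(** Telescoping against 1/k - 1/(k+1). The weights (k+1)^-2 turn supremum
    bounds into sums, at the cost of two more orders of decay; this is the
    form in which nuclearity of s is used. *)
Lemma sum_inv_sqr n : \sum_(k < n) (k.+1%:R ^- 2 : R) <= 2.
Proof.
case: n => [|n]; first by rewrite big_ord0.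
suff : \sum_(k < n.+1) (k.+1%:R ^- 2 : R) <= 2 - n.+1%:R^-1.
  by move=> /le_trans; apply; rewrite gerBl invr_ge0.
elim: n => [|n IH]; first by rewrite big_ord1 expr1n invr1; lra.
rewrite big_ord_recr/=; apply: le_trans (lerD IH (lexx _)) _.
have a0 : 0 < n.+1%:R :> R by rewrite ltr0n.
have E : n.+2%:R = n.+1%:R + 1 :> R by rewrite -natr1.
rewrite E; set a := (n.+1%:R : R) in a0 *; clearbody a.
have : (a + 1) ^- 2 <= a^-1 - (a + 1)^-1.
  rewrite -subr_ge0.
  have -> : a^-1 - (a + 1)^-1 - (a + 1) ^- 2 = (a * (a + 1) ^+ 2)^-1.
    by field; rewrite !lt0r_neq0//; lra.
  by rewrite invr_ge0 mulr_ge0 ?sqr_ge0// ltW.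
lra.
Qed.

Definition lcvg (A : nat -> nat -> R) (u : nat -> lambda2 A) (x : lambda2 A) :=
  forall q (e : R), 0 < e -> exists n0, forall n, (n0 <= n)%N -> lnorm q (u n - x) <= e.

Definition scvg : (nat -> S) -> S -> Prop := @lcvg _.

Lemma lcvg_ccvg (A : nat -> nat -> R) (u : nat -> lambda2 A) (x : lambda2 A) j :
  (forall j q, 0 <= A j q) -> (forall j, exists q, 0 < A j q) ->
  lcvg u x -> ccvg (fun n => u n j) (x j).
Proof.
move=> A0 Apos ux e e0; have [q q0] := Apos j.
have e1 : 0 < e * A j q / 2 by rewrite !divr_gt0// mulr_gt0.
have [n0 h] := ux q _ e1; exists n0 => n /h h1.
have := normc_le_wnorm j (lambda2_lty q (u n - x)) (A0 j q).
move=> /le_trans/(_ h1) h2; rewrite -(ltr_pM2r q0).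
have p0 : 0 < e * A j q by exact: mulr_gt0.
by apply: le_lt_trans h2 _; lra.
Qed.

Lemma lcvg_unique (A : nat -> nat -> R) (u : nat -> lambda2 A) (x y : lambda2 A) :
  (forall j q, 0 <= A j q) -> (forall j, exists q, 0 < A j q) ->
  lcvg u x -> lcvg u y -> x = y.
Proof.
move=> A0 Apos ux uy; apply: lambda2_ext => j.
exact: ccvg_unique (lcvg_ccvg j A0 Apos ux) (lcvg_ccvg j A0 Apos uy).
Qed.

Lemma s_weight_ge0 j q : 0 <= (j.+1%:R ^+ q : R). Proof. by rewrite exprn_ge0. Qed.
Lemma s_weight_gt0 j q : 0 < (j.+1%:R ^+ q : R). Proof. by rewrite exprn_gt0. Qed.
Hint Resolve s_weight_ge0 s_weight_gt0 : core.

Lemma scvg_ccvg (u : nat -> S) x j : scvg u x -> ccvg (fun n => u n j) (x j).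
Proof. by apply: lcvg_ccvg => // i; exists 0%N. Qed.

Lemma scvg_unique (u : nat -> S) x y : scvg u x -> scvg u y -> x = y.
Proof. by apply: lcvg_unique => // i; exists 0%N. Qed.

Lemma scvgP (u : nat -> S) x : scvg u x <-> u @ \oo --> x.
Proof.
split=> [ux A /s_nbhsP[q [e e0 eA]]|ux q e e0].
  have e20 : 0 < e / 2 by rewrite divr_gt0.
  have [n0 h] := ux q _ e20; exists n0 => // n /= /h h1; apply: eA.
  by apply: le_lt_trans h1 _; lra.
have : nbhs x [set y | lnorm q (y - x) <= e].
  by apply/s_nbhsP; exists q, e => // y /ltW.
by move=> /ux[n0 _ h]; exists n0.
Qed.

Lemma lcvg_lin (A : nat -> nat -> R) (u v : nat -> lambda2 A) (x y : lambda2 A) a :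
  lcvg u x -> lcvg v y -> lcvg (fun n => a *: u n + v n) (a *: x + y).
Proof.
move=> ux vy q e e0; have na := normc_ge0 a.
have a0 : 0 < normc a + 1 by lra.
have e1 : 0 < e / 2 / (normc a + 1) by rewrite !divr_gt0.
have e2 : 0 < e / 2 by rewrite divr_gt0.
have [n1 h1] := ux q _ e1; have [n2 h2] := vy q _ e2.
exists (maxn n1 n2) => n; rewrite geq_max => /andP[/h1 + /h2].
rewrite opprD addrACA -scalerBr ler_pdivlMr// => {}h1 {}h2.
apply: le_trans (lnormD _ _ _) _; rewrite lnormZ.
have := lnorm_ge0 q (u n - x); nra.
Qed.

Lemma lcvg_le (A : nat -> nat -> R) (u : nat -> lambda2 A) (x : lambda2 A) q c :
  lcvg u x -> (exists n0, forall n, (n0 <= n)%N -> lnorm q (u n) <= c) ->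
  lnorm q x <= c.
Proof.
move=> ux [n0 h]; apply/ler_addgt0Pr => e /(ux q)[n1 h1].
have {}h := h (maxn n0 n1) (leq_maxl _ _).
have {}h1 := h1 (maxn n0 n1) (leq_maxr _ _).
have -> : x = u (maxn n0 n1) - (u (maxn n0 n1) - x) by rewrite opprB addrC subrK.
apply: le_trans (lnormD _ _ _) _; rewrite lnormN; lra.
Qed.

Lemma lcvg_cst (A : nat -> nat -> R) (x : lambda2 A) : lcvg (fun=> x) x.
Proof. by move=> q e e0; exists 0%N => n _; rewrite subrr lnorm0 ltW. Qed.

Definition delta k : nat -> R[i] := fun j => (j == k)%:R.

Lemma wpsum_delta w k n : wpsum w (delta k) n = if (k < n)%N then w k ^+ 2 else 0.
Proof.
elim: n => [|n IH]; first by rewrite /wpsum big_ord0.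
rewrite wpsumSr IH /delta ltnS; case: (ltngtP k n) => [kn|kn|->].
- by rewrite normc0 mul0r expr0n addr0.
- by rewrite normc0 mul0r expr0n addr0.
- by rewrite normc1 mul1r add0r.
Qed.

Lemma wsum_delta w k : (wsum w (delta k) < +oo)%E.
Proof.
apply: (@wsum_lty _ _ _ (w k ^+ 2)) => n; rewrite wpsum_delta.
by case: ifP => // _; rewrite sqr_ge0.
Qed.

Lemma wnorm_delta w k : 0 <= w k -> wnorm w (delta k) = w k.
Proof.
move=> w0; apply/eqP; rewrite eq_le; apply/andP; split.
  apply: (wnorm_leP (wsum_delta w k) w0).2 => n; rewrite wpsum_delta.
  by case: ifP => // _; rewrite sqr_ge0.
have := normc_le_wnorm k (wsum_delta w k) w0.
by rewrite /delta eqxx normc1 mul1r.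
Qed.

Lemma delta_mem (A : nat -> nat -> R) k : delta k \in lambda2_mem A.
Proof. by apply/asboolP => q; exact: wsum_delta. Qed.

Definition ldelta (A : nat -> nat -> R) k : lambda2 A := Lambda2 (delta_mem A k).

Lemma lnorm_ldelta (A : nat -> nat -> R) k q : 0 <= A k q ->
  lnorm q (ldelta A k) = A k q.
Proof. by move=> A0; rewrite /lnorm/= wnorm_delta. Qed.

Lemma ldeltaZ (A : nat -> nat -> R) (c : R[i]) k j :
  (c *: ldelta A k) j = c * (if j == k then 1 else 0).
Proof. by rewrite lambda2Z /= /delta; case: (j == k). Qed.

Lemma lambda2_delta_sum (A : nat -> nat -> R) (x : lambda2 A) n j :
  (\sum_(k < n) x k *: ldelta A k) j = if (j < n)%N then x j else 0.
Proof.
rewrite lambda2_sum; elim: n => [|n IH]; first by rewrite big_ord0.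
rewrite big_ord_recr IH ldeltaZ ltnS /=; case: (ltngtP j n) => [h|h|->].
- by rewrite mulr0 addr0.
- by rewrite mulr0 addr0.
- by rewrite mulr1 add0r.
Qed.

(** The unit vectors form a Schauder basis: the remainder of the expansion is
    the tail of a convergent series. *)
Lemma lcvg_delta (A : nat -> nat -> R) (x : lambda2 A) :
  (forall j q, 0 <= A j q) ->
  lcvg (fun n => \sum_(k < n) x k *: ldelta A k) x.
Proof.
move=> A0 q e e0.
have e2 : 0 < e ^+ 2 by rewrite exprn_gt0.
have [n0 h] := wpsum_tail (lambda2_lty q x) e2; exists n0 => n n0n.
have yE j : (\sum_(k < n) x k *: ldelta A k - x) j = (if (j < n)%N then x j else 0) - x j.
  by rewrite lambda2B lambda2_delta_sum.
move: (\sum_(k < n) x k *: ldelta A k - x) yE => y yE.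
have y0 m : (m <= n)%N -> wpsum (A ^~ q) y m = 0.
  move=> mn; rewrite /wpsum big1// => i _.
  by rewrite yE (leq_trans (ltn_ord i) mn) subrr normc0 mul0r expr0n.
apply: (wnorm_leP (lambda2_lty q _) (ltW e0)).2 => m.
have [mn|/ltnW nm] := leqP m n; first by rewrite y0// sqr_ge0.
have E : wpsum (A ^~ q) y m + wpsum (A ^~ q) x n = wpsum (A ^~ q) x m.
  rewrite -(subnKC nm); elim: (m - n)%N => [|d IH].
    by rewrite addn0 y0// add0r.
  rewrite addnS !wpsumSr -IH addrAC; congr (_ + _).
  rewrite yE ltnNge leq_addr/= sub0r.
  by rewrite (normcN (x _ : R[i])).
have := wpsum_le_wnorm m (lambda2_lty q x); have := h _ n0n; lra.
Qed.

Definition es k : S := ldelta _ k.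

Lemma lnorm_es k q : lnorm q (es k) = k.+1%:R ^+ q.
Proof. exact: lnorm_ldelta. Qed.

Lemma s_l2 x : l2_mem x.
Proof. exact: (lambda2_lty 0 x). Qed.
Hint Resolve s_l2 : core.

Lemma dot_es x k : l2_dot x (es k) = x k.
Proof.
apply: dot_eq => // e e0; exists k.+1 => n kn.
rewrite (bigD1 (Ordinal kn))//= big1 => [|i ik].
  by rewrite /delta eqxx rmorph1 mulr1 addr0 subrr normc0.
rewrite /delta (_ : (i == k :> nat) = false) ?rmorph0 ?mulr0//.
by apply/negbTE; apply: contraNN ik => /eqP h; apply/eqP/val_inj.
Qed.

Lemma esZ (c : R[i]) k j : (c *: es k) j = c * (if j == k then 1 else 0).
Proof. exact: ldeltaZ. Qed.

Lemma csum_single (u : nat -> R[i]) k : (forall j, j != k -> u j = 0) ->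
  csum u = u k.
Proof.
move=> u0.
have uE n : (k < n)%N -> \sum_(j < n) u j = u k.
  move=> kn; rewrite (bigD1 (Ordinal kn))//= big1 ?addr0// => i ik.
  by rewrite u0//; apply: contraNN ik => /eqP e1; apply/eqP/val_inj.
have nE n : \sum_(j < n) normc (u j) <= normc (u k).
  case: (ltnP k n) => kn.
    rewrite (bigD1 (Ordinal kn))//= big1 ?addr0// => i ik.
    by rewrite u0 ?normc0//; apply: contraNN ik => /eqP e1; apply/eqP/val_inj.
  rewrite big1 ?normc_ge0// => i _.
  by rewrite u0 ?normc0// neq_ltn (leq_trans (ltn_ord i) kn).
apply: (@ccvg_unique _ (fun n => \sum_(j < n) u j)); last first.
  by move=> e e0; exists k.+1 => n /uE ->; rewrite subrr normc0.
have s : (\sum_(0 <= j <oo) (normc (u j))%:E <= (normc (u k))%:E)%E.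
  apply: lime_le; first by apply: is_cvg_nneseries => j _ _; rewrite lee_fin normc_ge0.
  by apply: nearW => n; rewrite big_mkord sumEFin lee_fin.
have := cvg_csum s => {}s e e0.
have e0' : 0 < e%:C by rewrite ltcR.
move/(@cvgrPdist_lt R[i] R[i]^o) : s => /(_ _ e0')[n0 _ s]; exists n0 => n /s.
by rewrite /series/= big_mkord normrcE ltcR normcB.
Qed.

Lemma dual_pair_term (x : D) (c : R[i]) k : dual_pair x (c *: es k) = x k * c.
Proof.
rewrite /dual_pair (csum_single (k := k)) ?esZ ?eqxx ?mulr1// => j jk.
by rewrite esZ (negbTE jk) !mulr0.
Qed.

(** A fundamental system of the bounded subsets of the dual of s: sequences
    with a common polynomial bound. *)
Definition dual_ball p (C : R) : set D := [set x | forall k, normc (x k) <= C * k.+1%:R ^+ p].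

Lemma normc_pair_le (x : D) y p C : 0 <= C -> dual_ball p C x ->
  normc (dual_pair x y) <= 2 * C * lnorm p.+2 y.
Proof.
move=> C0 xC; apply: normc_csum_le.
apply: lime_le; first by apply: is_cvg_nneseries => j _ _; rewrite lee_fin normc_ge0.
apply: nearW => n; rewrite big_mkord sumEFin lee_fin.
have K0 : 0 <= C * lnorm p.+2 y by rewrite mulr_ge0// lnorm_ge0.
apply: (@le_trans _ _ (\sum_(k < n) (k.+1%:R ^- 2) * (C * lnorm p.+2 y))); last first.
  by rewrite -mulr_suml -mulrA ler_wpM2r// sum_inv_sqr.
apply: ler_sum => k _; rewrite normcM [leRHS]mulrC ler_pdivlMr ?s_weight_gt0//.
have h := normc_le_wnorm k (lambda2_lty p.+2 y) (s_weight_ge0 k _).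
apply: le_trans (_ : C * k.+1%:R ^+ p * normc (y k) * k.+1%:R ^+ 2 <= _).
  by apply: ler_wpM2r => //; apply: ler_wpM2r => //; exact: normc_ge0.
have -> : C * k.+1%:R ^+ p * normc (y k) * k.+1%:R ^+ 2 = C * (normc (y k) * k.+1%:R ^+ p.+2).
  have := exprD (k.+1%:R : R) p 2; rewrite addn2 => ->.
  by move: (_ ^+ p) (_ ^+ 2) (normc _) => a b c; ring.
exact: ler_wpM2l.
Qed.

Lemma vbounded_dual_ball p C : vbounded (dual_ball p C).
Proof.
move=> U /s_dual_nbhsP[M [e e0 eU]].
pose K := 2 * `|C| * `|M p.+2|.
have K0 : 0 <= K by rewrite !mulr_ge0.
pose r : R := K / e + 1.
have r0 : 0 < r by rewrite /r ltr_wpDl// divr_ge0// ltW.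
exists r%:C; first by rewrite ltcR.
move=> a; rewrite normrcE lecR => ra x xC.
have na0 : 0 < normc a by exact: lt_le_trans ra.
have a0 : a != 0 by apply: contraTneq na0 => ->; rewrite normc0 ltxx.
exists (a^-1 *: x); last by rewrite scalerA divff// scale1r.
apply: eU => z zM.
have -> : dual_pair 0 z = 0.
  by rewrite /dual_pair (csum_single (k := 0%N)) => [|j _]; rewrite mul0r.
rewrite subr0.
have h : dual_ball p (`|C| / normc a) (a^-1 *: x).
  move=> k; rewrite -[(a^-1 *: x) k]/(a^-1 * x k) normcM normcV mulrAC.
  rewrite [leRHS]mulrC; apply: ler_wpM2l; first by rewrite invr_ge0 ltW.
  by rewrite (le_trans (xC k))// ler_wpM2r// ler_norm.
have := normc_pair_le z _ h => /(_ _)/le_lt_trans; apply.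
  by rewrite divr_ge0// ltW.
have zM2 : lnorm p.+2 z <= `|M p.+2| by rewrite (le_trans (zM _))// ler_norm.
apply: (@le_lt_trans _ _ (K / normc a)).
  have -> : 2 * (`|C| / normc a) * lnorm p.+2 z = 2 * `|C| * lnorm p.+2 z / normc a by ring.
  by rewrite ler_wpM2r ?invr_ge0 ?(ltW na0)// ler_wpM2l// mulr_ge0.
rewrite ltr_pdivrMr// -ltr_pdivrMl// mulrC; apply: lt_le_trans ra; rewrite /r; lra.
Qed.

Lemma normcR (a : R) : normc a%:C = `|a|.
Proof. by rewrite /= expr0n addr0 sqrtr_sqr. Qed.

Lemma normcn k p : normc (k.+1%:R ^+ p : R[i]) = k.+1%:R ^+ p :> R.
Proof.
have -> : k.+1%:R ^+ p = (k.+1%:R ^+ p)%:C :> R[i] by rewrite rmorphXn rmorph_nat.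
by rewrite normcR ger0_norm.
Qed.

Lemma normcVn k p : normc (k.+1%:R ^- p : R[i]) = k.+1%:R ^- p :> R.
Proof. by rewrite normcV normcn. Qed.

(** If no polynomial bound held, there would be elements x_p of B and indices
    k_p violating the bound p (k+1)^p; the vectors (k_p+1)^-p e_(k_p) form a
    bounded set of s, on which B would be unbounded. *)
Lemma vbounded_dual (B : set D) : vbounded B -> exists p C, 0 <= C /\ B `<=` dual_ball p C.
Proof.
move=> Bb; apply: contrapT => h.
have /choice[u uP] : forall p, exists xk : D * nat, B xk.1 /\
    p%:R * xk.2.+1%:R ^+ p < normc (xk.1 xk.2).
  move=> p; apply: contrapT => hp; apply: h; exists p, p%:R; split=> // x Bx k.
  by rewrite leNgt; apply/negP => hk; apply: hp; exists (x, k).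
(* For p >= q the norm of order q is at most 1; the finitely many other terms
   are added up. *)
pose M q : R := \sum_(p < q) (u p).2.+1%:R ^+ q + 1.
have MB p : s_ball M ((u p).2.+1%:R ^- p *: es (u p).2).
  move=> q; rewrite lnormZ lnorm_es /M.
  rewrite normcVn.
  case: (ltnP p q) => pq.
    apply: ler_wpDr => //; rewrite (bigD1 (Ordinal pq))//=.
    apply: ler_wpDr; first by apply: sumr_ge0.
    by rewrite mulrC ler_pdivrMr ?s_weight_gt0// ler_peMr// exprn_ege1// ler1n.
  apply: ler_wpDl; first by apply: sumr_ge0.
  by rewrite mulrC ler_pdivrMr ?s_weight_gt0// mul1r ler_weXn2l// ler1n.
have U0 : nbhs (0 : D) [set y | forall z, s_ball M z -> normc (dual_pair y z - dual_pair (0 : D) z) < 1].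
  by apply/s_dual_nbhsP; exists M, 1.
have [r r0 rB] := Bb _ U0.
have nr0 : 0 < normc r by rewrite -ltcR -normrcE gtr0_norm.
have [p rp] : exists p : nat, normc r < p%:R.
  (* Past the absorbing factor r the violated bounds contradict absorption. *)
  by exists (Num.bound (normc r)); by apply: archi_boundP; exact: normc_ge0.
have [Bu hu] := uP p.
have rr : r <= `|r| by rewrite gtr0_norm.
have [v vU vE] := rB r rr _ Bu.
have := vU _ (MB p).
have -> : dual_pair (0 : D) ((u p).2.+1%:R ^- p *: es (u p).2) = 0 by rewrite dual_pair_term mul0r.
rewrite subr0 dual_pair_term normcM.
rewrite normcVn.
rewrite ltr_pdivrMr ?s_weight_gt0// mul1r => hv.
move: hu; rewrite -vE -[(r *: v) _]/(r * v _) normcM => hu.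
have h1 := ler_wpM2l (ltW nr0) (ltW hv).
have h2 : normc r * (u p).2.+1%:R ^+ p < p%:R * (u p).2.+1%:R ^+ p by rewrite ltr_pM2r ?s_weight_gt0.
by have := lt_trans (lt_le_trans hu h1) h2; rewrite ltxx.
Qed.

End operators.

(** * Operators from the dual of s to s and their Hilbert-Schmidt norms *)

Section hilbert_schmidt.
Context {R : realType}.
Local Notation S := (s_space R).
Local Notation D := (s_dual R).
Local Notation L := (Lss R).
Implicit Types (q p k j n : nat) (T : L).
Hint Resolve s_weight_ge0 s_weight_gt0 s_l2 : core.

(** The column of index k of the matrix of T. Columns determine the operator,
    as the unit vectors span a dense subspace of the dual. *)
Definition ecol (T : L) k : S := T (s_incl (es k)).

Lemma Lss_lin T : linear T.
Proof. by have /asboolP[] := Lss_funP T. Qed.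

Lemma Lss_cont T : continuous T.
Proof. by have /asboolP[] := Lss_funP T. Qed.

Lemma Lss_linearP T a (x y : D) : T (a *: x + y) = a *: T x + T y.
Proof. exact: Lss_lin. Qed.

Lemma Lss0 T : T 0 = 0.
Proof. by have := Lss_linearP T (-1) 0 0; rewrite scaler0 addr0 scaleN1r addNr. Qed.

Lemma LssZ T a (x : D) : T (a *: x) = a *: T x.
Proof. by have := Lss_linearP T a x 0; rewrite Lss0 !addr0. Qed.

Lemma LssD T (x y : D) : T (x + y) = T x + T y.
Proof. by have := Lss_linearP T 1 x y; rewrite !scale1r. Qed.

Lemma LssB T (x y : D) : T (x - y) = T x - T y.
Proof. by rewrite LssD -scaleN1r LssZ scaleN1r. Qed.

Lemma Lss_sumv T (I : Type) (r : seq I) (P : pred I) (F : I -> D) :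
  T (\sum_(i <- r | P i) F i) = \sum_(i <- r | P i) T (F i).
Proof. by elim/big_rec2 : _ => [|i y x _ <-]; rewrite ?Lss0 ?LssD. Qed.

(** A continuous operator maps bounded sets to bounded sets, here with
    explicit fundamental systems. *)
Lemma Lss_bdd T p C q : exists K, forall x, dual_ball p C x -> lnorm q (T x) <= K.
Proof.
have U0 : nbhs (0 : D) (T @^-1` [set y : S | lnorm q y < 1]).
  have : nbhs (T 0) [set y : S | lnorm q y < 1].
    by rewrite Lss0; apply/s_nbhsP; exists q, 1 => // y; rewrite subr0.
  exact: (@Lss_cont T 0).
have [r r0 rB] := @vbounded_dual_ball R p C _ U0.
have rr : r <= `|r| by rewrite gtr0_norm.
exists (normc r) => x /(rB r rr)[u u1 <-].
by rewrite LssZ lnormZ ler_piMr ?normc_ge0// ltW.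
Qed.

Lemma s_inclZ (c : R[i]) k j : (c *: s_incl (es k) : D) j = c * (j == k)%:R.
Proof. by []. Qed.

Lemma s_dualD (x y : D) j : (x + y) j = x j + y j.
Proof. by []. Qed.

Lemma s_dualB (x y : D) j : (x - y) j = x j - y j.
Proof. by []. Qed.

Lemma s_dualZ c (x : D) j : (c *: x) j = c * x j.
Proof. by []. Qed.

Lemma s_dual_sum (I : Type) (r : seq I) (P : pred I) (F : I -> D) j :
  (\sum_(i <- r | P i) F i) j = \sum_(i <- r | P i) F i j.
Proof. by elim/big_rec2 : _ => // i y x _ <-. Qed.

Lemma s_dual_in_ball (x : D) : exists p C, 0 <= C /\ dual_ball p C x.
Proof.
have /asboolP[q xq] := s_dual_seqP x.
exists q, (wnorm (fun j => j.+1%:R ^- q) x); split; first exact: wnorm_ge0.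
move=> k; rewrite -ler_pdivrMr//.
by apply: (normc_le_wnorm k xq); rewrite invr_ge0.
Qed.

(** The multiples (k+1)^p e_k form a bounded subset of the dual of s, so all
    weighted columns are bounded. *)
Lemma Lss_col T p q : exists K, 0 <= K /\ forall k, k.+1%:R ^+ p * lnorm q (ecol T k) <= K.
Proof.
have [K h] := Lss_bdd T p 1 q.
have {}h k : k.+1%:R ^+ p * lnorm q (ecol T k) <= K.
  have <- : lnorm q (T (k.+1%:R ^+ p *: s_incl (es k))) = k.+1%:R ^+ p * lnorm q (ecol T k).
    by rewrite LssZ lnormZ normcn.
  apply: h => j; rewrite s_inclZ mul1r normcM normcn.
  by case: eqP => [->|_]; rewrite ?normc1 ?mulr1// normc0 mulr0.
by exists K; split=> //; apply: le_trans (h 0%N); rewrite mulr_ge0// lnorm_ge0.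
Qed.

(** Multiplied by n, the remainder of index n of the expansion still has a
    polynomial bound independent of n, and T is bounded on the sequences with
    that bound. *)
Lemma Lss_sum T (x : D) : scvg (fun n => \sum_(k < n) x k *: ecol T k) (T x).
Proof.
move=> q e e0; have [p [C [C0 xC]]] := s_dual_in_ball x.
have [K h] := Lss_bdd T p.+1 C q.
exists (Num.bound (`|K| / e)) => n Kn.
have n0 : 0 < n.+1%:R :> R by rewrite ltr0n.
set y : D := n.+1%:R *: (x - \sum_(k < n) x k *: s_incl (es k)).
have dE j : (\sum_(k < n) x k *: s_incl (es k)) j = if (j < n)%N then x j else 0.
  rewrite s_dual_sum; elim: n {Kn n0 y} => [|n IH]; first by rewrite big_ord0.
  rewrite big_ord_recr IH s_inclZ ltnS /=.
  case: (ltngtP j n) => [?|?|->].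
  - by rewrite mulr0 addr0.
  - by rewrite mulr0 addr0.
  - by rewrite mulr1 add0r.
have yC : dual_ball p.+1 C y.
  move=> j; rewrite /y s_dualZ s_dualB normcM dE; case: ifPn => [_|]; first by rewrite subrr normc0 mulr0 mulr_ge0.
  rewrite -leqNgt subr0 => nj; rewrite (@normcn _ n 1) expr1 exprSr mulrA mulrC.
  by apply: ler_pM => //; rewrite ?normc_ge0// ler_nat.
have := h _ yC; rewrite LssZ lnormZ (@normcn _ n 1) expr1 LssB Lss_sumv => h1.
rewrite lnormB.
have -> : \sum_(k < n) x k *: ecol T k = \sum_(i < n) T (x i *: s_incl (es i)).
  by apply: eq_bigr => k _; rewrite LssZ.
have h2 : `|K| / e < n.+1%:R.
  apply: (@lt_trans _ _ (Num.bound (`|K| / e))%:R).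
    by apply: archi_boundP; rewrite divr_ge0// ltW.
  by rewrite ltr_nat ltnS.
rewrite -(ler_pM2l n0) (le_trans h1)// (le_trans (ler_norm _))//.
by move: h2; rewrite ltr_pdivrMr// => /ltW.
Qed.

Lemma Lss_ext (T T' : L) : (forall k, ecol T k = ecol T' k) -> T = T'.
Proof.
move=> h; apply: val_inj; apply/funext => x /=.
have hx : (fun n => \sum_(k < n) x k *: ecol T k) = (fun n => \sum_(k < n) x k *: ecol T' k).
  by apply/funext => n; apply: eq_bigr => k _; rewrite h.
by apply: scvg_unique (Lss_sum T x) _; rewrite hx; exact: Lss_sum.
Qed.

Lemma normc_lnorm q (x : S) : normc (lnorm q x)%:C = lnorm q x.
Proof. by rewrite normcR ger0_norm// lnorm_ge0. Qed.

(** One more order of decay turns a supremum bound into a square-sum bound. *)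
Lemma wnorm_bound (x : nat -> R[i]) p K : 0 <= K ->
  (forall k, k.+1%:R ^+ p.+1 * normc (x k) <= K) ->
  (wsum (fun k => k.+1%:R ^+ p)%R x < +oo)%E /\ wnorm (fun k => k.+1%:R ^+ p) x <= 2 * K.
Proof.
move=> K0 h.
have b n : wpsum (fun k => k.+1%:R ^+ p) x n <= (2 * K) ^+ 2.
  apply: (@le_trans _ _ (\sum_(k < n) (k.+1%:R ^- 2) * (K ^+ 2))).
    apply: ler_sum => k _; rewrite [leRHS]mulrC ler_pdivlMr// -exprMn.
    rewrite ler_sqr ?nnegrE ?mulr_ge0 ?normc_ge0//; apply: le_trans (h k).
    by rewrite [leRHS]mulrC exprSr mulrA.
  rewrite -mulr_suml; apply: (@le_trans _ _ (2 * K ^+ 2)).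
    by rewrite ler_wpM2r ?sqr_ge0// sum_inv_sqr.
  rewrite exprMn ler_wpM2r ?sqr_ge0//; lra.
have xoo : (wsum (fun k => k.+1%:R ^+ p)%R x < +oo)%E by exact: wsum_lty b.
by split=> //; apply: (wnorm_leP xoo _).2; rewrite ?mulr_ge0.
Qed.

Definition colseq q (T : L) : nat -> R[i] := fun k => (lnorm q (ecol T k))%:C.

(** Sealed, so that computation never unfolds the norm of a compound operator. *)
Fact hs_key : {f : nat -> nat -> L -> R |
  forall p q T, f p q T = wnorm (fun k => k.+1%:R ^+ p) (colseq q T)}.
Proof. by exists (fun p q T => wnorm (fun k => k.+1%:R ^+ p) (colseq q T)). Qed.

(** The weighted Hilbert-Schmidt norm: the square root of the sum of
    (k+1)^(2p) |T e_k|_q^2. Being Hilbertian, these norms make orthogonal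
    projections orthogonal, which supremum norms would not do. *)
Definition hs p q T : R := sval hs_key p q T.

Lemma hsE p q T : hs p q T = wnorm (fun k => k.+1%:R ^+ p) (colseq q T).
Proof. exact: (svalP hs_key). Qed.

Lemma hs_ge0 p q T : 0 <= hs p q T. Proof. rewrite hsE; exact: wnorm_ge0. Qed.
Hint Resolve hs_ge0 lnorm_ge0 : core.

Lemma hs_lty p q T : (wsum (fun k => k.+1%:R ^+ p)%R (colseq q T) < +oo)%E.
Proof.
have [K [K0 h]] := Lss_col T p.+1 q.
by have [] := @wnorm_bound (colseq q T) p K K0 (fun k => eq_ind_r (fun z => _ * z <= K) (h k) (normc_lnorm _ _)).
Qed.

Lemma hs_wsum p q T :
  (hs p q T ^+ 2)%:E = wsum (fun k => k.+1%:R ^+ p) (colseq q T).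
Proof. by rewrite hsE -(wsumE (hs_lty p q T)). Qed.

Lemma hs_le p q T K : 0 <= K -> (forall k, k.+1%:R ^+ p.+1 * lnorm q (ecol T k) <= K) ->
  hs p q T <= 2 * K.
Proof.
move=> K0 h; rewrite hsE.
by have [] := @wnorm_bound (colseq q T) p K K0 (fun k => eq_ind_r (fun z => _ * z <= K) (h k) (normc_lnorm _ _)).
Qed.

Lemma hs_col p q T k : k.+1%:R ^+ p * lnorm q (ecol T k) <= hs p q T.
Proof. by rewrite hsE; have := normc_le_wnorm k (hs_lty p q T) (s_weight_ge0 k p); rewrite normc_lnorm mulrC. Qed.

Lemma hs_leP p q T a : 0 <= a -> hs p q T <= a <->
  forall n, \sum_(k < n) (lnorm q (ecol T k) * k.+1%:R ^+ p) ^+ 2 <= a ^+ 2.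
Proof.
move=> a0; rewrite hsE (wnorm_leP (hs_lty p q T) a0).
split=> h n; have := h n; rewrite /wpsum; congr (_ <= _);
  by apply: eq_bigr => k _; rewrite normc_lnorm.
Qed.

Lemma hs_psum p q T n : \sum_(k < n) (lnorm q (ecol T k) * k.+1%:R ^+ p) ^+ 2 <= hs p q T ^+ 2.
Proof. by move: n; apply/(hs_leP p q T (hs_ge0 _ _ _)). Qed.

Lemma hs_mono p q T p' q' T' c : 0 <= c ->
  (forall k, lnorm q (ecol T k) * k.+1%:R ^+ p <= c * (lnorm q' (ecol T' k) * k.+1%:R ^+ p')) ->
  hs p q T <= c * hs p' q' T'.
Proof.
move=> c0 h; rewrite !hsE; apply: (wnorm_mono (hs_lty p' q' T') c0 _).2 => k.
rewrite !normc_lnorm; apply/andP; split; last exact: h.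
by rewrite mulr_ge0 ?lnorm_ge0 ?s_weight_ge0.
Qed.

Lemma hs_homo p q p' q' T : (p <= p')%N -> (q <= q')%N -> hs p q T <= hs p' q' T.
Proof.
move=> pp qq; rewrite -[leRHS]mul1r; apply: hs_mono => // k; rewrite mul1r.
apply: ler_pM; rewrite ?lnorm_ge0 ?s_weight_ge0//; first exact: (lnorm_homo (ecol T k) qq).
by rewrite ler_weXn2l// ler1n.
Qed.

Lemma ecolD (T T' : L) k : ecol (T + T' : L) k = ecol T k + ecol T' k.
Proof. by []. Qed.
Lemma ecolZ a (T : L) k : ecol (a *: T : L) k = a *: ecol T k.
Proof. by []. Qed.
Lemma ecolB (T T' : L) k : ecol (T - T' : L) k = ecol T k - ecol T' k.
Proof. by []. Qed.
Lemma ecol0 k : ecol (0 : L) k = 0.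
Proof. by []. Qed.

Lemma hsZ p q a T : hs p q (a *: T : L) = normc a * hs p q T.
Proof.
rewrite !hsE -(wnormZ a (hs_lty p q T)) /wnorm /wsum; congr (Num.sqrt (fine _)).
apply: eq_eseriesr => k _; rewrite (_ : (a *: colseq q T) k = a * colseq q T k)// normcM.
by rewrite !normc_lnorm ecolZ lnormZ.
Qed.

Lemma hsN p q T : hs p q (- T : L) = hs p q T.
Proof. by rewrite -scaleN1r hsZ normcN normc1 mul1r. Qed.

Lemma hsD p q (T T' : L) : hs p q (T + T' : L) <= hs p q T + hs p q T'.
Proof.
rewrite !hsE; apply: le_trans (wnormD (hs_lty p q T) (hs_lty p q T')).
have := @wnorm_mono R (fun k => k.+1%:R ^+ p) (fun k => k.+1%:R ^+ p)
  (colseq q (T + T' : L)) (colseq q T + colseq q T') 1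
  (wsumD_lty (hs_lty p q T) (hs_lty p q T')) ler01; rewrite mul1r => -[k|_]; last exact.
rewrite normc_lnorm mul1r; apply/andP; split; first by rewrite mulr_ge0 ?lnorm_ge0 ?s_weight_ge0.
apply: ler_wpM2r; first exact: s_weight_ge0.
rewrite (_ : (colseq q T + colseq q T') k = colseq q T k + colseq q T' k)// /colseq -rmorphD normcR.
by rewrite ger0_norm ?addr_ge0 ?lnorm_ge0//; exact: (lnormD q (ecol T k) (ecol T' k)).
Qed.

Lemma hs0 p q : hs p q (0 : L) = 0.
Proof. by rewrite -(scale0r (0 : L)) hsZ normc0 mul0r. Qed.

Lemma hsB p q (T T' : L) : hs p q (T - T' : L) = hs p q (T' - T : L).
Proof. by rewrite -(hsN p q (T - T')) opprB. Qed.

Lemma hs_eq0 p q T : hs p q T <= 0 -> T = 0.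
Proof.
move=> h; apply: Lss_ext => k; rewrite ecol0; apply: lambda2_ext => j.
have h1 := le_trans (hs_col p q T k) h.
have h2 : lnorm q (ecol T k) <= 0.
  by rewrite -(ler_pM2l (s_weight_gt0 k p)) mulr0.
have := normc_le_wnorm j (lambda2_lty q (ecol T k)) (s_weight_ge0 j q).
move=> /le_trans/(_ h2) h3; apply: eq0_normc; apply/eqP; rewrite eq_le normc_ge0 andbT.
by rewrite -(ler_pM2r (s_weight_gt0 j q)) mul0r.
Qed.

(** Expand T x in the columns of T and use two of the orders of decay for
    summability. *)
Lemma Lss_dual_le T (x : D) p C q : 0 <= C -> dual_ball p C x ->
  lnorm q (T x) <= 2 * C * hs p.+2 q T.
Proof.
move=> C0 xC; apply: (lcvg_le (Lss_sum T x)); exists 0%N => n _.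
apply: le_trans (lnorm_sum _ _ _ _) _.
apply: (@le_trans _ _ (\sum_(k < n) (k.+1%:R ^- 2) * (C * hs p.+2 q T))); last first.
  by rewrite -mulr_suml -mulrA ler_wpM2r ?mulr_ge0// sum_inv_sqr.
apply: ler_sum => k _; rewrite lnormZ [leRHS]mulrC ler_pdivlMr//.
have := hs_col p.+2 q T k; have := xC k.
have := exprD (k.+1%:R : R) p 2; rewrite addn2 => ->.
have := lnorm_ge0 q (ecol T k); have := s_weight_ge0 (R := R) k p; have := s_weight_ge0 (R := R) k 2.
move: (_ ^+ p) (_ ^+ 2) (lnorm _ _) (normc _) (hs _ _ _) => a b l m h b0 a0 l0 h1 h2.
apply: le_trans (_ : C * (a * b * l) <= _); last exact: ler_wpM2l.
have -> : C * (a * b * l) = C * a * l * b by ring.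
by rewrite ler_wpM2r// ler_wpM2r.
Qed.

(** Uniform convergence on bounded sets is uniform convergence on the balls of
    polynomially bounded sequences; on such a ball an operator is bounded by a
    Hilbert-Schmidt norm of higher order, and conversely the multiples
    (k+1)^(n+1) e_k lie in such a ball. *)
Lemma Lss_nbhsP T (A : set L) : nbhs T A <->
  exists n, exists2 e : R, 0 < e & forall T' : L, hs n n (T' - T : L) < e -> A T'.
Proof.
have famD (B C : set D) : vbounded B -> vbounded C ->
    exists2 F, vbounded F & B `|` C `<=` F.
  move=> /vbounded_dual[p [M [M0 BM]]] /vbounded_dual[r [N [N0 CN]]].
  exists (dual_ball (maxn p r) (Num.max M N)); first exact: vbounded_dual_ball.
  move=> y [/BM h|/CN h] k; apply: le_trans (h k) _; apply: ler_pM => //.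
  - by rewrite le_max lexx.
  - by rewrite ler_weXn2l ?ler1n// leq_maxl.
  - by rewrite le_max lexx orbT.
  - by rewrite ler_weXn2l ?ler1n// leq_maxr.
have famE : exists B : set D, vbounded B by exists (dual_ball 0 0); exact: vbounded_dual_ball.
split.
  move=> /(@initial_nbhsE L {family @vbounded _ D, D -> S} (@Lss_fun R))[C].
  move=> /(fam_nbhs_base _ _ famE famD)[B [E [Bb [U [U0 UE]] EC]]] CA.
  have [n [e e0 eU]] := (s_nbhsP _ _).1 U0.
  have [p [K [K0 BK]]] := vbounded_dual Bb.
  have K1 : 0 < 2 * K + 1 by lra.
  (* Two orders more than the polynomial growth p of the bounded set, for
     summability. *)
  exists (maxn p.+2 n), (e / (2 * K + 1)); first by rewrite divr_gt0.
  move=> T' h; apply: CA; apply: EC => x /BK xK.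
  apply/set_mem/(UE (T x, T' x))/mem_set/eU => /=; rewrite subr0 lnormB.
  apply: le_lt_trans (Lss_dual_le (T' - T) n K0 xK) _.
  rewrite ltr_pdivlMr// in h.
  have := hs_homo (T' - T) (leq_maxl p.+2 n) (leq_maxr p.+2 n).
  have := hs_ge0 p.+2 n (T' - T).
  move: h; move: (hs _ _ _) (hs _ _ _) => a b; nra.
move=> [n [e e0 h]].
apply/(@initial_nbhsE L {family @vbounded _ D, D -> S} (@Lss_fun R)).
exists [set f : D -> S | forall x, dual_ball n.+1 1 x -> lnorm n (f x - T x) < e / 4].
  apply/(fam_nbhs_base _ _ famE famD).
  exists (dual_ball n.+1 1), [set xy : S * S | lnorm n (xy.1 - xy.2) < e / 4]; split.
  - exact: vbounded_dual_ball.
  - exists [set y | lnorm n y < e / 4]; split; last by move=> xy; rewrite !inE.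
    by apply/s_nbhsP; exists n, (e / 4); [rewrite divr_gt0|move=> y; rewrite subr0].
  - by move=> g gM z /gM /=; rewrite lnormB.
move=> T' /= hT'; apply: h.
have : hs n n (T' - T) <= 2 * (e / 4); last by move=> /le_lt_trans; apply; lra.
apply: hs_le => [|k]; first by rewrite divr_ge0// ltW.
have <- : lnorm n ((T' - T : L) (k.+1%:R ^+ n.+1 *: s_incl (es k))) = k.+1%:R ^+ n.+1 * lnorm n (ecol (T' - T : L) k).
  by rewrite LssZ lnormZ normcn.
apply/ltW/hT' => j; rewrite s_inclZ mul1r normcM normcn.
by case: eqP => [->|_]; rewrite ?normc1 ?mulr1// normc0 mulr0.
Qed.

End hilbert_schmidt.

(** * Operators given by their columns, products and limits *)

Section operator_series.
Context {R : realType}.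
Local Notation S := (s_space R).
Local Notation D := (s_dual R).
Local Notation L := (Lss R).
Implicit Types (q p k j n : nat) (T : L).
Hint Resolve s_weight_ge0 s_weight_gt0 s_l2 hs_ge0 : core.

Lemma mono_tail (s : nat -> R) M : (forall n, s n <= s n.+1) -> (forall n, s n <= M) ->
  forall e, 0 < e -> exists n0, forall n, (n0 <= n)%N -> s n - s n0 < e.
Proof.
move=> s1 sM e e0.
have sm : nondecreasing_seq s by apply/nondecreasing_seqP.
have cs : cvgn s by apply: nondecreasing_is_cvgn => //; exists M => _ [n _ <-].
have sl n : s n <= limn s by apply: nondecreasing_cvgn_le.
move/cvgrPdist_lt : (cs) => /(_ e e0)[n0 _ /(_ n0 (leqnn _))] /= h.
exists n0 => n _; have := sl n; have := ler_norm (limn s - s n0); lra.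
Qed.

Lemma eps_lin (e na : R) : 0 < e -> 0 <= na ->
  exists2 d, 0 < d & forall b c, 0 <= b -> b <= d -> c <= d -> na * b + c <= e.
Proof.
move=> e0 na0; have a0 : 0 < na + 1 by lra.
have [d d0 de] : exists2 d, 0 < d & d * (na + 1) = e.
  by exists (e / (na + 1)); [rewrite divr_gt0|rewrite divfK// gt_eqF].
exists d => // b c b0 h1 h2; rewrite -de mulrDr mulr1 (mulrC d); apply: lerD => //.
by rewrite ler_wpM2l.
Qed.

Lemma lnorm_subD (A : nat -> nat -> R) q (x y : lambda2 A) :
  lnorm q (x - y) <= lnorm q x + lnorm q y.
Proof. by apply: le_trans (lnormD _ _ _) _; rewrite (lnormN q y). Qed.

(** The partial sums are Cauchy for each seminorm because the sums of the
    norms are. *)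
Lemma lcvg_series (A : nat -> nat -> R) (v : nat -> lambda2 A) :
  (forall j q, 0 <= A j q) -> (forall j, exists q, 0 < A j q) ->
  (forall q, exists M, forall n, \sum_(k < n) lnorm q (v k) <= M) ->
  exists x, lcvg (fun n => \sum_(k < n) v k) x.
Proof.
move=> A0 Apos hv; apply: lambda2_complete => // q e e0.
have [M hM] := hv q.
have e20 : 0 < e / 2 by rewrite divr_gt0.
have s1 n : \sum_(k < n) lnorm q (v k) <= \sum_(k < n.+1) lnorm q (v k).
  by rewrite big_ord_recr/= lerDl lnorm_ge0.
have [n0 h] := @mono_tail (fun n => \sum_(k < n) lnorm q (v k)) M s1 hM _ e20.
exists n0.
have key m : (n0 <= m)%N -> lnorm q (\sum_(k < m) v k - \sum_(k < n0) v k) <= e / 2.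
  move=> n0m; apply: le_trans (ltW (h m n0m)).
  rewrite -(subnKC n0m); elim: (m - n0)%N => [|d IH].
    by rewrite addn0 !subrr lnorm0.
  rewrite addnS !big_ord_recr/= addrAC (addrAC _ _ (- _)).
  by apply: le_trans (lnormD _ _ _) _; rewrite lerD2r.
move=> n m hn hm.
have -> : \sum_(k < n) v k - \sum_(k < m) v k =
  (\sum_(k < n) v k - \sum_(k < n0) v k) - (\sum_(k < m) v k - \sum_(k < n0) v k).
  by rewrite opprB addrA subrK.
apply: le_trans (lnorm_subD _ _ _) _.
by rewrite (splitr e); apply: lerD; [exact: key|exact: key].
Qed.

(** Prescribed rapidly decreasing columns t_k define an operator by the sum of
    the x_k t_k. It is continuous because the vectors (k+1)^2 |t_k|_q e_k form
    a bounded subset of s, against which x is tested. *)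
Lemma Lss_of_columns (t : nat -> S) :
  (forall q, exists K, forall k, k.+1%:R ^+ q * lnorm q (t k) <= K) ->
  exists T : L, forall k, ecol T k = t k.
Proof.
move=> ht.
have {}ht p q : exists K, 0 <= K /\ forall k, k.+1%:R ^+ p * lnorm q (t k) <= K.
  have [K h] := ht (maxn p q).
  have {}h k : k.+1%:R ^+ p * lnorm q (t k) <= K.
    apply: le_trans (h k); apply: ler_pM; rewrite ?s_weight_ge0 ?lnorm_ge0//.
      by rewrite ler_weXn2l ?ler1n// leq_maxl.
    exact: (lnorm_homo (t k) (leq_maxr p q)).
  by exists K; split=> //; apply: le_trans (h 0%N); rewrite mulr_ge0// lnorm_ge0.
have /choice[F FP] : forall x : D, exists y, scvg (fun n => \sum_(k < n) x k *: t k) y.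
  move=> x; have [p [C [C0 xC]]] := s_dual_in_ball x.
  apply: (@lcvg_series _ (fun k => x k *: t k : S)); first by move=> j q; exact: s_weight_ge0.
    by move=> j; exists 0%N; exact: s_weight_gt0.
  move=> q; have [K [K0 hK]] := ht p.+2 q.
  (* Two of the p+2 orders of decay of the columns pay for the summation. *)
  exists (2 * (C * K)) => n.
  apply: (@le_trans _ _ (\sum_(k < n) (k.+1%:R ^- 2) * (C * K))); last first.
    by rewrite -mulr_suml ler_wpM2r ?mulr_ge0// sum_inv_sqr.
  apply: ler_sum => k _; rewrite lnormZ [leRHS]mulrC ler_pdivlMr//.
  have := hK k; have := xC k; have := exprD (k.+1%:R : R) p 2; rewrite addn2 => ->.
  have := lnorm_ge0 q (t k); have := s_weight_ge0 (R := R) k p; have := s_weight_ge0 (R := R) k 2.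
  move: (_ ^+ p) (_ ^+ 2) (lnorm _ _) (normc _) => a b l m b0 a0 l0 h1 h2.
  apply: le_trans (_ : C * (a * b * l) <= _); last exact: ler_wpM2l.
  have -> : C * (a * b * l) = C * a * l * b by ring.
  by rewrite ler_wpM2r// ler_wpM2r.
have Flin : linear F.
  move=> a x y; apply: (scvg_unique (FP _)).
  have := lcvg_lin a (FP x) (FP y); rewrite /scvg.
  have -> // : (fun n => a *: (\sum_(k < n) x k *: t k) + \sum_(k < n) y k *: t k) =
    (fun n => \sum_(k < n) (a *: x + y) k *: t k).
  apply/funext => n; rewrite scaler_sumr -big_split; apply: eq_bigr => k _.
  by rewrite s_dualD s_dualZ scalerDl scalerA.
have FB x y : F (x - y) = F x - F y.
  by rewrite addrC -scaleN1r Flin scaleN1r addrC.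
have Fcont : continuous F.
  move=> x A /s_nbhsP[q [e e0 eA]].
  have /choice[M MP] : forall r, exists K, 0 <= K /\ forall k, k.+1%:R ^+ (2 + r) * lnorm q (t k) <= K.
    by move=> r; exact: ht.
  have e40 : 0 < e / 4 by rewrite divr_gt0.
  have : nbhs x [set y : D | forall z, s_ball M z -> normc (dual_pair y z - dual_pair x z) < e / 4].
    by apply/s_dual_nbhsP; exists M, (e / 4).
  apply: filterS => y hy /=; apply: eA; rewrite -FB.
  apply: le_lt_trans (_ : 2 * (e / 4) < _); last lra.
  apply: (lcvg_le (FP (y - x))); exists 0%N => n _.
  apply: le_trans (lnorm_sum _ _ _ _) _.
  apply: (@le_trans _ _ (\sum_(k < n) (k.+1%:R ^- 2) * (e / 4))); last first.
    by rewrite -mulr_suml ler_wpM2r ?(ltW e40)// sum_inv_sqr.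
  apply: ler_sum => k _; rewrite lnormZ [leRHS]mulrC ler_pdivlMr//.
  have zM : s_ball M ((k.+1%:R ^+ 2 * lnorm q (t k))%:C *: es k).
    move=> r; rewrite lnormZ lnorm_es normcR ger0_norm ?mulr_ge0 ?lnorm_ge0//.
    by have [_ /(_ k)] := MP r; rewrite exprD mulrAC.
  have := hy _ zM; rewrite !dual_pair_term -mulrBl normcM normcR ger0_norm ?mulr_ge0 ?lnorm_ge0//.
  by move=> /ltW h; rewrite s_dualB -mulrA (mulrC (lnorm q (t k))).
have Fm : F \in @Lss_mem R by apply/asboolP; split.
exists (MkLss Fm) => k; apply: (scvg_unique (FP (s_incl (es k)))).
move=> q e e0; exists k.+1 => n kn.
rewrite (bigD1 (Ordinal kn))//= big1 => [|i ik].
  by rewrite addr0 /delta eqxx scale1r subrr lnorm0 ltW.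
rewrite /delta (_ : (i == k :> nat) = false) ?scale0r//.
by apply/negbTE; apply: contraNN ik => /eqP h; apply/eqP/val_inj.
Qed.

(** The action on s itself, where adjoints and projections are studied. *)
Definition app T (x : S) : S := T (s_incl x).

Lemma s_inclD a (x y : S) : s_incl (a *: x + y) = a *: s_incl x + s_incl y.
Proof. exact: s_incl_linear. Qed.

Lemma app_lin T a x y : app T (a *: x + y) = a *: app T x + app T y.
Proof. by rewrite /app s_inclD Lss_linearP. Qed.

Lemma app_mul T T' x : app (Lss_mul T T') x = app T (app T' x).
Proof. by []. Qed.

Lemma app_es T k : app T (es k) = ecol T k.
Proof. by []. Qed.

Lemma ecol_mul T T' k : ecol (Lss_mul T T') k = app T (ecol T' k).
Proof. by []. Qed.

Lemma app_sum T (x : S) : scvg (fun n => \sum_(k < n) x k *: ecol T k) (app T x).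
Proof. exact: (Lss_sum T (s_incl x)). Qed.

(** Cauchy-Schwarz for finite sums with prescribed bounds, so that the bounds
    may be 0. *)
Lemma fin_CS n (a b : nat -> R) (A B : R) : 0 <= A -> 0 <= B ->
  \sum_(k < n) a k ^+ 2 <= A ^+ 2 -> \sum_(k < n) b k ^+ 2 <= B ^+ 2 ->
  \sum_(k < n) a k * b k <= A * B.
Proof.
move=> A0 B0 hA hB.
have z0 (c : nat -> R) : \sum_(k < n) c k ^+ 2 <= 0 -> forall k : 'I_n, c k = 0.
  move=> h k; apply/eqP; rewrite -sqrf_eq0 eq_le sqr_ge0 andbT; apply: le_trans h.
  by rewrite (bigD1 k)//= lerDl; apply: sumr_ge0 => i _; rewrite sqr_ge0.
have [EA|nA] := eqVneq A 0.
  by rewrite big1 ?mulr_ge0// => k _; rewrite z0 ?mul0r//; move: hA; rewrite EA expr0n.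
have [EB|nB] := eqVneq B 0.
  by rewrite big1 ?mulr_ge0// => k _; rewrite (z0 b) ?mulr0//; move: hB; rewrite EB expr0n.
have {A0}A0 : 0 < A by rewrite lt_neqAle eq_sym nA.
have {B0}B0 : 0 < B by rewrite lt_neqAle eq_sym nB.
apply: (@le_trans _ _ (\sum_(k < n) (B / A / 2 * a k ^+ 2 + A / B / 2 * b k ^+ 2))).
  apply: ler_sum => k _.
  have -> : B / A / 2 * a k ^+ 2 + A / B / 2 * b k ^+ 2 =
      a k * b k + (B * a k - A * b k) ^+ 2 / (2 * (A * B)).
    by field; rewrite nA nB.
  by rewrite lerDl divr_ge0 ?sqr_ge0// !mulr_ge0// ltW.
rewrite big_split/= -!mulr_sumr.
have -> : A * B = (B / A / 2) * A ^+ 2 + (A / B / 2) * B ^+ 2 by field; rewrite nA nB.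
by apply: lerD; rewrite ler_wpM2l// !divr_ge0// ltW.
Qed.

(** An operator is bounded from l2 by its Hilbert-Schmidt norm. *)
Lemma app_le T q (x : S) : lnorm q (app T x) <= hs 0 q T * lnorm 0 x.
Proof.
apply: (lcvg_le (app_sum T x)); exists 0%N => n _.
apply: le_trans (lnorm_sum _ _ _ _) _.
rewrite mulrC; under eq_bigr do rewrite lnormZ.
have h1 : \sum_(k < n) normc (x k) ^+ 2 <= lnorm 0 x ^+ 2.
  apply: le_trans (wpsum_le_wnorm n (lambda2_lty 0 x)); rewrite /wpsum.
  by under [leRHS]eq_bigr do rewrite expr0 mulr1.
have h2 : \sum_(k < n) lnorm q (ecol T k) ^+ 2 <= hs 0 q T ^+ 2.
  apply: le_trans (hs_psum 0 q T n).
  by under [leRHS]eq_bigr do rewrite expr0 mulr1.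
exact: (@fin_CS n (fun k => normc (x k)) (fun k => lnorm q (ecol T k))
  (lnorm 0 x) (hs 0 q T) (lnorm_ge0 _ _) (hs_ge0 _ _ _) h1 h2).
Qed.

(** The columns of the product are T applied to the columns of the second
    factor, to which the bound of T on l2 applies. *)
Lemma hsM p q T T' : hs p q (Lss_mul T T') <= hs 0 q T * hs p 0 T'.
Proof.
apply: hs_mono => [|k]; first by rewrite hs_ge0.
by rewrite ecol_mul mulrA ler_wpM2r ?s_weight_ge0//; exact: app_le.
Qed.

Definition opcvg (u : nat -> L) T := forall p q (e : R), 0 < e ->
  exists n0, forall n, (n0 <= n)%N -> hs p q (u n - T : L) <= e.

Lemma opcvg_col u T k : opcvg u T -> scvg (fun n => ecol (u n) k) (ecol T k).
Proof.
move=> uT q e e0; have [n0 h] := uT 0%N q e e0; exists n0 => n /h; apply: le_trans.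
by have := hs_col 0 q (u n - T : L) k; rewrite expr0 mul1r.
Qed.

Lemma opcvg_entry u T k j : opcvg u T -> ccvg (fun n => ecol (u n) k j) (ecol T k j).
Proof. by move=> /opcvg_col h; apply: scvg_ccvg. Qed.

Lemma opcvg_lin u v T T' a : opcvg u T -> opcvg v T' ->
  opcvg (fun n => a *: u n + v n) (a *: T + T').
Proof.
move=> ux vy p q e e0; have [d d0 hd] := eps_lin e0 (normc_ge0 a).
have [n1 h1] := ux p q d d0; have [n2 h2] := vy p q d d0.
exists (maxn n1 n2) => n; rewrite geq_max => /andP[n1n n2n].
have -> : a *: u n + v n - (a *: T + T') = a *: (u n - T) + (v n - T').
  by rewrite scalerBr opprD addrACA.
apply: le_trans (hsD p q (a *: (u n - T)) (v n - T')) _; rewrite (hsZ p q a (u n - T)).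
exact: hd (hs_ge0 _ _ _) (h1 n n1n) (h2 n n2n).
Qed.

Lemma LmulBl T T' T'' : Lss_mul (T - T') T'' = Lss_mul T T'' - Lss_mul T' T''.
Proof. by apply: Lss_ext. Qed.

Lemma appB T x y : app T (x - y) = app T x - app T y.
Proof. by rewrite addrC -scaleN1r app_lin scaleN1r addrC. Qed.

Lemma appD T x y : app T (x + y) = app T x + app T y.
Proof. by have := app_lin T 1 x y; rewrite !scale1r. Qed.

Lemma app0 T : app T 0 = 0.
Proof. by have := app_lin T (-1) 0 0; rewrite scaler0 addr0 scaleN1r addNr. Qed.

Lemma appZ T a x : app T (a *: x) = a *: app T x.
Proof. by have := app_lin T a x 0; rewrite !addr0 => ->; rewrite app0 addr0. Qed.

Lemma LmulBr T T' T'' : Lss_mul T (T' - T'') = Lss_mul T T' - Lss_mul T T''.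
Proof. by apply: Lss_ext => k; rewrite ecolB !ecol_mul ecolB appB. Qed.

Lemma LmulZl a T T' : Lss_mul (a *: T) T' = a *: Lss_mul T T'.
Proof. by apply: Lss_ext. Qed.

Lemma LmulZr a T T' : Lss_mul T (a *: T') = a *: Lss_mul T T'.
Proof. by apply: Lss_ext => k; rewrite ecolZ !ecol_mul ecolZ appZ. Qed.

Lemma LmulDl T T' T'' : Lss_mul (T + T') T'' = Lss_mul T T'' + Lss_mul T' T''.
Proof. by apply: Lss_ext. Qed.

Lemma LmulDr T T' T'' : Lss_mul T (T' + T'') = Lss_mul T T' + Lss_mul T T''.
Proof.
by apply: Lss_ext => k; rewrite ecolD !ecol_mul ecolD appD.
Qed.

Lemma LmulA T T' T'' : Lss_mul T (Lss_mul T' T'') = Lss_mul (Lss_mul T T') T''.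
Proof. by apply: Lss_ext. Qed.

Lemma Lmul0l T : Lss_mul 0 T = 0.
Proof. by apply: Lss_ext. Qed.

Lemma Lmul0r T : Lss_mul T 0 = 0.
Proof. by have := LmulZr 0 T 0; rewrite !scale0r. Qed.

Lemma Lmul_sumr T n (F : nat -> L) :
  Lss_mul T (\sum_(i < n) F i) = \sum_(i < n) Lss_mul T (F i).
Proof. by elim/big_rec2: _ => [|i x y _ <-]; rewrite ?Lmul0r ?LmulDr. Qed.

Lemma Lmul_suml T n (F : nat -> L) :
  Lss_mul (\sum_(i < n) F i) T = \sum_(i < n) Lss_mul (F i) T.
Proof. by elim/big_rec2: _ => [|i x y _ <-]; rewrite ?Lmul0l ?LmulDl. Qed.

Lemma ecol_sum n (F : nat -> L) k : ecol (\sum_(i < n) F i : L) k = \sum_(i < n) ecol (F i) k.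
Proof. by elim/big_rec2: _ => [//|i x y _ <-]; rewrite ecolD. Qed.

Lemma opcvg_mulr u T T' : opcvg u T -> opcvg (fun n => Lss_mul T' (u n)) (Lss_mul T' T).
Proof.
move=> uT p q e e0; have [d d0 hd] := eps_lin e0 (hs_ge0 0 q T').
have [n0 h] := uT p 0%N d d0; exists n0 => n n0n; rewrite -LmulBr.
apply: le_trans (hsM p q T' (u n - T)) _; rewrite -[leLHS]addr0.
exact: hd (hs_ge0 _ _ _) (h n n0n) (ltW d0).
Qed.

Lemma opcvg_mull u T T' : opcvg u T -> opcvg (fun n => Lss_mul (u n) T') (Lss_mul T T').
Proof.
move=> uT p q e e0; have [d d0 hd] := eps_lin e0 (hs_ge0 p 0 T').
have [n0 h] := uT 0%N q d d0; exists n0 => n n0n; rewrite -LmulBl.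
apply: le_trans (hsM p q (u n - T) T') _; rewrite -[leLHS]addr0 mulrC.
exact: hd (hs_ge0 _ _ _) (h n n0n) (ltW d0).
Qed.

Lemma opcvg_unique u T T' : opcvg u T -> opcvg u T' -> T = T'.
Proof.
move=> uT uT'; apply: Lss_ext => k.
exact: scvg_unique (opcvg_col k uT) (opcvg_col k uT').
Qed.

Lemma opcvg_le u T p q c : opcvg u T ->
  (exists n0, forall n, (n0 <= n)%N -> hs p q (u n) <= c) -> hs p q T <= c.
Proof.
move=> ux [n0 h]; apply/ler_addgt0Pr => e /(ux p q)[n1 h1].
have {}h := h (maxn n0 n1) (leq_maxl _ _).
have {}h1 := h1 (maxn n0 n1) (leq_maxr _ _).
have -> : T = u (maxn n0 n1) - (u (maxn n0 n1) - T) by rewrite opprB addrC subrK.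
apply: le_trans (hsD p q _ _) _; rewrite (hsN p q (_ - _)).
by move: h h1; clear; move: (hs _ _ _) (hs _ _ _) => b d; lra.
Qed.

(** Columns converge by completeness of s; the bounds needed for the limit
    columns to define an operator come from a single term of the sequence. *)
Lemma Lss_complete (u : nat -> L) :
  (forall q e, 0 < e -> exists n0, forall n m, (n0 <= n)%N -> (n0 <= m)%N ->
     hs q q (u n - u m : L) <= e) -> exists T, opcvg u T.
Proof.
move=> uC0.
have uC p q e : 0 < e -> exists n0, forall n m, (n0 <= n)%N -> (n0 <= m)%N ->
     hs p q (u n - u m : L) <= e.
  move=> e0; have [n0 h] := uC0 (maxn p q) e e0; exists n0 => n m hn hm.
  exact: le_trans (hs_homo _ (leq_maxl p q) (leq_maxr p q)) (h n m hn hm).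
have /choice[t tP] : forall k, exists x, scvg (fun n => ecol (u n) k) x.
  move=> k; apply: lambda2_complete => //; first by move=> j; exists 0%N.
  move=> q e e0; have [n0 h] := uC 0%N q e e0; exists n0 => n m hn hm.
  apply: le_trans (h n m hn hm); rewrite -ecolB.
  by have := hs_col 0 q (u n - u m : L) k; rewrite expr0 mul1r.
have [T TP] : exists T : L, forall k, ecol T k = t k.
  apply: Lss_of_columns => q; have [n0 h] := uC q q 1 ltr01.
  exists (1 + hs q q (u n0)) => k; rewrite mulrC -ler_pdivlMr//.
  apply: (lcvg_le (tP k)); exists n0 => n n0n; rewrite ler_pdivlMr// mulrC.
  apply: le_trans (hs_col q q (u n) k) _.
  have -> : u n = (u n - u n0) + u n0 by rewrite subrK.
  by apply: le_trans (hsD _ _ _ _) _; rewrite lerD2r h.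
exists T => p q e e0; have e20 : 0 < e / 2 by rewrite divr_gt0.
have [n0 h] := uC p.+1 q _ e20; exists n0 => n n0n.
have -> : e = 2 * (e / 2) by field.
apply: hs_le => [|k]; first exact: ltW.
have -> : ecol (u n - T : L) k = (-1) *: t k + ecol (u n) k.
  by rewrite ecolB TP scaleN1r addrC.
rewrite mulrC -ler_pdivlMr//.
apply: (lcvg_le (lcvg_lin (-1) (tP k) (lcvg_cst (ecol (u n) k)))).
exists n0 => m n0m; rewrite ler_pdivlMr// mulrC scaleN1r addrC -ecolB.
exact: le_trans (hs_col p.+1 q _ k) (h _ _ n0n n0m).
Qed.

End operator_series.

(** * Isomorphisms of graded spaces *)

Section graded.
Context {R : realType}.
Implicit Types V W U : preTopologicalLmodType R[i].

(** The topology induced on the subspace E is given by the increasing sequence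
    p of seminorms. Subspaces of s, spaces lambda2 and the operator algebras
    are treated uniformly in this way. *)
Definition graded V (E : set V) (p : nat -> V -> R) : Prop :=
  [/\ linear_subspace E,
      forall q x y, E x -> E y -> p q (x + y) <= p q x + p q y,
      forall q a x, E x -> p q (a *: x) = normc a * p q x,
      forall q x, E x -> p q x <= p q.+1 x &
      forall x (A : set V), E x -> (within E (nbhs x) A <->
        exists n, exists2 e : R, 0 < e & forall y, E y -> p n (y - x) < e -> A y)].

Definition lin_on V W (E : set V) (T : V -> W) : Prop :=
  forall (a : R[i]) x y, E x -> E y -> T (a *: x + y) = a *: T x + T y.

(** Continuity of linear maps between graded spaces, expressed by the
    seminorms. *)
Definition bounded_on V W (E : set V) (p : nat -> V -> R) (p' : nat -> W -> R) (T : V -> W) :=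
  forall q, exists r (c : R), 0 <= c /\ forall x, E x -> p' q (T x) <= c * p r x.

(** An isomorphism together with its inverse and the estimates in both
    directions; the form in which isomorphisms are composed. *)
Definition tame_iso V W (E : set V) p (F : set W) p' (T : V -> W) (S : W -> V) : Prop :=
  [/\ lin_on E T, forall x, E x -> F (T x) /\ S (T x) = x,
    forall y, F y -> E (S y) /\ T (S y) = y,
    bounded_on E p p' T & bounded_on F p' p S].

Lemma subspaceZ V (E : set V) a x : linear_subspace E -> E x -> E (a *: x).
Proof. by move=> [E0 Elin] Ex; rewrite -[_ *: _]addr0; exact: Elin. Qed.

Lemma subspaceD V (E : set V) x y : linear_subspace E -> E x -> E y -> E (x + y).
Proof. by move=> [E0 Elin] Ex Ey; rewrite -[x]scale1r; exact: Elin. Qed.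

Lemma subspaceB V (E : set V) x y : linear_subspace E -> E x -> E y -> E (x - y).
Proof. by move=> [E0 Elin] Ex Ey; rewrite addrC -scaleN1r; exact: Elin. Qed.

Lemma subspace_sum V (E : set V) (I : Type) (r : seq I) (P : pred I) (F : I -> V) :
  linear_subspace E -> (forall i, P i -> E (F i)) -> E (\sum_(i <- r | P i) F i).
Proof.
move=> hE h; elim/big_rec: _ => [|i x Pi Ex]; first by have [] := hE.
by apply: subspaceD => //; exact: h.
Qed.

Lemma lin_on0 V W (E : set V) (T : V -> W) : linear_subspace E -> lin_on E T -> T 0 = 0.
Proof.
by move=> [E0 _] Tl; have := Tl (-1) 0 0 E0 E0; rewrite scaler0 addr0 scaleN1r addNr.
Qed.

Lemma lin_onZ V W (E : set V) (T : V -> W) a x : linear_subspace E -> lin_on E T -> E x ->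
  T (a *: x) = a *: T x.
Proof.
by move=> hE Tl Ex; have [E0 _] := hE; have := Tl a x 0 Ex E0; rewrite !addr0 (lin_on0 hE Tl) addr0.
Qed.

Lemma lin_onB V W (E : set V) (T : V -> W) x y : linear_subspace E -> lin_on E T -> E x -> E y ->
  T (x - y) = T x - T y.
Proof.
by move=> hE Tl Ex Ey; rewrite addrC -scaleN1r Tl// scaleN1r addrC.
Qed.

Lemma lin_on_sum V W (E : set V) (T : V -> W) n (c : nat -> R[i]) (x : nat -> V) :
  linear_subspace E -> lin_on E T -> (forall i, E (x i)) ->
  T (\sum_(i < n) c i *: x i) = \sum_(i < n) c i *: T (x i).
Proof.
move=> hE Tl Ex; elim: n => [|n IH]; first by rewrite !big_ord0 (lin_on0 hE Tl).
rewrite !big_ord_recr/= addrC Tl//; first by rewrite IH addrC.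
by apply: subspace_sum => // i _; apply: subspaceZ.
Qed.

Lemma graded_ge0 V (E : set V) p q x : graded E p -> E x -> 0 <= p q x.
Proof.
move=> [hE pD pZ _ _] Ex; have [E0 _] := hE.
have p0 : p q 0 = 0 by rewrite -(scale0r 0) pZ// normc0 mul0r.
have Enx : E (- x) by rewrite -scaleN1r; exact: subspaceZ.
have := pD q x (- x) Ex Enx; rewrite subrr p0 -scaleN1r pZ//.
rewrite normcN normc1 mul1r; lra.
Qed.

(** Continuity at 0 gives a bound on a small ball, and homogeneity extends it.
    The summand d avoids dividing by a seminorm that may vanish. *)
Lemma graded_continuous V W (E : set V) p (F : set W) p' (T : V -> W) :
  graded E p -> graded F p' -> lin_on E T -> (forall x, E x -> F (T x)) ->
  {within E, continuous T} <-> bounded_on E p p' T.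
Proof.
move=> gE gF Tl TF; have [hE pD pZ pm pn] := gE; have [hF pD' pZ' pm' pn'] := gF.
have [E0 _] := hE; have [F0 _] := hF; have T0 := lin_on0 hE Tl.
split=> [/subspace_continuousP Tc q|Tb].
  have : within F (nbhs 0) [set y | p' q y < 1].
    by apply/pn' => //; exists q, 1 => // y Fy; rewrite subr0.
  rewrite -T0 => /(Tc 0 E0) h.
  have /pn[//|n [e e0 {}h]] : within E (nbhs 0) [set x | p' q (T x) < 1].
    have h' : nbhs 0 [set x | E x -> F (T x) -> p' q (T x) < 1] := h.
    by apply: (filterS _ h') => x /= h1 Ex; apply: h1 => //; exact: TF.
  exists n, (2 / e); split=> [|x Ex]; first by rewrite divr_ge0// ltW.
  have px := graded_ge0 n gE Ex.
  apply/ler_addgt0Pr => d d0.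
  have D0 : 0 < 2 / e * p n x + d by rewrite ltr_wpDl// mulr_ge0// divr_ge0// ltW.
  pose t := (2 / e * p n x + d)^-1.
  have t0 : 0 < t by rewrite invr_gt0.
  have ne : normc t%:C = t by rewrite normcR gtr0_norm.
  have Et := subspaceZ t%:C hE Ex.
  have : p n (t%:C *: x - 0) < e.
    rewrite subr0 pZ// ne mulrC ltr_pdivrMr//.
    have -> : e * (2 / e * p n x + d) = 2 * p n x + e * d by field; rewrite gt_eqF.
    have := mulr_gt0 e0 d0; lra.
  move=> /(h _ Et); rewrite /= (lin_onZ _ hE)// pZ'//; last exact: TF.
  by rewrite ne mulrC ltr_pdivrMr// mul1r => /ltW.
apply/subspace_continuousP => x Ex B TB.
have : within F (nbhs (T x)) B by apply: filterS TB => y By _.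
move=> /pn'[|n [e e0 h]]; first exact: TF.
have [r [c [c0 hc]]] := Tb n.
have c1 : 0 < c + 1 by lra.
have : within E (nbhs x) (T @^-1` B); last by apply.
apply/pn => //; exists r, (e / (c + 1)); first by rewrite divr_gt0.
move=> y Ey; rewrite ltr_pdivlMr// => yx; apply: h; first exact: TF.
have Eyx := subspaceB hE Ey Ex.
rewrite -(lin_onB hE)//; apply: le_lt_trans (hc _ Eyx) _.
by have := graded_ge0 r gE Eyx; lra.
Qed.

Lemma inv_lin V W (E : set V) p (F : set W) p' (T : V -> W) S :
  linear_subspace E -> linear_subspace F -> tame_iso E p F p' T S -> lin_on F S.
Proof.
move=> hE hF [Tl TS ST _ _] a x y Fx Fy.
have [ESx TSx] := ST x Fx; have [ESy TSy] := ST y Fy.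
have ES : E (a *: S x + S y) by apply: hE.2.
by have [_ <-] := TS _ ES; rewrite Tl// TSx TSy.
Qed.

Lemma tame_sym V W (E : set V) p (F : set W) p' (T : V -> W) S :
  linear_subspace E -> linear_subspace F -> tame_iso E p F p' T S -> tame_iso F p' E p S T.
Proof.
move=> hE hF TS; have Sl := inv_lin hE hF TS.
by case: TS => ? ? ? ? ?; split.
Qed.

Lemma bounded_comp V W U (E : set V) p (F : set W) p' (p'' : nat -> U -> R) T S :
  (forall x, E x -> F (T x)) -> bounded_on E p p' T -> bounded_on F p' p'' S ->
  bounded_on E p p'' (S \o T).
Proof.
move=> TF Tb Sb q; have [r [c [c0 h]]] := Sb q; have [r' [c' [c'0 h']]] := Tb r.
exists r', (c * c'); split=> [|x Ex]; first exact: mulr_ge0.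
by rewrite -mulrA; apply: le_trans (h _ (TF _ Ex)) _; rewrite ler_wpM2l// h'.
Qed.

Lemma tame_trans V W U (E : set V) p (F : set W) p' (G : set U) p'' T S T' S' :
  tame_iso E p F p' T S -> tame_iso F p' G p'' T' S' ->
  tame_iso E p G p'' (T' \o T) (S \o S').
Proof.
move=> [Tl TS ST Tb Sb] [Tl' TS' ST' Tb' Sb']; split.
- by move=> a x y Ex Ey /=; rewrite Tl// Tl'//; [have [] := TS x Ex|have [] := TS y Ey].
- move=> x Ex /=; have [FT e] := TS x Ex; have [GT e'] := TS' _ FT.
  by rewrite e'.
- move=> x Gx /=; have [FT e] := ST' x Gx; have [GT e'] := ST _ FT.
  by rewrite e'.
- by apply: bounded_comp Tb Tb' => x /TS[].
- by apply: bounded_comp Sb' Sb => x /ST'[].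
Qed.

Lemma tame_frechet V W (E : set V) p (F : set W) p' (T : V -> W) S :
  graded E p -> graded F p' -> tame_iso E p F p' T S -> frechet_iso_map E F T.
Proof.
move=> gE gF TS; have [hE _ _ _ _] := gE; have [hF _ _ _ _] := gF.
have Sl := inv_lin hE hF TS; case: TS => Tl TS ST Tb Sb.
split.
- exact: Tl.
- split.
  + by move=> x /TS[].
  + move=> x y /set_mem Ex /set_mem Ey; have [_ e] := TS x Ex; have [_ e'] := TS y Ey.
    by move=> h; rewrite -e h e'.
  + by move=> y /ST[ES e]; exists (S y).
- by apply/(graded_continuous gE gF Tl) => // x /TS[].
- exists S; first by move=> x /TS[].
  by apply/(graded_continuous gF gE Sl) => // x /ST[].
Qed.

Lemma frechet_tame V W (E : set V) p (F : set W) p' (T : V -> W) :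
  graded E p -> graded F p' -> frechet_iso_map E F T -> exists S, tame_iso E p F p' T S.
Proof.
move=> gE gF [Tl [Tf Ti Ts] Tc [S ST Sc]]; have [hE _ _ _ _] := gE; have [hF _ _ _ _] := gF.
have TS y : F y -> E (S y) /\ T (S y) = y by move=> /Ts[x Ex <-]; rewrite ST.
have ST' x : E x -> F (T x) /\ S (T x) = x by move=> Ex; split; [exact: Tf|exact: ST].
have Sl : lin_on F S.
  move=> a x y Fx Fy; have [ESx TSx] := TS x Fx; have [ESy TSy] := TS y Fy.
  have ES : E (a *: S x + S y) by apply: hE.2.
  by have [_ <-] := ST' _ ES; rewrite Tl// TSx TSy.
exists S; split => //.
- by apply: (graded_continuous gE gF Tl _).1 => // x /ST'[].
- by apply: (graded_continuous gF gE Sl _).1 => // x /TS[].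
Qed.

Lemma graded_s (X : set (s_space R)) : linear_subspace X -> graded X (fun q => @lnorm R _ q).
Proof.
move=> hX; split => //.
- by move=> q x y _ _; exact: lnormD.
- by move=> q a x _; exact: lnormZ.
- by move=> q x _; exact: (lnorm_homo x).
- move=> x A Xx; split.
    move=> /s_nbhsP[n [e e0 h]]; exists n, e => // y Xy /h; exact.
  by move=> [n [e e0 h]]; apply/s_nbhsP; exists n, e => // y yx Xy; exact: h.
Qed.

Definition kothe_mono (A : nat -> nat -> R) := forall j q, 0 <= A j q <= A j q.+1.

Lemma graded_lambda2 (A : nat -> nat -> R) : kothe_mono A ->
  graded [set: lambda2 A] (fun q => @lnorm R A q).
Proof.
move=> Am; split => //.
- by move=> q x y _ _; exact: lnormD.
- by move=> q a x _; exact: lnormZ.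
- move=> q x _; have := @wnorm_mono R (A ^~ q) (A ^~ q.+1) x x 1
    (lambda2_lty q.+1 _) ler01; rewrite mul1r => -[j|_]; last exact.
  have /andP[A0 A1] := Am j q.
  by rewrite mul1r mulr_ge0 ?normc_ge0//= ler_wpM2l ?normc_ge0.
- move=> x B _; split.
    by move=> /(lambda2_nbhsP _ _ Am)[n [e e0 h]]; exists n, e => // y _ /h; exact.
  by move=> [n [e e0 h]]; apply/(lambda2_nbhsP _ _ Am); exists n, e => // y yx _; exact: h.
Qed.

End graded.

(** * Adjoints *)

Section adjoints.
Context {R : realType}.
Local Notation S := (s_space R).
Local Notation L := (Lss R).
Implicit Types (q p k j n : nat) (T : L) (x y z : S).
Hint Resolve s_weight_ge0 s_weight_gt0 s_l2 hs_ge0 : core.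

Lemma sdotDl_l2 a x y (z : nat -> R[i]) : l2_mem z ->
  l2_dot (a *: x + y : S) z = a * l2_dot x z + l2_dot y z.
Proof. by move=> hz; exact: (dotDl a (s_l2 x) (s_l2 y) hz). Qed.

Lemma scvg_dot (u : nat -> S) x (y : nat -> R[i]) : scvg u x -> l2_mem y ->
  ccvg (fun n => l2_dot (u n) y) (l2_dot x y).
Proof.
move=> ux hy e e0; have y0 : 0 < l2_norm y + 1 by have := wnorm_ge0 (fun=> 1) y; rewrite /l2_norm; lra.
have e1 : 0 < e / (l2_norm y + 1) / 2 by rewrite !divr_gt0.
have [n0 h] := ux 0%N _ e1; exists n0 => n n0n.
have -> : l2_dot (u n) y - l2_dot x y = l2_dot (u n - x : S) y.
  have -> : u n - x = (-1) *: x + u n by rewrite scaleN1r addrC.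
  by rewrite (sdotDl_l2 _ _ _ hy) mulN1r addrC.
apply: le_lt_trans (dot_CS (s_l2 _) hy) _.
have h1 := h n n0n; have h2 : l2_norm (u n - x : S) <= e / (l2_norm y + 1) / 2 by exact: h1.
apply: (@le_lt_trans _ _ (e / (l2_norm y + 1) / 2 * (l2_norm y + 1))).
  apply: ler_pM => //; rewrite ?wnorm_ge0//; lra.
by rewrite mulrAC divfK ?gt_eqF//; lra.
Qed.

Lemma dot_es_l (x : nat -> R[i]) k : l2_mem x -> l2_dot (es k) x = (x k)^*.
Proof.
move=> hx; apply: dot_eq => // e e0; exists k.+1 => n kn.
rewrite (bigD1 (Ordinal kn))//= big1 => [|i ik].
  by rewrite /delta eqxx mul1r addr0 subrr normc0.
rewrite /delta (_ : (i == k :> nat) = false) ?mul0r//.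
by apply/negbTE; apply: contraNN ik => /eqP h; apply/eqP/val_inj.
Qed.

(** It suffices to test the adjoint on unit vectors, since the scalar products
    are limits of those of the partial expansions of the arguments. *)
Lemma adjointP T T' : Lss_adjoint T T' <->
  forall k j, ecol T k j = (ecol T' j k)^*.
Proof.
split=> [h k j|h x y hx hy].
  have := h (s_incl (es k)) (s_incl (es j)) (s_l2 (es k)) (s_l2 (es j)).
  by rewrite [LHS]dot_es [RHS]dot_es_l.
have hk k : l2_dot (ecol T k) y = (T' y k)^*.
  apply: dot_eq => //; have := ccvg_conj (scvg_ccvg k (Lss_sum T' y)).
  move=> /ccvg_eq; apply => n; rewrite lambda2_sum rmorph_sum; apply: eq_bigr => j _.
  by rewrite lambda2Z rmorphM/= h mulrC.
have h1 := scvg_dot (Lss_sum T x) hy.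
apply: (ccvg_unique h1); apply: ccvg_eq (dot_ccvg hx (s_l2 (T' y))) _ => n.
elim: n => [|n IH]; first by rewrite !big_ord0 dot0l.
have -> : \sum_(k < n.+1) x k *: ecol T k = x n *: ecol T n + \sum_(k < n) x k *: ecol T k.
  by rewrite big_ord_recr addrC.
by rewrite (sdotDl_l2 _ _ _ hy) hk -IH big_ord_recr addrC.
Qed.

Lemma sdotDl a x y z : l2_dot (a *: x + y) z = a * l2_dot x z + l2_dot y z.
Proof. exact: sdotDl_l2. Qed.

Lemma sdot_conj x y : l2_dot y x = (l2_dot x y)^*.
Proof. by rewrite -dotC. Qed.

Lemma sdot0l x : l2_dot (0 : S) x = 0.
Proof. by rewrite -[RHS](dot0l (s_l2 x)). Qed.

Lemma sdotZl a x y : l2_dot (a *: x) y = a * l2_dot x y.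
Proof. by have := sdotDl a x 0 y; rewrite addr0 sdot0l addr0. Qed.

Lemma sdotZr a x y : l2_dot y (a *: x) = a^* * l2_dot y x.
Proof. by rewrite sdot_conj sdotZl rmorphM/= -sdot_conj. Qed.

Lemma sdotAl x y z : l2_dot (x + y) z = l2_dot x z + l2_dot y z.
Proof. by have := sdotDl 1 x y z; rewrite scale1r mul1r. Qed.

Lemma sdotAr x y z : l2_dot z (x + y) = l2_dot z x + l2_dot z y.
Proof. by rewrite sdot_conj sdotAl rmorphD/= -!sdot_conj. Qed.

Lemma sdotBl x y z : l2_dot (x - y) z = l2_dot x z - l2_dot y z.
Proof. by rewrite sdotAl -scaleN1r sdotZl mulN1r. Qed.

Lemma sdotBr x y z : l2_dot z (x - y) = l2_dot z x - l2_dot z y.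
Proof. by rewrite sdot_conj sdotBl rmorphB/= -!sdot_conj. Qed.

Lemma sdotxx x : l2_dot x x = (lnorm 0 x ^+ 2)%:C.
Proof. exact: dotxx. Qed.

Lemma sdot_CS x y : normc (l2_dot x y) <= lnorm 0 x * lnorm 0 y.
Proof. exact: dot_CS. Qed.

Lemma lnorm0_sqr x : lnorm 0 x ^+ 2 = complex.Re (l2_dot x x).
Proof. by rewrite sdotxx. Qed.

Lemma lnorm0_eq0 x : lnorm 0 x <= 0 -> x = 0.
Proof.
move=> h; have {h}h : lnorm 0 x = 0 by apply/eqP; rewrite eq_le h lnorm_ge0.
by apply: val_inj; exact: l2_norm_eq0 (s_l2 x) h.
Qed.

Lemma Lss_adj T T' x y : Lss_adjoint T T' -> l2_dot (app T x) y = l2_dot x (app T' y).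
Proof. by move=> h; exact: (h (s_incl x) (s_incl y) (s_l2 x) (s_l2 y)). Qed.

Lemma adj_sym T T' : Lss_adjoint T T' -> Lss_adjoint T' T.
Proof. by move=> /adjointP h; apply/adjointP => k j; rewrite h conjcK. Qed.

Lemma adj_unique T T' T'' : Lss_adjoint T T' -> Lss_adjoint T T'' -> T' = T''.
Proof.
move=> /adjointP h /adjointP h'; apply: Lss_ext => k; apply: lambda2_ext => j.
by apply: (can_inj (@conjcK R)); rewrite -h -h'.
Qed.

Lemma adj_lin a T T' U U' : Lss_adjoint T T' -> Lss_adjoint U U' ->
  Lss_adjoint (a *: T + U) (a^* *: T' + U').
Proof.
move=> /adjointP h /adjointP h'; apply/adjointP => k j.
rewrite !ecolD !ecolZ !lambda2D !lambda2Z rmorphD rmorphM/= conjcK.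
by rewrite h h'.
Qed.

Lemma Ladj0 : Lss_adjoint (0 : L) 0.
Proof. by apply/adjointP => k j; rewrite !ecol0 !lambda20 rmorph0. Qed.

Lemma LadjZ a T T' : Lss_adjoint T T' -> Lss_adjoint (a *: T) (a^* *: T').
Proof. by move=> h; have := adj_lin a h Ladj0; rewrite !addr0. Qed.

Lemma LadjD T T' U U' : Lss_adjoint T T' -> Lss_adjoint U U' -> Lss_adjoint (T + U) (T' + U').
Proof. by move=> h h'; have := adj_lin 1 h h'; rewrite rmorph1 !scale1r. Qed.

Lemma LadjB T T' U U' : Lss_adjoint T T' -> Lss_adjoint U U' -> Lss_adjoint (T - U) (T' - U').
Proof.
move=> h h'; have := adj_lin (-1) h' h.
by rewrite rmorphN rmorph1 !scaleN1r ![- _ + _]addrC.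
Qed.

Lemma LadjM T T' U U' : Lss_adjoint T T' -> Lss_adjoint U U' ->
  Lss_adjoint (Lss_mul T U) (Lss_mul U' T').
Proof.
move=> h h'; apply/adjointP => k j.
rewrite -!dot_es !ecol_mul -app_es -app_es (Lss_adj _ _ h) app_es -app_es.
by rewrite (Lss_adj _ _ h') -sdot_conj.
Qed.

Lemma adj_lim (u v : nat -> L) T T' : (forall n, Lss_adjoint (u n) (v n)) ->
  opcvg u T -> opcvg v T' -> Lss_adjoint T T'.
Proof.
move=> uv uT vT; apply/adjointP => k j; apply: (ccvg_unique (opcvg_entry k j uT)).
apply: ccvg_eq (ccvg_conj (opcvg_entry j k vT)) _ => n.
by have /adjointP -> := uv n.
Qed.

Lemma Lss_closed (E : set L) (u : nat -> L) T : closed E -> (forall n, E (u n)) ->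
  opcvg u T -> E T.
Proof.
move=> cE Eu uT; apply: cE => B /Lss_nbhsP[n [e e0 h]].
have e20 : 0 < e / 2 by rewrite divr_gt0.
have [n0 /(_ n0 (leqnn _)) h1] := uT n n _ e20.
by exists (u n0); split=> //; apply: h; apply: le_lt_trans h1 _; lra.
Qed.

(** The topology is given by countably many norms, so that points of the
    closure are limits of sequences. *)
Lemma Lss_closureP (E : set L) T : closure E T ->
  exists2 u : nat -> L, forall n, E (u n) & opcvg u T.
Proof.
move=> cT.
have /choice[u uP] : forall n : nat, exists U : L, E U /\ hs n n (U - T) < n.+1%:R^-1.
  move=> n; have : nbhs T [set U : L | hs n n (U - T) < n.+1%:R^-1].
    by apply/Lss_nbhsP; exists n, (n.+1%:R^-1).
  by move=> /cT[U []]; exists U.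
exists u => [n|p q e e0]; first by have [] := uP n.
pose m := Num.bound e^-1; exists (maxn (maxn p q) m) => n.
rewrite !geq_max => /andP[/andP[pn qn] mn].
apply: le_trans (hs_homo (u n - T) pn qn) _; have [_ /ltW h] := uP n.
apply: le_trans h _; rewrite -[leRHS]invrK lef_pV2 ?posrE ?invr_gt0//.
apply: le_trans (_ : m%:R <= _); last by rewrite ler_nat; exact: leqW.
by apply/ltW/archi_boundP; rewrite invr_ge0 ltW.
Qed.

(** The entry in row j and column k is bounded by the norm of the column j.
    Normal operators have this property, as row j and column j then have equal
    norms; it trades decay of the rows for decay of the columns. *)
Definition balanced T := forall k j, normc (ecol T k j) <= lnorm 0 (ecol T j).

Lemma entry_le x j q : normc (x j) * j.+1%:R ^+ q <= lnorm q x.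
Proof. exact: (normc_le_wnorm j (lambda2_lty q x)). Qed.

Lemma entry_le0 x j : normc (x j) <= lnorm 0 x.
Proof. by have := entry_le x j 0; rewrite expr0 mulr1. Qed.

(** The entry T_(j,k) is bounded both by |T e_k|_0 and by |T e_j|_0, so the
    larger of the two indices can carry the weights of both. The constant 4
    stems from two applications of the bound on the sum of (k+1)^-2. *)
Lemma balanced_hs T q : balanced T -> hs q q T <= 4 * hs (q.+1 + q.+1) 0 T.
Proof.
move=> bT; set N := hs _ 0 T.
have N0 : 0 <= N by exact: hs_ge0.
have -> : 4 * N = 2 * (2 * N) by ring.
apply: hs_le => [|k]; first by rewrite mulr_ge0.
rewrite mulrC -ler_pdivlMr//.
have K0 : 0 <= N / k.+1%:R ^+ q.+1 by rewrite divr_ge0.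
have -> : 2 * N / k.+1%:R ^+ q.+1 = 2 * (N / k.+1%:R ^+ q.+1) by rewrite mulrA.
apply: (wnorm_bound K0 _).2 => j; rewrite ler_pdivlMr// mulrC mulrA.
have key (a b : nat) r (c : R) : (a <= b)%N -> c * b.+1%:R ^+ (r + r) <= N ->
    0 <= c -> c * (a.+1%:R ^+ r * b.+1%:R ^+ r) <= N.
  move=> ab h c0; apply: le_trans h; rewrite ler_wpM2l// exprD ler_wpM2r//.
  by rewrite lerXn2r ?nnegrE// ler_nat.
have [kj|/ltnW jk] := leqP k j.
  rewrite mulrC; apply: key => //; last exact: normc_ge0.
  apply: le_trans (_ : lnorm 0 (ecol T j) * j.+1%:R ^+ (q.+1 + q.+1) <= _).
    by rewrite ler_wpM2r.
  by rewrite mulrC; exact: hs_col.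
rewrite mulrC (mulrC (_ ^+ _)); apply: key => //; last exact: normc_ge0.
apply: le_trans (_ : lnorm 0 (ecol T k) * k.+1%:R ^+ (q.+1 + q.+1) <= _).
  by rewrite ler_wpM2r// entry_le0.
by rewrite mulrC; exact: hs_col.
Qed.

End adjoints.

(** * Commutative algebras with a spectral basis *)

Section algebra.
Context {R : realType}.
Local Notation S := (s_space R).
Local Notation D := (s_dual R).
Local Notation L := (Lss R).
Implicit Types (q p k j n : nat) (T : L) (x y z : S).
Hint Resolve s_weight_ge0 s_weight_gt0 s_l2 hs_ge0 : core.

Lemma lnorm0_add x y :
  lnorm 0 (x + y) ^+ 2 = lnorm 0 x ^+ 2 + lnorm 0 y ^+ 2 + 2 * complex.Re (l2_dot x y).
Proof.
rewrite !lnorm0_sqr sdotAl !sdotAr (sdot_conj x y).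
case: (l2_dot x x) (l2_dot y y) (l2_dot x y) => a b [c d] [e f] /=; ring.
Qed.

Lemma orth_tail (y : nat -> S) n m : (forall i j, i != j -> l2_dot (y i) (y j) = 0) ->
  (n <= m)%N ->
  lnorm 0 (\sum_(j < m) y j - \sum_(j < n) y j) ^+ 2 =
  \sum_(j < m) lnorm 0 (y j) ^+ 2 - \sum_(j < n) lnorm 0 (y j) ^+ 2.
Proof.
move=> yo nm; rewrite -(subnKC nm); elim: (m - n)%N => [|d IH].
  by rewrite addn0 !subrr lnorm0 expr0n.
rewrite addnS big_ord_recr /= addrAC lnorm0_add IH [in RHS]big_ord_recr /=.
have s0 M : (M <= n + d)%N -> l2_dot (\sum_(j < M) y j) (y (n + d)%N) = 0.
  elim: M => [|M IHM] h; first by rewrite big_ord0 sdot0l.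
  rewrite big_ord_recr /= sdotAl IHM ?(ltnW h)// yo ?addr0//.
  by rewrite neq_ltn h.
by rewrite sdotBl !s0 ?leq_addr// subrr mulr0 addr0 addrAC.
Qed.

Lemma orth_sum (y : nat -> S) n : (forall i j, i != j -> l2_dot (y i) (y j) = 0) ->
  lnorm 0 (\sum_(j < n) y j) ^+ 2 = \sum_(j < n) lnorm 0 (y j) ^+ 2.
Proof.
by move=> yo; have := orth_tail yo (leq0n n); rewrite !big_ord0 !subr0.
Qed.

Definition is_proj (e : L) : Prop := Lss_mul e e = e /\ Lss_adjoint e e.

Lemma proj_dot (e : L) x y : is_proj e -> l2_dot (app e x) (app e y) = l2_dot x (app e y).
Proof. by move=> [ee ae]; rewrite (Lss_adj _ _ ae) -app_mul ee. Qed.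

Lemma proj_le (e : L) x : is_proj e -> lnorm 0 (app e x) <= lnorm 0 x.
Proof.
move=> pe; have [->|n0] := eqVneq (lnorm 0 (app e x)) 0; first exact: lnorm_ge0.
have p0 : 0 < lnorm 0 (app e x) by rewrite lt_neqAle eq_sym n0 lnorm_ge0.
rewrite -(ler_pM2r p0); apply: le_trans (sdot_CS x (app e x)).
by rewrite -proj_dot// sdotxx normcR ger0_norm ?sqr_ge0// expr2.
Qed.

Lemma proj_sum (e : nat -> L) n : (forall j, is_proj (e j)) ->
  (forall i j, i != j -> Lss_mul (e i) (e j) = 0) -> is_proj (\sum_(j < n) e j).
Proof.
move=> h h1; split.
  rewrite Lmul_suml; apply: eq_bigr => i _; rewrite Lmul_sumr (bigD1 i)//= big1.
    by have [-> _] := h i; rewrite addr0.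
  by move=> j ji; rewrite h1// eq_sym.
elim: n => [|n IH]; first by rewrite big_ord0; exact: Ladj0.
by rewrite big_ord_recr/=; apply: LadjD => //; have [_ ?] := h n.
Qed.

(** Bessel's inequality: the sum of orthogonal projections is again a
    projection, hence a contraction. *)
Lemma proj_bessel (e : nat -> L) n x : (forall j, is_proj (e j)) ->
  (forall i j, i != j -> Lss_mul (e i) (e j) = 0) ->
  \sum_(j < n) lnorm 0 (app (e j) x) ^+ 2 <= lnorm 0 x ^+ 2.
Proof.
move=> h h1; have o i j : i != j -> l2_dot (app (e i) x) (app (e j) x) = 0.
  move=> ij; have [_ ai] := h i; rewrite (Lss_adj _ _ ai) -app_mul h1//.
  by rewrite /app sdot_conj sdot0l rmorph0.
rewrite -(orth_sum n o).
have -> : \sum_(j < n) app (e j) x = app (\sum_(j < n) e j) x.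
  by elim/big_rec2: _ => [//|i y z _ ->].
by rewrite ler_sqr ?nnegrE ?lnorm_ge0// proj_le//; exact: proj_sum.
Qed.

(** Identities between squared norms of columns are inherited by the Hilbert-
    Schmidt norms, for every weight. *)
Lemma hs_sqr4 q (A B C D' : L) :
  (forall k, lnorm 0 (ecol A k) ^+ 2 + lnorm 0 (ecol B k) ^+ 2 =
     lnorm 0 (ecol C k) ^+ 2 + lnorm 0 (ecol D' k) ^+ 2) ->
  hs q 0 A ^+ 2 + hs q 0 B ^+ 2 = hs q 0 C ^+ 2 + hs q 0 D' ^+ 2.
Proof.
move=> h.
have E T : (hs q 0 T ^+ 2)%:E = (\sum_(0 <= k <oo) (((k.+1%:R ^+ q * lnorm 0 (ecol T k)) ^+ 2)%R)%:E)%E.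
  rewrite hs_wsum /wsum; apply: eq_eseriesr => k _.
  by rewrite normc_lnorm mulrC.
have g T k : xpredT k -> (0 <= (((k.+1%:R ^+ q * lnorm 0 (ecol T k)) ^+ 2)%R)%:E)%E.
  by move=> _; rewrite lee_fin sqr_ge0.
have E2 T U : (hs q 0 T ^+ 2 + hs q 0 U ^+ 2)%:E = (\sum_(0 <= k <oo)
    (((k.+1%:R ^+ q) ^+ 2 * (lnorm 0 (ecol T k) ^+ 2 + lnorm 0 (ecol U k) ^+ 2))%R)%:E)%E.
  rewrite EFinD.
  apply: (eq_trans (congr2 (@adde R) (E T) (E U))).
  apply: (eq_trans (esym (@nneseriesD R _ _ xpredT 0%N (fun k _ => g T k) (fun k _ => g U k)))).
  apply: eq_eseriesr => k _.
  by rewrite -EFinD !exprMn -mulrDr.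
have e1 : (hs q 0 A ^+ 2 + hs q 0 B ^+ 2)%:E = (hs q 0 C ^+ 2 + hs q 0 D' ^+ 2)%:E.
  apply: (eq_trans (E2 A B)); apply: (eq_trans _ (esym (E2 C D'))).
  by apply: eq_eseriesr => k _; rewrite h.
exact: (EFin_inj e1).
Qed.

Lemma hs_sqr3 q (A C D' : L) :
  (forall k, lnorm 0 (ecol A k) ^+ 2 =
     lnorm 0 (ecol C k) ^+ 2 + lnorm 0 (ecol D' k) ^+ 2) ->
  hs q 0 A ^+ 2 = hs q 0 C ^+ 2 + hs q 0 D' ^+ 2.
Proof.
move=> h.
have w (Z : L) : hs q 0 Z = 0 -> (forall k, lnorm 0 (ecol Z k) = 0) ->
    hs q 0 A ^+ 2 = hs q 0 C ^+ 2 + hs q 0 D' ^+ 2.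
  move=> Z0 Zk; have := @hs_sqr4 q A Z C D'; rewrite Z0 expr0n addr0; apply=> k.
  by rewrite Zk expr0n addr0 h.
have w0 : forall k, lnorm 0 (ecol (0 : L) k) = 0.
  by move=> k; exact: (eq_trans (congr1 (lnorm 0) (ecol0 k)) (lnorm0 _ _)).
exact: (w (0 : L) (hs0 q 0) w0).
Qed.

Section fixed.
Context (E : set L).
Hypothesis CE : closed_commutative_star_subalgebra E.

Lemma alg_lin : linear_subspace E. Proof. by have [[]] := CE. Qed.
Lemma alg_mul T T' : E T -> E T' -> E (Lss_mul T T').
Proof. by have [[_ h _] _ _] := CE; exact: h. Qed.
Lemma alg_comm T T' : E T -> E T' -> Lss_mul T T' = Lss_mul T' T.
Proof. by have [_ h _] := CE; exact: h. Qed.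
Lemma alg_adj T : E T -> exists2 T', E T' & Lss_adjoint T T'.
Proof. by have [[_ _ h] _ _] := CE; exact: h. Qed.
Lemma alg_closed : closed E. Proof. by have [] := CE. Qed.

(** Commuting with the adjoint makes the norms of T x and T* x equal. *)
Lemma alg_normal T T' x : E T -> E T' -> Lss_adjoint T T' ->
  lnorm 0 (app T x) = lnorm 0 (app T' x).
Proof.
move=> ET ET' h; apply/eqP; rewrite -(@eqrXn2 _ 2) ?lnorm_ge0//; apply/eqP.
rewrite !lnorm0_sqr (Lss_adj _ _ h) (Lss_adj _ _ (adj_sym h)).
by rewrite -!app_mul alg_comm.
Qed.

Lemma alg_balanced T : E T -> balanced T.
Proof.
move=> ET k j; have [T' ET' h] := alg_adj ET.
have /adjointP -> := h; rewrite normc_conj; apply: le_trans (entry_le0 _ _) _.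
by rewrite -!app_es (alg_normal _ ET ET' h).
Qed.

Lemma alg_hs T p q : E T -> hs p q T <= 4 * hs ((maxn p q).+1 + (maxn p q).+1) 0 T.
Proof.
move=> ET; apply: le_trans (balanced_hs (maxn p q) (alg_balanced ET)).
exact: hs_homo (leq_maxl _ _) (leq_maxr _ _).
Qed.

(** By normality the one-parameter scale hs q 0 is equivalent to the full two-
    parameter scale. *)
Lemma alg_graded : graded E (fun q T => hs q 0 T).
Proof.
split.
- exact: alg_lin.
- by move=> q T T' _ _; exact: hsD.
- by move=> q a T _; exact: hsZ.
- by move=> q T _; exact: hs_homo.
- move=> T A ET; split.
    move=> /Lss_nbhsP[n [e e0 h]].
    exists (n.+1 + n.+1)%N, (e / 4); first by rewrite divr_gt0.
    move=> T' ET' d; apply: h => //; apply: le_lt_trans (alg_hs n n (subspaceB alg_lin ET' ET)) _.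
    by rewrite maxnn mulrC -ltr_pdivlMr.
  move=> [n [e e0 h]]; apply/Lss_nbhsP; exists n, e; first exact: e0.
  move=> T' d ET'; apply: (h T' ET').
  exact: le_lt_trans (hs_homo (T' - T) (leqnn n) (leq0n n)) d.
Qed.

Lemma alg_complete (u : nat -> L) : (forall n, E (u n)) ->
  (forall q e, 0 < e -> exists n0, forall n m, (n0 <= n)%N -> (n <= m)%N ->
     hs q 0 (u m - u n : L) <= e) -> exists2 T, E T & opcvg u T.
Proof.
move=> Eu uC.
have [T uT] : exists T, opcvg u T.
  apply: Lss_complete => q e e0; have e40 : 0 < e / 4 by rewrite divr_gt0.
  have [n0 h] := uC (q.+1 + q.+1)%N _ e40; exists n0 => n m hn hm.
  wlog nm : n m hn hm / (n <= m)%N.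
    by move=> w; have [?|/ltnW ?] := leqP n m; [exact: w|rewrite hsB; exact: w].
  rewrite hsB; apply: le_trans (alg_hs q q (subspaceB alg_lin (Eu m) (Eu n))) _.
  by rewrite maxnn mulrC -ler_pdivlMr//; exact: h.
by exists T => //; exact: Lss_closed alg_closed Eu uT.
Qed.

(** A maximal family of minimal projections: orthogonal, each spanning an
    ideal of dimension one, and jointly separating E. *)
Definition spectral (e : nat -> L) : Prop :=
  [/\ forall j, [/\ E (e j), is_proj (e j) & e j <> 0],
      forall i j, i != j -> Lss_mul (e i) (e j) = 0,
      forall j T, E T -> exists c : R[i], Lss_mul (e j) T = c *: e j &
      forall T, E T -> (forall j, Lss_mul (e j) T = 0) -> T = 0].

(** The Koethe matrix of E in the coordinates given by the spectral basis. *)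
Definition smatrix (e : nat -> L) : nat -> nat -> R := fun j q => hs q 0 (e j).

Context (e : nat -> L).
Hypothesis Se : spectral e.

Lemma spectral_ext T T' : E T -> E T' ->
  (forall j, Lss_mul (e j) T = Lss_mul (e j) T') -> T = T'.
Proof.
move=> ET ET' h; have [_ _ _ h0] := Se; apply/eqP; rewrite -subr_eq0; apply/eqP.
apply: h0 => [|j]; first exact: subspaceB alg_lin ET ET'.
by rewrite LmulBr h subrr.
Qed.

Lemma spectral_orth (c : nat -> R[i]) k i j : i != j ->
  l2_dot (ecol (c i *: e i) k) (ecol (c j *: e j) k) = 0.
Proof.
move=> ij; have [h h1 _ _] := Se; have [_ [_ ai] _] := h i.
rewrite !ecolZ sdotZl sdotZr -!app_es (Lss_adj _ _ ai) -app_mul h1//.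
by rewrite app_es ecol0 sdot_conj sdot0l rmorph0 !mulr0.
Qed.

(** The columns of distinct e_j are orthogonal in l2, so by Pythagoras the
    squared norms add up; hence finite combinations have exactly the norm of
    their coefficients in lambda2. *)
Lemma spectral_tail (c : nat -> R[i]) q n m : (n <= m)%N ->
  hs q 0 (\sum_(j < m) c j *: e j - \sum_(j < n) c j *: e j) ^+ 2 =
  wpsum (smatrix e ^~ q) c m - wpsum (smatrix e ^~ q) c n.
Proof.
move=> nm.
have add M : hs q 0 (\sum_(j < M.+1) c j *: e j - \sum_(j < n) c j *: e j) ^+ 2 =
   hs q 0 (\sum_(j < M) c j *: e j - \sum_(j < n) c j *: e j) ^+ 2 + hs q 0 (c M *: e M) ^+ 2 \/ ~ (n <= M)%N.
  case: (leqP n M) => nM; last by right.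
  left; apply: hs_sqr3 => k.
  pose y j := ecol (c j *: e j) k.
  have o : forall i j, i != j -> l2_dot (y i) (y j) = 0 by exact: spectral_orth.
  rewrite 2!ecolB (@ecol_sum _ M.+1 (fun j => c j *: e j)) (@ecol_sum _ M (fun j => c j *: e j)).
  rewrite (@ecol_sum _ n (fun j => c j *: e j)).
  apply: (eq_trans (orth_tail o (leqW nM))); rewrite big_ord_recr /= addrAC.
  by congr (_ + _); exact: (esym (orth_tail o nM)).
rewrite -(subnKC nm); elim: (m - n)%N => [|d IH].
  by rewrite addn0 !subrr hs0 expr0n.
rewrite addnS; have [->|] := add (n + d)%N; last by rewrite leq_addr.
by rewrite IH hsZ wpsumSr addrAC.
Qed.

Lemma spectral_sum (c : nat -> R[i]) q n :
  hs q 0 (\sum_(j < n) c j *: e j) ^+ 2 = wpsum (smatrix e ^~ q) c n.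
Proof.
have := spectral_tail c q (leq0n n).
by rewrite !big_ord0 subr0 [wpsum _ _ 0]big_ord0 subr0.
Qed.

Lemma spectral_partial c T n : E T -> (forall j, Lss_mul (e j) T = c j *: e j) ->
  forall q, hs q 0 (\sum_(j < n) c j *: e j) <= hs q 0 T.
Proof.
move=> ET cT q; rewrite -[leRHS]mul1r; apply: hs_mono => // k; rewrite mul1r.
rewrite ler_wpM2r//; have [h h1 _ _] := Se.
set P := \sum_(j < n) c j *: e j.
have PT : P = Lss_mul (\sum_(j < n) e j) T.
  by rewrite Lmul_suml; apply: eq_bigr => j _; rewrite cT.
have pQ : is_proj (\sum_(j < n) e j).
  by apply: proj_sum => // j; have [] := h j.
rewrite PT ecol_mul; exact: proj_le.
Qed.

(** The coefficients are bounded since the partial sums are the products of T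
    with projections. *)
Lemma spectral_coef T : E T -> exists c : lambda2 (smatrix e),
  (forall j, Lss_mul (e j) T = c j *: e j) /\ forall q, lnorm q c <= hs q 0 T.
Proof.
move=> ET; have [_ _ h _] := Se.
have /choice[c cT] : forall j, exists c : R[i], Lss_mul (e j) T = c *: e j.
  by move=> j; exact: h.
have b q n : wpsum (smatrix e ^~ q) c n <= hs q 0 T ^+ 2.
  rewrite -spectral_sum ler_sqr ?nnegrE ?hs_ge0//; exact: (spectral_partial n ET cT q).
have cA : c \in lambda2_mem (smatrix e) by apply/asboolP => q; exact: wsum_lty (b q).
exists (Lambda2 cA); split=> // q; apply: (wnorm_leP _ _).2 => //.
exact: wsum_lty (b q).
Qed.

(** Partial sums are Cauchy by the isometry of spectral_tail, and E is
    complete. *)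
Lemma spectral_synth (c : lambda2 (smatrix e)) : exists T,
  [/\ E T, forall j, Lss_mul (e j) T = c j *: e j & forall q, hs q 0 T <= lnorm q c].
Proof.
have [h h1 _ _] := Se.
pose u n : L := \sum_(j < n) c j *: e j.
have Eu n : E (u n).
  by apply: subspace_sum alg_lin _ => j _; apply: subspaceZ alg_lin _; have [] := h j.
have [T ET uT] : exists2 T, E T & opcvg u T.
  apply: alg_complete => // q d d0; have d2 : 0 < d ^+ 2 by rewrite exprn_gt0.
  have [n0 hn] := wpsum_tail (lambda2_lty q c) d2; exists n0 => n m n0n nm.
  rewrite -ler_sqr ?nnegrE ?hs_ge0 ?(ltW d0)// /u spectral_tail//.
  have := hn n n0n; have := wpsum_le_wnorm m (lambda2_lty q c).
  by move: (wnorm _ _) (wpsum _ _ m) (wpsum _ _ n) => a b f; lra.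
exists T; split=> // [j|q].
  apply: (opcvg_unique (opcvg_mulr (e j) uT)) => p q d d0; exists j.+1 => n jn.
  rewrite (_ : Lss_mul (e j) (u n) = c j *: e j) ?subrr ?hs0 ?ltW//.
  rewrite (@Lmul_sumr _ (e j) n (fun i => c i *: e i)) (bigD1 (Ordinal jn))//= big1.
    by have [_ [ee _] _] := h j; rewrite LmulZr ee addr0.
  move=> i ij; rewrite LmulZr h1 ?scaler0//; apply: contraNN ij => /eqP E1.
  by apply/eqP/val_inj.
apply: (opcvg_le uT); exists 0%N => n _.
rewrite -ler_sqr ?nnegrE ?hs_ge0 ?lnorm_ge0// /u spectral_sum.
exact: wpsum_le_wnorm (lambda2_lty q c).
Qed.

Lemma spectral_model : exists Psi Phi,
  [/\ tame_iso [set: lambda2 (smatrix e)] (fun q => @lnorm R _ q) E (fun q T => hs q 0 T) Psi Phi,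
      forall c j, Lss_mul (e j) (Psi c) = c j *: e j &
      forall T j, E T -> Lss_mul (e j) T = Phi T j *: e j].
Proof.
have /choice[Psi hPsi] := spectral_synth.
have /choice[Phi hPhi] : forall T, exists c : lambda2 (smatrix e), E T ->
  (forall j, Lss_mul (e j) T = c j *: e j) /\ forall q, lnorm q c <= hs q 0 T.
  move=> T; have [ET|nE] := pselect (E T); last by exists 0.
  by have [c hc] := spectral_coef ET; exists c.
have [h h1 _ _] := Se.
have cinj (c d : R[i]) j : c *: e j = d *: e j -> c = d.
  move=> /eqP; rewrite -subr_eq0 -scalerBl scaler_eq0 subr_eq0 => /orP[/eqP//|/eqP e0].
  by have [_ _ []] := h j.
exists Psi, Phi; split.
- split.
  + move=> a c d _ _; have [E1 k1 _] := hPsi (a *: c + d); have [E2 k2 _] := hPsi c.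
    have [E3 k3 _] := hPsi d.
    apply: spectral_ext => //; first by apply: alg_lin.2.
    by move=> j; rewrite k1 LmulDr LmulZr k2 k3 lambda2D lambda2Z scalerDl scalerA.
  + move=> c _; have [E1 k1 _] := hPsi c; split=> //.
    apply: lambda2_ext => j; apply: (cinj _ _ j).
    by have [<- _] := hPhi _ E1.
  + move=> T ET; have [k2 _] := hPhi T ET; split=> //.
    have [E1 k1 _] := hPsi (Phi T); apply: spectral_ext => // j.
    by rewrite k1 k2.
  + by move=> q; exists q, 1; split=> // c _; rewrite mul1r; have [_ _] := hPsi c.
  + by move=> q; exists q, 1; split=> // T ET; rewrite mul1r; have [_] := hPhi T ET.
- by move=> c j; have [_ ->] := hPsi c.
- by move=> T j ET; have [->] := hPhi T ET.
Qed.

End fixed.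
End algebra.

(** * Powers of a self-adjoint operator *)

Section radius.
Context {R : realType}.

(** The ratios h(n+1)/h(n) increase by log-convexity and are bounded by h(0)
    by submultiplicativity. Their limit r plays the role of the spectral
    radius. *)
Lemma logconvex_radius (h : nat -> R) : (forall n, 0 < h n) ->
  (forall n, h n.+1 ^+ 2 <= h n * h n.+2) ->
  (forall n m, h (n + m).+1 <= h n * h m) ->
  exists2 r : R, 0 < r & forall n, h n.+1 <= r * h n /\ r ^+ n.+1 <= h n.
Proof.
move=> h0 hc hm; pose r n := h n.+1 / h n.
have r0 n : 0 < r n by rewrite divr_gt0.
have rS n : r n <= r n.+1.
  by rewrite /r ler_pdivrMr// mulrAC ler_pdivlMr// -expr2 mulrC.
have rb n : r n <= h 0%N by rewrite /r ler_pdivrMr// mulrC; have := hm n 0%N; rewrite addn0.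
have rm : nondecreasing_seq r by apply/nondecreasing_seqP.
have cr : cvgn r by apply: nondecreasing_is_cvgn => //; exists (h 0%N) => _ [n _ <-].
have rl n : r n <= limn r by apply: nondecreasing_cvgn_le.
exists (limn r); first exact: lt_le_trans (r0 0%N) (rl 0%N).
move=> n; split; first by rewrite -ler_pdivrMr// rl.
have : (r N) ^+ n.+1 @[N --> \oo] --> (limn r) ^+ n.+1.
  exact: (cvg_comp _ _ cr (@exprn_continuous R n.+1 (limn r))).
move=> /cvgr_to_le; apply; apply: nearW => N.
(* Increasing ratios bound the growth of h from below by a geometric sequence. *)
have st m : r N ^+ m * h N <= h (N + m)%N.
  elim: m => [|m IH]; first by rewrite expr0 mul1r addn0.
  rewrite exprS -mulrA addnS; apply: le_trans (_ : r N * h (N + m)%N <= _).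
    by rewrite ler_wpM2l// ltW.
  by rewrite -ler_pdivlMr//; apply: rm; exact: leq_addr.
rewrite -(ler_pM2r (h0 N)); apply: le_trans (st n.+1) _.
by rewrite addnS mulrC; exact: hm.
Qed.

End radius.

Section powers.
Context {R : realType}.
Local Notation S := (s_space R).
Local Notation L := (Lss R).
Implicit Types (q p k j n m : nat) (T a : L) (x y z : S).
Hint Resolve s_weight_ge0 s_weight_gt0 s_l2 : core.

(** The power of exponent n+1; there is no unit, so exponents start from 1. *)
Definition pw a n : L := iter n (Lss_mul a) a.

Lemma pwS a n : pw a n.+1 = Lss_mul a (pw a n). Proof. by []. Qed.

Lemma pwD a n m : pw a (n + m).+1 = Lss_mul (pw a n) (pw a m).
Proof. by elim: n => [//|n IH]; rewrite addSn pwS IH LmulA. Qed.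

Lemma pw_dotS a n m x : Lss_adjoint a a ->
  l2_dot (app (pw a n.+1) x) (app (pw a m) x) = l2_dot (app (pw a n) x) (app (pw a m.+1) x).
Proof. by move=> sa; rewrite !pwS !app_mul (Lss_adj _ _ sa). Qed.

(** For self-adjoint a the scalar product of two powers only depends on the
    sum of the exponents. *)
Lemma pw_dot a n m i j x : Lss_adjoint a a -> (n + m = i + j)%N ->
  l2_dot (app (pw a n) x) (app (pw a m) x) = l2_dot (app (pw a i) x) (app (pw a j) x).
Proof.
move=> sa; wlog ni : n m i j / (n <= i)%N.
  by move=> w; have [h|/ltnW h] := leqP n i; [exact: w|move=> e; apply/esym; apply: w].
move=> e; have {e ni} [d [-> ->]] : exists d, (i = n + d)%N /\ (m = j + d)%N.
  by exists (i - n)%N; lia.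
elim: d n j => [|d IH] n j; first by rewrite !addn0.
by rewrite !addnS pw_dotS// -addSn -IH addSn -pw_dotS.
Qed.

(** Cauchy-Schwarz, twice: in l2 for each column and then for the sum over the
    columns. *)
Lemma pw_logconvex a n : Lss_adjoint a a ->
  hs 0 0 (pw a n.+1) ^+ 2 <= hs 0 0 (pw a n) * hs 0 0 (pw a n.+2).
Proof.
move=> sa; have P0 : 0 <= hs 0 0 (pw a n) * hs 0 0 (pw a n.+2) by rewrite mulr_ge0 ?hs_ge0.
rewrite -(sqr_sqrtr P0) ler_sqr ?nnegrE ?hs_ge0 ?sqrtr_ge0//.
apply: (hs_leP _ _ _ _).2 => [|N]; first exact: sqrtr_ge0.
rewrite sqr_sqrtr//.
apply: (@le_trans _ _ (\sum_(k < N) lnorm 0 (ecol (pw a n) k) * lnorm 0 (ecol (pw a n.+2) k))).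
  apply: ler_sum => k _; rewrite expr0 mulr1.
  apply: le_trans (sdot_CS _ _); rewrite -!app_es.
  rewrite (@pw_dot a n n.+2 n.+1 n.+1)//; last by rewrite addnS.
  by rewrite sdotxx normcR ger0_norm ?sqr_ge0.
have hh i : \sum_(k < N) lnorm 0 (ecol (pw a i) k) ^+ 2 <= hs 0 0 (pw a i) ^+ 2.
  by apply: le_trans (hs_psum 0 0 (pw a i) N); apply: ler_sum => k _; rewrite expr0 mulr1.
exact: (@fin_CS R N (fun k => lnorm 0 (ecol (pw a n) k)) (fun k => lnorm 0 (ecol (pw a n.+2) k))
  _ _ (hs_ge0 _ _ _) (hs_ge0 _ _ _) (hh n) (hh n.+2)).
Qed.

Lemma pw_neq0 a n : Lss_adjoint a a -> a <> 0 -> pw a n <> 0.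
Proof.
move=> sa a0; elim: n => [//|n IH] h; apply: IH.
apply: Lss_ext => k; rewrite ecol0; apply: lnorm0_eq0.
suff : lnorm 0 (ecol (pw a n) k) ^+ 2 <= 0.
  by move=> h1; rewrite -(@ler_pXn2r _ 2) ?nnegrE ?lnorm_ge0// expr0n.
rewrite lnorm0_sqr -!app_es; case: n h => [|n] h.
  by rewrite (Lss_adj _ _ sa) -app_mul -[Lss_mul _ _]/(pw a 1) h sdot_conj sdot0l.
by rewrite -(@pw_dot a n.+2 n)// ?h ?sdot0l// addnS.
Qed.

Lemma hs_gt0 T p q : T <> 0 -> 0 < hs p q T.
Proof.
move=> T0; rewrite lt_neqAle hs_ge0 andbT; apply/eqP => h; apply: T0.
by apply: (@hs_eq0 _ p q); rewrite -h.
Qed.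

Lemma pwZ (c : R[i]) a n : pw (c *: a) n = c ^+ n.+1 *: pw a n.
Proof.
elim: n => [|n IH]; first by rewrite expr1.
by rewrite pwS IH LmulZl LmulZr scalerA -exprS.
Qed.

Lemma adjZr (r : R) a : Lss_adjoint a a -> Lss_adjoint (r%:C *: a) (r%:C *: a).
Proof.
have e : Num.conj (r%:C : R[i]) = r%:C := conjc_real r.
by move=> /(LadjZ r%:C); rewrite e.
Qed.

(** Dividing a by its spectral radius makes the Hilbert-Schmidt norms of the
    powers decreasing while they remain at least 1. *)
Lemma pw_normalize a : Lss_adjoint a a -> a <> 0 -> exists2 r : R, 0 < r &
  forall n, hs 0 0 (pw (r^-1%:C *: a) n.+1) <= hs 0 0 (pw (r^-1%:C *: a) n) /\
    1 <= hs 0 0 (pw (r^-1%:C *: a) n).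
Proof.
move=> sa a0.
have [||r r0 hr] := @logconvex_radius R (fun n => hs 0 0 (pw a n)) (fun n => hs_gt0 0 0 (pw_neq0 sa a0 (n:=n))).
- by move=> n; exact: pw_logconvex.
- by move=> n m; rewrite pwD; exact: hsM.
exists r => // n; have [h1 h2] := hr n.
have E m : hs 0 0 (pw (r^-1%:C *: a) m) = hs 0 0 (pw a m) / r ^+ m.+1.
  rewrite pwZ hsZ -rmorphXn normcR ger0_norm ?exprn_ge0 ?invr_ge0 ?(ltW r0)//.
  by rewrite exprVn mulrC.
rewrite !E; split; last by rewrite ler_pdivlMr ?exprn_gt0// mul1r.
rewrite ler_pdivrMr ?exprn_gt0// -mulrA (mulrC _ (r ^+ n.+2)) exprS mulfK ?gt_eqF ?exprn_gt0//.
by rewrite mulrC.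
Qed.

End powers.

(** * Existence of minimal projections *)

Lemma nonincr_le (R : realType) (h : nat -> R) n m : (forall i, h i.+1 <= h i) ->
  (n <= m)%N -> h m <= h n.
Proof.
move=> hS; elim: m => [|m IH]; first by rewrite leqn0 => /eqP->.
by rewrite leq_eqVlt => /predU1P[->//|]; rewrite ltnS => /IH; apply: le_trans.
Qed.

Lemma zmod_cancel (V : zmodType) (u v w : V) : u + v + (v + w) - u - w = v + v.
Proof. by rewrite addrA -(addrA u v v) (addrAC _ w) addrK addrC addKr. Qed.

HB.instance Definition _ (R : realType) := isPointed.Build (Lss R) 0.

Section projections.
Context {R : realType}.
Local Notation S := (s_space R).
Local Notation L := (Lss R).
Implicit Types (q k j n m : nat) (T a e p f : L) (x y z : S).
Hint Resolve s_weight_ge0 s_weight_gt0 s_l2 : core.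
Context (E : set L).
Hypothesis CE : closed_commutative_star_subalgebra E.

Lemma pw_alg a n : E a -> E (pw a n).
Proof. by move=> Ea; elim: n => [//|n IH]; exact: (alg_mul CE). Qed.

Lemma pw_adj a n : E a -> Lss_adjoint a a -> Lss_adjoint (pw a n) (pw a n).
Proof.
move=> Ea sa; elim: n => [//|n IH].
by have := LadjM sa IH; rewrite (alg_comm CE (pw_alg n Ea) Ea).
Qed.

Lemma sdot0r x : l2_dot x (0 : S) = 0.
Proof. by rewrite sdot_conj sdot0l rmorph0. Qed.

Lemma sdotNr x y : l2_dot x (- y) = - l2_dot x y.
Proof. by have := sdotBr 0 y x; rewrite !sub0r sdot0r sub0r. Qed.

Lemma lnorm0_subsqr x y :
  lnorm 0 (x - y) ^+ 2 + 2 * complex.Re (l2_dot x y) = lnorm 0 x ^+ 2 + lnorm 0 y ^+ 2.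
Proof.
rewrite (lnorm0_add x (- y)) (lnormN 0 y) (sdotNr x y).
by case: (l2_dot x y) => u v /=; ring.
Qed.

(** Polarisation: expand the squared norm of T x - T' x and use that the mixed
    term is a squared norm itself. *)
Lemma hs_pair T T' U q :
  (forall x, l2_dot (app T x) (app T' x) = (lnorm 0 (app U x) ^+ 2)%:C) ->
  hs q 0 (T - T') ^+ 2 + 2 * hs q 0 U ^+ 2 = hs q 0 T ^+ 2 + hs q 0 T' ^+ 2.
Proof.
move=> h; have s2 : Num.sqrt (2 : R) ^+ 2 = 2 by rewrite sqr_sqrtr.
have -> : 2 * hs q 0 U ^+ 2 = hs q 0 ((Num.sqrt 2)%:C *: U) ^+ 2.
  by rewrite hsZ normcR exprMn real_normK ?num_real// sqr_sqrtr.
apply: hs_sqr4 => k; rewrite ecolB ecolZ lnormZ normcR exprMn real_normK ?num_real// s2.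
have hk : l2_dot (ecol T k) (ecol T' k) = (lnorm 0 (ecol U k) ^+ 2)%:C := h (es k).
by rewrite -(lnorm0_subsqr (ecol T k) (ecol T' k)) hk.
Qed.

Lemma pw_pair a i j m q : Lss_adjoint a a -> (i + j = m + m)%N ->
  hs q 0 (pw a i - pw a j) ^+ 2 + 2 * hs q 0 (pw a m) ^+ 2 =
  hs q 0 (pw a i) ^+ 2 + hs q 0 (pw a j) ^+ 2.
Proof.
by move=> sa ijm; apply: hs_pair => x; rewrite (pw_dot x sa ijm) sdotxx.
Qed.

Lemma opcvg_ge (u : nat -> L) T (p q : nat) c : opcvg u T -> (forall n, c <= hs p q (u n)) -> c <= hs p q T.
Proof.
move=> uT h; apply/ler_addgt0Pr => d d0; have [n0 /(_ n0 (leqnn _)) h0] := uT p q d d0.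
apply: le_trans (h n0) _; have -> : u n0 = T + (u n0 - T) by rewrite addrC subrK.
by apply: le_trans (hsD p q T (u n0 - T)) _; rewrite lerD2l.
Qed.

(** The squared norms C(n) of the powers of exponent n+1 decrease to a limit,
    and the squared distance of the powers of exponents 2n+1 and 2m+1 equals
    C(2n) + C(2m) - 2 C(n+m). So the odd powers of a form a Cauchy sequence
    for hs 0 0, and with one more factor a the even powers are Cauchy for all
    the norms. The limit is idempotent because multiplication with the square
    of a does not change it. *)
Lemma pw_limit a : E a -> Lss_adjoint a a ->
  (forall n, hs 0 0 (pw a n.+1) <= hs 0 0 (pw a n)) -> (forall n, 1 <= hs 0 0 (pw a n)) ->
  exists e, [/\ E e, is_proj e, opcvg (fun n => pw a (n + n).+1) e, 1 <= hs 0 0 e &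
    Lss_mul (Lss_mul a a) e = e].
Proof.
move=> Ea sa hS h1; pose C n := hs 0 0 (pw a n) ^+ 2.
(* Negated, as the tail lemma is stated for increasing sequences. *)
have C1 n : - C n <= - C n.+1.
  by rewrite lerN2 ler_sqr ?nnegrE ?hs_ge0.
have CM n : - C n <= 0 by rewrite oppr_le0 sqr_ge0.
have Cm n m : (n <= m)%N -> C m <= C n.
  by apply: nonincr_le => i; rewrite -lerN2.
have C0 d : 0 < d -> exists n0, forall n m, (n0 <= n)%N -> (n0 <= m)%N ->
    hs 0 0 (pw a (n + n) - pw a (m + m)) ^+ 2 <= d.
  move=> d0; have d2 : 0 < d / 2 by rewrite divr_gt0.
  have [n0 hn0] := mono_tail C1 CM d2.
  exists n0 => n m n0n n0m.
  have e1 : ((n + n) + (m + m) = (n + m) + (n + m))%N by lia.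
  have := pw_pair 0 sa e1.
  rewrite -/(C (n + m)%N) -/(C (n + n)%N) -/(C (m + m)%N).
  have a1 : C (n + n)%N <= C n0 by apply: Cm; lia.
  have a2 : C (m + m)%N <= C n0 by apply: Cm; lia.
  have a3 : C n0 - C (n + m)%N < d / 2.
    have n0nm : (n0 <= n + m)%N by lia.
    by have := hn0 _ n0nm; rewrite opprK addrC.
  move: a1 a2 a3; clear -d0; move: (C _) (C _) (C _) (C _) => c1 c2 c3 c4.
  move: (hs _ _ _ ^+ 2) => h; lra.
have Eu n : E (pw a (n + n).+1) by exact: pw_alg.
have [e Ee ue] : exists2 e, E e & opcvg (fun n => pw a (n + n).+1) e.
  apply: (alg_complete CE) => // q d d0.
  have [c c0 hc] := eps_lin d0 (hs_ge0 q 0 a).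
  have c2 : 0 < c ^+ 2 by rewrite exprn_gt0.
  have [n0 hn0] := C0 _ c2; exists n0 => n m n0n nm.
  have -> : pw a (m + m).+1 - pw a (n + n).+1 = Lss_mul (pw a (m + m) - pw a (n + n)) a.
    by rewrite LmulBl !pwS !(alg_comm CE (pw_alg _ Ea) Ea).
  apply: le_trans (hsM q 0 _ a) _; rewrite -[leLHS]addr0 mulrC.
  apply: hc (hs_ge0 _ _ _) _ (ltW c0).
  rewrite -(@ler_pXn2r _ 2) ?nnegrE ?hs_ge0 ?(ltW c0)//.
  by apply: hn0 => //; exact: leq_trans nm.
have aae : Lss_mul (Lss_mul a a) e = e.
  apply: (opcvg_unique (u := fun n => Lss_mul (Lss_mul a a) (pw a (n + n).+1))).
    exact: opcvg_mulr.
  move=> p q d d0; have [n0 h0] := ue p q d d0; exists n0 => n n0n.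
  have -> : Lss_mul (Lss_mul a a) (pw a (n + n).+1) = pw a (n.+1 + n.+1).+1.
    by rewrite addSn addnS !pwS !LmulA.
  by apply: h0; exact: leqW.
have pe n : Lss_mul (pw a (n + n).+1) e = e.
  elim: n => [|n IH]; first by [].
  have -> : pw a (n.+1 + n.+1).+1 = Lss_mul (Lss_mul a a) (pw a (n + n).+1).
    by rewrite addSn addnS !pwS !LmulA.
  by rewrite -LmulA IH.
exists e; split => //.
- split.
    apply: (opcvg_unique (opcvg_mull e ue)) => p q d d0; exists 0%N => n _.
    by rewrite pe subrr hs0 ltW.
  by apply: (adj_lim _ ue ue) => n; exact: pw_adj.
- by apply: (opcvg_ge ue) => n; exact: h1.
Qed.

Definition nonzero_proj e := [/\ E e, is_proj e & e <> 0].

(** e projects onto the eigenspaces of largest absolute value r, where the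
    square of a acts as r^2. In the last clause e is all of p; then b = a/r
    and its square have the same norm as p, which forces the square to be at
    distance 0 from p. *)
Lemma spectral_projection a : E a -> Lss_adjoint a a -> a <> 0 ->
  exists e (r : R), [/\ nonzero_proj e, 0 < r, Lss_mul (Lss_mul a a) e = (r ^+ 2)%:C *: e,
    (forall p, Lss_mul p a = a -> Lss_mul p e = e) &
    forall p, E p -> is_proj p -> Lss_mul p a = a -> e = p -> Lss_mul a a = (r ^+ 2)%:C *: p].
Proof.
move=> Ea sa a0; have [r r0 hr] := pw_normalize sa a0.
set b := r^-1%:C *: a in hr.
have rC : r%:C != 0 by rewrite eq_complex /= gt_eqF.
have ab : a = r%:C *: b.
  by rewrite /b scalerA -rmorphM divff ?gt_eqF// rmorph1 scale1r.
have Eb : E b by apply: subspaceZ Ea; exact: alg_lin CE.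
have sb : Lss_adjoint b b by exact: adjZr.
have [e [Ee pe ue e1 bbe]] := pw_limit Eb sb (fun n => (hr n).1) (fun n => (hr n).2).
have aab : Lss_mul a a = (r ^+ 2)%:C *: Lss_mul b b.
  by rewrite ab LmulZl LmulZr scalerA -rmorphM expr2.
exists e, r; split => //.
- by split => // e0; move: e1; rewrite e0 hs0 ler10.
- by rewrite aab LmulZl bbe.
- move=> p pa; have pb : Lss_mul p b = b by rewrite /b LmulZr pa.
  apply: (opcvg_unique (opcvg_mulr p ue)) => i j d d0; have [n0 h0] := ue i j d d0.
  exists n0 => n n0n.
  by rewrite pwS LmulA pb; exact: (h0 n n0n).
- move=> p Ep pp pa ep; rewrite aab; congr (_ *: _).
  have pb : Lss_mul p b = b by rewrite /b LmulZr pa.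
  pose h n := hs 0 0 (pw b n).
  have hm n m : (n <= m)%N -> h m <= h n.
    by apply: nonincr_le => i; exact: (hr i).1.
  have hp n : hs 0 0 p <= h n.
    rewrite -ep; apply: (opcvg_le ue); exists n => m nm.
    by apply: hm; apply: leqW; apply: leq_trans nm (leq_addr _ _).
  (* The mixed term of b^2 and p is the squared norm of b, since p b = b; so
     all three squared norms are equal and b^2 = p. *)
  have key x : l2_dot (app (Lss_mul b b) x) (app p x) = (lnorm 0 (app b x) ^+ 2)%:C.
    rewrite app_mul (Lss_adj _ _ sb) -app_mul (alg_comm CE Eb Ep) pb.
    by rewrite sdotxx.
  have id := hs_pair 0 key.
  have h1p : h 1%N <= h 0%N by exact: hm.
  have h0p : h 0%N <= hs 0 0 p.
    have : hs 0 0 b <= hs 0 0 p.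
      rewrite -(@ler_pXn2r _ 2) ?nnegrE ?hs_ge0//.
      have p0 : 0 <= hs 0 0 (Lss_mul b b - p) ^+ 2 by rewrite sqr_ge0.
      have h1' : hs 0 0 (Lss_mul b b) ^+ 2 <= hs 0 0 b ^+ 2.
        by rewrite ler_sqr ?nnegrE ?hs_ge0//; exact: h1p.
      move: id p0 h1'; move: (_ ^+ 2) (_ ^+ 2) (_ ^+ 2) (_ ^+ 2) => u v w z; lra.
    by [].
  have e0 : h 0%N = hs 0 0 p by apply/eqP; rewrite eq_le h0p hp.
  have e2 : h 1%N = hs 0 0 p by apply/eqP; rewrite eq_le hp (le_trans h1p h0p).
  rewrite /h /= in e0 e2; rewrite e0 e2 in id.
  apply/eqP; rewrite -subr_eq0; apply/eqP; apply: (@hs_eq0 _ 0 0).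
  rewrite -(@ler_pXn2r _ 2) ?nnegrE ?hs_ge0// expr0n /=.
  move: id; move: (_ ^+ 2) (_ ^+ 2) => u v; lra.
Qed.

(** A nonzero idempotent has norm at least 1 in a normed algebra. *)
Lemma proj_hs1 e : nonzero_proj e -> 1 <= hs 0 0 e.
Proof.
move=> [_ [ee _] e0]; have h0 := hs_gt0 0 0 e0.
by rewrite -(ler_pM2r h0) mul1r -{1}ee; exact: hsM.
Qed.

Definition minproj p := nonzero_proj p /\ forall e, nonzero_proj e -> Lss_mul p e = e -> e = p.

(** Splitting off a smaller projection f from e lowers the square of hs 0 0 by
    at least 1, since it is additive on orthogonal projections; so this stops
    after finitely many steps. *)
Lemma minproj_exists e : nonzero_proj e -> exists2 p, minproj p & Lss_mul e p = p.
Proof.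
have [n] : exists n : nat, hs 0 0 e ^+ 2 <= n%:R.
  by exists (Num.bound (hs 0 0 e ^+ 2)); apply/ltW/archi_boundP; exact: sqr_ge0.
elim: n e => [|n IH] e hn pe.
  have := proj_hs1 pe; have : hs 0 0 e ^+ 2 = 0 by apply/eqP; rewrite eq_le hn sqr_ge0.
  by move/eqP; rewrite sqrf_eq0 => /eqP ->; rewrite ler10.
have [me|] := pselect (minproj e).
  by exists e => //; have [_ [] ] := pe.
move=> nm; have [f [pf ef fe]] : exists f, [/\ nonzero_proj f, Lss_mul e f = f & f <> e].
  apply: contrapT => h; apply: nm; split=> // f pf ef; apply: contrapT => fe.
  by apply: h; exists f.
have [Ee [ee se] e0] := pe; have [Ef [ff sf] f0] := pf.
have fef : Lss_mul f e = f by rewrite (alg_comm CE Ef Ee).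
have pg : nonzero_proj (e - f).
  split; first exact: subspaceB (alg_lin CE) Ee Ef.
    split; last exact: LadjB.
    by rewrite LmulBl !LmulBr ee ef fef ff subrr subr0.
  by move=> /eqP; rewrite subr_eq0 => /eqP h; apply: fe.
have split2 : hs 0 0 e ^+ 2 = hs 0 0 f ^+ 2 + hs 0 0 (e - f) ^+ 2.
  apply: hs_sqr3 => k; have ek : ecol e k = ecol f k + ecol (e - f) k by rewrite ecolB addrC subrK.
  rewrite ek lnorm0_add.
  have -> : l2_dot (ecol f k) (ecol (e - f) k) = 0.
    rewrite -!app_es (Lss_adj _ _ sf) -app_mul LmulBr fef ff subrr.
    by rewrite app_es ecol0 sdot_conj sdot0l rmorph0.
  by rewrite mulr0 addr0.
have [|p mp fp] := IH f _ pf; last by exists p => //; rewrite -fp LmulA ef.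
have g1 := proj_hs1 pg.
have g2 : 1 <= hs 0 0 (e - f) ^+ 2 by rewrite expr_ge1 ?hs_ge0.
move: hn g2; rewrite split2 -natr1; move: (hs 0 0 f ^+ 2) (_ ^+ 2) (n%:R) => u v w; lra.
Qed.

(** Real and imaginary part of an operator. *)
Lemma sa_decomp T : E T -> exists A B, [/\ E A, E B, Lss_adjoint A A, Lss_adjoint B B &
  T = A + (0 +i* 1) *: B].
Proof.
move=> ET; have [T' ET' adT] := alg_adj CE ET; have hE := alg_lin CE.
have adT' := adj_sym adT.
pose h : R[i] := (2^-1)%:C; pose g : R[i] := 0 +i* (- 2^-1).
have hc : h^* = h by apply/eqP; rewrite eq_complex /= oppr0 !eqxx.
have gc : g^* = - g by apply/eqP; rewrite eq_complex /= oppr0 !eqxx.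
exists (h *: (T + T')), (g *: (T - T')); split.
- exact: (subspaceZ h hE (subspaceD hE ET ET')).
- exact: (subspaceZ g hE (subspaceB hE ET ET')).
- have := LadjZ h (LadjD adT adT'); rewrite (addrC T' T).
  by have -> : Num.conj h = h by exact: hc.
- have := LadjZ g (LadjB adT adT').
  have -> : Num.conj g = - g by exact: gc.
  by rewrite scaleNr -scalerN opprB.
- have h1 : (0 +i* 1) * g = h.
    by rewrite /g /h; congr (_ +i* _); rewrite ?mul0r ?mulr0 ?mul1r ?subr0 ?sub0r ?addr0 ?opprK.
  rewrite scalerA h1 -scalerDr addrACA subrr addr0 -mulr2n -scaler_nat scalerA.
  have -> : h * 2%:R = 1 :> R[i].
    by rewrite /h -(rmorph_nat (real_complex R)) -rmorphM mulVf// pnatr_eq0.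
  by rewrite scale1r.
Qed.

(** The spectral projection of a lies below p, hence equals p by minimality. *)
Lemma minproj_scalar_sa p a : minproj p -> E a -> Lss_adjoint a a -> Lss_mul p a = a ->
  exists c : R, Lss_mul a a = c%:C *: p.
Proof.
move=> [[Ep pp p0] mp] Ea sa pa; have [->|/eqP a0] := eqVneq a 0.
  by exists 0; rewrite Lmul0l rmorph0 scale0r.
have [e [r [pe r0 aae ep key]]] := spectral_projection Ea sa a0.
by exists (r ^+ 2); apply: key => //; apply: mp => //; exact: ep.
Qed.

(** For self-adjoint a = pT both a^2 and (a+p)^2 are multiples of p, so 2a =
    (a+p)^2 - a^2 - p is one as well; the general case follows by taking real
    and imaginary parts. *)
Lemma minproj_scalar p T : minproj p -> E T -> exists c : R[i], Lss_mul p T = c *: p.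
Proof.
move=> mp ET; have [[Ep [pp sp] p0] _] := mp; have hE := alg_lin CE.
have sak A : E A -> Lss_adjoint A A -> exists c : R[i], Lss_mul p A = c *: p.
  move=> EA sA; pose a := Lss_mul p A.
  have Ea : E a by exact: (alg_mul CE).
  have sa : Lss_adjoint a a by have := LadjM sp sA; rewrite (alg_comm CE EA Ep).
  have pa : Lss_mul p a = a by rewrite /a LmulA pp.
  have ap : Lss_mul a p = a by rewrite (alg_comm CE Ea Ep).
  have [c hc] := minproj_scalar_sa mp Ea sa pa.
  have [|||d hd] := @minproj_scalar_sa p (a + p) mp.
  - exact: subspaceD.
  - exact: LadjD.
  - by rewrite LmulDr pa pp.
  move: hd; rewrite LmulDl !LmulDr hc pa ap pp => hd.
  exists ((d - c - 1)%:C / 2%:R); rewrite -/a.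
  have {}hd : 2%:R *: a = (d - c - 1)%:C *: p.
    rewrite !rmorphB rmorph1 !scalerBl scale1r -hd.
    by rewrite scaler_nat mulr2n zmod_cancel.
  by rewrite mulrC -scalerA -hd scalerA mulVf ?scale1r// pnatr_eq0.
have [A [B [EA EB sA sB ->]]] := sa_decomp ET.
have [c hc] := sak A EA sA; have [d hd] := sak B EB sB.
by exists (c + (0 +i* 1) * d); rewrite LmulDr LmulZr hc hd scalerDl scalerA.
Qed.

Lemma minproj_orth p f : minproj p -> minproj f -> p <> f -> Lss_mul p f = 0.
Proof.
move=> mp mf pf; have [[Ep [pp sp] p0] _] := mp; have [[Ef [ff sf] f0] _] := mf.
have [c hc] := minproj_scalar mp Ef; have [d hd] := minproj_scalar mf Ep.
rewrite (alg_comm CE Ef Ep) hc in hd.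
have [c0|c0] := eqVneq c 0; first by rewrite hc c0 scale0r.
exfalso; apply: pf.
have pk : p = (c^-1 * d) *: f by rewrite -scalerA -hd scalerA mulVf// scale1r.
move: pk p0 pp; move: (c^-1 * d) => k -> p0.
rewrite LmulZl LmulZr ff scalerA => /eqP; rewrite -subr_eq0 -scalerBl scaler_eq0.
have /eqP/negbTE -> := f0; rewrite orbF -{3}(mulr1 k) -mulrBr mulf_eq0.
case/orP => /eqP k0; first by exfalso; apply: p0; rewrite k0 scale0r.
have -> : k = 1 by apply/eqP; rewrite -subr_eq0 k0.
by rewrite scale1r.
Qed.

(** A self-adjoint element annihilated by all minimal projections is 0:
    otherwise its spectral projection would dominate a minimal one. *)
Lemma minproj_complete T : E T -> (forall p, minproj p -> Lss_mul p T = 0) -> T = 0.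
Proof.
move=> ET hT; have [T' ET' adT] := alg_adj CE ET.
have hT' p : minproj p -> Lss_mul p T' = 0.
  move=> mp; have [[Ep [_ sp] _] _] := mp.
  have := LadjM sp adT; rewrite hT// => h; have := adj_unique Ladj0 h.
  by rewrite (alg_comm CE ET' Ep).
have key A : E A -> Lss_adjoint A A -> (forall p, minproj p -> Lss_mul p A = 0) -> A = 0.
  move=> EA sA hA; apply: contrapT => A0.
  have [e [r [pe r0 aae _ _]]] := spectral_projection EA sA A0.
  have [p mp ep] := minproj_exists pe.
  have [Ee _ _] := pe; have [[Ep _ p0] _] := mp.
  apply: p0; have : Lss_mul p (Lss_mul (Lss_mul A A) e) = 0.
    by rewrite !LmulA (hA p mp) !Lmul0l.
  rewrite aae LmulZr (alg_comm CE Ep Ee) ep => /eqP; rewrite scaler_eq0.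
  by rewrite eq_complex /= expf_eq0 /= gt_eqF//= => /eqP.
have hE := alg_lin CE.
have [A [B [EA EB sA sB TAB]]] := sa_decomp ET.
have adT2 : Lss_adjoint T (A - (0 +i* 1) *: B).
  have := LadjD sA (LadjZ (0 +i* 1) sB); rewrite -TAB.
  have -> : Num.conj (0 +i* 1 : R[i]) = - (0 +i* 1) by congr (_ +i* _); rewrite oppr0.
  by rewrite scaleNr.
have T'AB : T' = A - (0 +i* 1) *: B by exact: adj_unique adT adT2.
have i0 : (0 +i* 1 : R[i]) != 0 by rewrite eq_complex /= oner_eq0 andbF.
have A0 : A = 0.
  apply: key => // p mp; have e1 := hT p mp; have e2 := hT' p mp.
  have : Lss_mul p (T + T') = 0 by rewrite LmulDr e1 e2 addr0.
  rewrite TAB T'AB addrACA subrr addr0 -mulr2n -scaler_nat LmulZr => /eqP.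
  by rewrite scaler_eq0 pnatr_eq0 /= => /eqP.
have B0 : B = 0.
  apply: key => // p mp; have e1 := hT p mp.
  rewrite TAB A0 add0r LmulZr in e1; move/eqP: e1; rewrite scaler_eq0 (negbTE i0).
  by move=> /eqP.
by rewrite TAB A0 B0 scaler0 addr0.
Qed.

(** By Bessel's inequality applied to e_k, only finitely many minimal
    projections p satisfy |p e_k|^2 >= 1/(n+1). *)
Lemma minproj_countable : countable [set p | minproj p].
Proof.
(* A minimal projection has a nonzero column k, hence lies in one of the
   countably many sets F k n; each of these is finite. *)
pose F k n := [set p | minproj p /\ 1 <= n.+1%:R * lnorm 0 (ecol p k) ^+ 2].
apply: (@sub_countable _ _ _ (\bigcup_k (\bigcup_n F k n))).
  apply: subset_card_le => p mp; have [[Ep pp p0] _] := mp.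
  have [k hk] : exists k, ecol p k <> 0.
    apply: contrapT => h; apply: p0; apply: Lss_ext => k; rewrite ecol0.
    by apply: contrapT => hk; apply: h; exists k.
  exists k => //; have l0 : 0 < lnorm 0 (ecol p k) ^+ 2.
    rewrite exprn_gt0// lt_neqAle lnorm_ge0 andbT; apply/eqP => h; apply: hk.
    by apply: lnorm0_eq0; rewrite -h.
  exists (Num.bound (lnorm 0 (ecol p k) ^+ 2)^-1) => //; split=> //.
  rewrite -ler_pdivrMr// div1r; apply: le_trans (_ : (Num.bound (lnorm 0 (ecol p k) ^+ 2)^-1)%:R <= _).
    by apply/ltW/archi_boundP; rewrite invr_ge0 sqr_ge0.
  by rewrite ler_nat.
apply: bigcup_countable => // k _; apply: bigcup_countable => // n _.
apply: finite_set_countable; apply: contrapT => /infiniteP/pcard_leP[f].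
have hf i : F k n (f i) by apply: funS.
have fi : injective f by move=> i j; apply: inj; rewrite inE.
have fo i j : i != j -> Lss_mul (f i) (f j) = 0.
  move=> ij; have [mi _] := hf i; have [mj _] := hf j; apply: minproj_orth => //.
  by move=> /fi/eqP; rewrite (negbTE ij).
have fp j : is_proj (f j) by have [[[]]] := hf j.
have := @proj_bessel R f n.+2 (es k) fp fo; rewrite lnorm_es expr0 expr1n => h.
have : \sum_(j < n.+2) (n.+1%:R^-1 : R) <= 1.
  apply: le_trans h; apply: ler_sum => j _; have [_ h1] := hf j.
  by rewrite -div1r ler_pdivrMr// mulrC.
rewrite sumr_const card_ord -[X in X <= _]mulr_natl ler_pdivrMr// mul1r ler_nat.
by rewrite ltnn.
Qed.

(** If there were only finitely many minimal projections, these would span E.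
    Being countable, they can be enumerated. *)
Lemma spectral_exists :
  ~ (exists n (v : nat -> L), (forall i, E (v i)) /\ forall T, E T -> exists c : nat -> R[i], T = \sum_(i < n) c i *: v i) ->
  exists e : nat -> L, spectral E e.
Proof.
move=> infE.
have infM : infinite_set [set p | minproj p].
  move=> /finite_seqP[s hs]; apply: infE.
  pose s' := undup s; exists (size s'), (fun i => nth 0 s' i).
  have ms i : (i < size s')%N -> minproj (nth 0 s' i).
    move=> si; have : nth 0 s' i \in s' by exact: mem_nth.
    rewrite mem_undup => h; have : [set p | p \in s] (nth 0 s' i) by [].
    by rewrite -hs.
  have hE := alg_lin CE.
  split.
    move=> i; have [h|h] := ltnP i (size s'); first by have [[]] := ms i h.
    by rewrite nth_default//; have [] := hE.
  move=> T ET.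
  have /choice[c hc] : forall i, exists c : R[i], (i < size s')%N ->
      Lss_mul (nth 0 s' i) T = c *: nth 0 s' i.
    move=> i; have [h|h] := ltnP i (size s'); last by exists 0.
    by have [c hc] := minproj_scalar (ms i h) ET; exists c.
  exists c; apply/eqP; rewrite -subr_eq0; apply/eqP; apply: minproj_complete.
    apply: (subspaceB hE ET); apply: subspace_sum => [|i _]; first exact: hE.
    apply: (subspaceZ _ hE).
    by have [[]] := ms i (ltn_ord i).
  move=> p mp; have : [set p | p \in s] p by rewrite -hs.
  rewrite /= -mem_undup => ps; have [i si pi] := nthP 0 ps.
  rewrite -pi LmulBr (@Lmul_sumr _ _ _ (fun i => c i *: nth 0 s' i)) (hc i si).
  rewrite (bigD1 (Ordinal si))//= big1 => [|j ji].
    by rewrite addr0 LmulZr; have [[_ [-> _] _] _] := ms i si; rewrite subrr.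
  rewrite LmulZr minproj_orth ?scaler0//; [exact: ms|exact: ms|].
  move/eqP; rewrite nth_uniq ?undup_uniq// => /eqP ij.
  by move/eqP: ji; apply; apply: val_inj.
have := eq_card_nat minproj_countable infM; rewrite card_eq_sym => /card_set_bijP[e [eM ei es]].
have me j : minproj (e j) by exact: eM.
exists e; split.
- by move=> j; have [[]] := me j.
- move=> i j ij; apply: minproj_orth => // /(ei _ _ (in_setT _) (in_setT _)) /eqP.
  by rewrite (negbTE ij).
- by move=> j T ET; exact: minproj_scalar.
- move=> T ET hT; apply: minproj_complete => // p mp.
  by have [j _ <-] := es p mp; exact: hT.
Qed.

End projections.

(** * Isomorphisms of Koethe spaces and bases *)

Section matrices.
Context {R : realType}.
Local Notation S := (s_space R).
Local Notation L := (Lss R).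
Implicit Types (A B : nat -> nat -> R) (q k j n m : nat).
Hint Resolve s_weight_ge0 s_weight_gt0 s_l2 : core.

(** The properties of the matrix of a spectral basis which allow powers and
    scalar factors to be absorbed. *)
Definition submult A : Prop :=
  [/\ kothe_mono A, forall j, 1 <= A j 0%N & kothe_prec (kothe_sqr A) A].

Lemma kothe_mono_homo A j q r : kothe_mono A -> (q <= r)%N -> A j q <= A j r.
Proof.
move=> hA; elim: r => [|r IH]; first by rewrite leqn0 => /eqP->.
rewrite leq_eqVlt => /predU1P[->//|]; rewrite ltnS => /IH /le_trans; apply.
by have /andP[] := hA j r.
Qed.

Lemma submult_ge1 A j q : submult A -> 1 <= A j q.
Proof. by move=> [hA h1 _]; apply: le_trans (h1 j) (kothe_mono_homo _ hA _). Qed.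

(** The columns of a projection have norm at most 1, so |p e_k|^2 <= |p e_k|;
    Cauchy-Schwarz against the weights (k+1)^-1 does the rest. *)
Lemma smatrix_submult (E : set L) (e : nat -> L) : spectral E e -> submult (smatrix e).
Proof.
move=> [he _ _ _]; split.
- by move=> j q; rewrite /smatrix hs_ge0 hs_homo.
- move=> j; have [_ [ee _] e0] := he j; have h0 := hs_gt0 0 0 e0.
  by rewrite /smatrix -(ler_pM2r h0) mul1r -{1}ee; exact: hsM.
move=> q; exists (q + q).+1, 2 => // j; rewrite /kothe_sqr /smatrix.
have [_ pe _] := he j.
set N := hs (q + q).+1 0 (e j).
have N0 : 0 <= 2 * N by rewrite mulr_ge0 ?hs_ge0.
rewrite -(sqr_sqrtr N0) ler_sqr ?nnegrE ?hs_ge0 ?sqrtr_ge0//.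
apply: (hs_leP _ _ _ _).2 => [|n]; first exact: sqrtr_ge0.
rewrite sqr_sqrtr//.
pose a k : R := k.+1%:R^-1; pose b k := lnorm 0 (ecol (e j) k) * k.+1%:R ^+ (q + q).+1.
apply: (@le_trans _ _ (\sum_(k < n) a k * b k)).
  apply: ler_sum => k _; rewrite /a /b exprMn -exprM muln2 -addnn.
  have l1 : lnorm 0 (ecol (e j) k) <= 1.
    by apply: le_trans (proj_le (es k) pe) _; rewrite lnorm_es expr0.
  rewrite (exprS (k.+1%:R : R) (q + q)) mulrCA mulKf ?pnatr_eq0//.
  by rewrite ler_wpM2r// expr2 ler_piMl// lnorm_ge0.
apply: (fin_CS (A := 2) (B := N)) => //; first exact: hs_ge0.
  apply: le_trans (_ : 2 <= _); last by rewrite expr2; lra.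
  apply: (@le_trans _ _ (\sum_(k < n) k.+1%:R ^- 2)); last exact: sum_inv_sqr.
  by apply: ler_sum => k _; rewrite /a exprVn.
exact: hs_psum.
Qed.

(** The values of an injection on an initial segment lie in a larger initial
    segment. *)
Lemma inj_sum_le (F : nat -> R) (tau : nat -> nat) n : injective tau ->
  (forall j, 0 <= F j) -> exists m, \sum_(k < n) F (tau k) <= \sum_(j < m) F j.
Proof.
move=> ti F0; pose m := (\max_(k < n) tau k).+1; exists m.
have lm (k : 'I_n) : (tau k < m)%N by rewrite ltnS; exact: (leq_bigmax k).
pose h (k : 'I_n) : 'I_m := Ordinal (lm k).
have hi : injective h by move=> i j [/ti] /val_inj.
have -> : \sum_(k < n) F (tau k) = \sum_(j in h @: [set: 'I_n]%SET) F j.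
  rewrite big_imset /=; last by move=> i j _ _; exact: hi.
  by apply: eq_bigl => i; rewrite finset.in_setT.
rewrite [leRHS](bigID (fun j : 'I_m => j \in h @: [set: 'I_n]%SET)) /= lerDl.
by apply: sumr_ge0.
Qed.

Lemma perm_bounded A B (tau : nat -> nat) (x : lambda2 A) : injective tau ->
  (forall j q, 0 <= A j q) -> (forall j q, 0 <= B j q) ->
  (forall q, exists r, exists2 c, 0 < c & forall k, B k q <= c * A (tau k) r) ->
  (fun k => x (tau k)) \in lambda2_mem B.
Proof.
move=> ti A0 B0 h; apply/asboolP => q; have [r [c c0 hc]] := h q.
apply: (@wsum_lty _ _ _ (c ^+ 2 * lnorm r x ^+ 2)) => n.
have [m hm] := @inj_sum_le (fun j => (normc (x j) * A j r) ^+ 2) tau n ti (fun j => sqr_ge0 _).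
apply: (@le_trans _ _ (c ^+ 2 * \sum_(k < n) (normc (x (tau k)) * A (tau k) r) ^+ 2)).
  rewrite mulr_sumr; apply: ler_sum => k _; rewrite -exprMn.
  rewrite ler_sqr ?nnegrE ?mulr_ge0 ?normc_ge0 ?(ltW c0)//.
  by rewrite mulrCA ler_wpM2l ?normc_ge0.
rewrite ler_wpM2l ?sqr_ge0//; apply: le_trans hm _.
exact: wpsum_le_wnorm (lambda2_lty r x).
Qed.

Lemma perm_bounded_norm A B (tau : nat -> nat) (x : lambda2 A) (y : lambda2 B) q r c : injective tau ->
  (forall j q, 0 <= A j q) -> (forall j q, 0 <= B j q) -> 0 < c ->
  (forall k, B k q <= c * A (tau k) r) -> (forall k, y k = x (tau k)) ->
  lnorm q y <= c * lnorm r x.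
Proof.
move=> ti A0 B0 c0 hc yx; apply: (wnorm_leP (lambda2_lty q y) _).2.
  by rewrite mulr_ge0 ?lnorm_ge0 ?(ltW c0).
move=> n; have [m hm] := @inj_sum_le (fun j => (normc (x j) * A j r) ^+ 2) tau n ti (fun j => sqr_ge0 _).
apply: (@le_trans _ _ (c ^+ 2 * \sum_(k < n) (normc (x (tau k)) * A (tau k) r) ^+ 2)).
  rewrite mulr_sumr; apply: ler_sum => k _; rewrite -exprMn yx.
  rewrite ler_sqr ?nnegrE ?mulr_ge0 ?normc_ge0 ?(ltW c0)//.
  by rewrite mulrCA ler_wpM2l ?normc_ge0.
rewrite exprMn ler_wpM2l ?sqr_ge0//; apply: le_trans hm _.
exact: wpsum_le_wnorm (lambda2_lty r x).
Qed.

(** Boundedness of the permutation of coordinates, in both directions, is the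
    equivalence of the matrices. *)
Lemma perm_iso A B (sigma tau : nat -> nat) : cancel sigma tau -> cancel tau sigma ->
  (forall j q, 0 <= A j q) -> (forall j q, 0 <= B j q) ->
  kothe_equiv A (kothe_perm sigma B) -> exists T S,
  tame_iso [set: lambda2 A] (fun q => @lnorm R _ q) [set: lambda2 B] (fun q => @lnorm R _ q) T S
  /\ forall x j, T x (sigma j) = x j.
Proof.
move=> st ts A0 B0 [AB BA].
have ti := can_inj ts; have si := can_inj st.
have hT q : exists r, exists2 c, 0 < c & forall k, B k q <= c * A (tau k) r.
  have [r [c c0 h]] := BA q; exists r, c => // k; have := h (tau k).
  by rewrite /kothe_perm ts.
pose T (x : lambda2 A) : lambda2 B := Lambda2 (perm_bounded x ti A0 B0 hT).
pose Sm (y : lambda2 B) : lambda2 A := Lambda2 (perm_bounded y si B0 A0 AB).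
exists T, Sm; split; last by move=> x j; rewrite /T /= st.
split.
- by move=> a x y _ _; apply: lambda2_ext.
- by move=> x _; split=> //; apply: lambda2_ext => j; rewrite /= st.
- by move=> x _; split=> //; apply: lambda2_ext => j; rewrite /= ts.
- move=> q; have [r [c c0 h]] := hT q; exists r, c; split=> [|x _]; first exact: ltW.
  by apply: (@perm_bounded_norm A B tau x (T x) q r c ti A0 B0 c0 h).
- move=> q; have [r [c c0 h]] := AB q; exists r, c; split=> [|x _]; first exact: ltW.
  by apply: (@perm_bounded_norm B A sigma x (Sm x) q r c si B0 A0 c0 h).
Qed.

Lemma lambda2_full A : linear_subspace [set: lambda2 A].
Proof. by split. Qed.

Lemma tame_lcvg A B (E : set (lambda2 A)) (F : set (lambda2 B)) T S u x :
  linear_subspace E ->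
  tame_iso E (fun q => @lnorm R A q) F (fun q => @lnorm R B q) T S ->
  (forall n, E (u n)) -> E x -> lcvg u x -> lcvg (T \o u) (T x).
Proof.
move=> hE [Tl TS ST Tb Sb] Eu Ex ux q e e0; have [r [c [c0 hc]]] := Tb q.
have [d d0 hd] := eps_lin e0 c0; have [n0 h] := ux r d d0.
exists n0 => n n0n /=; rewrite -(lin_onB hE Tl (Eu n) Ex).
apply: le_trans (hc _ (subspaceB hE (Eu n) Ex)) _; rewrite -[leLHS]addr0.
exact: hd (lnorm_ge0 _ _) (h n n0n) (ltW d0).
Qed.

(** The isomorphism transports the expansion in unit vectors, and its inverse
    gives the uniqueness of the coefficients. *)
Lemma ldelta_basis A (X : set S) T U : submult A -> linear_subspace X ->
  tame_iso [set: lambda2 A] (fun q => @lnorm R A q) X (fun q => @lnorm R _ q) T U ->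
  schauder_basis X (fun j => T (ldelta A j)).
Proof.
move=> gA hX TU; have [Am A1 _] := gA; have [Tl TX UX Tb Ub] := TU.
have A0 j q : 0 <= A j q by have /andP[] := Am j q.
have Ap j : exists q, 0 < A j q by exists 0%N; exact: lt_le_trans (A1 j).
have hA := lambda2_full A.
have Ul := inv_lin hA hX TU.
split=> [j|y Xy]; first by have [] := TX (ldelta A j) I.
have [_ Uy] := UX y Xy.
have serE (t : nat -> R[i]) : series (fun j => t j *: T (ldelta A j)) =
    (fun n => \sum_(j < n) t j *: T (ldelta A j)).
  by apply/funext => n; rewrite /series /= big_mkord.
exists (U y); split.
  rewrite serE; apply/scvgP; rewrite -{2}Uy.
  have := tame_lcvg hA TU (fun _ => I) I (lcvg_delta (U y) A0).
  have -> // : T \o (fun n => \sum_(k < n) U y k *: ldelta A k) =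
     (fun n => \sum_(j < n) U y j *: T (ldelta A j)).
  apply/funext => n /=; exact: (lin_on_sum n _ hA Tl).
move=> t; rewrite serE => /scvgP ty; apply/funext => j.
have Xs n : X (\sum_(j < n) t j *: T (ldelta A j)).
  apply: subspace_sum => [|i _]; first exact: hX.
  by apply: (subspaceZ _ hX); have [] := TX (ldelta A i) I.
have := tame_lcvg hX (tame_sym hA hX TU) Xs Xy ty.
have -> : U \o (fun n => \sum_(j < n) t j *: T (ldelta A j)) =
    (fun n => \sum_(j < n) t j *: ldelta A j).
  apply/funext => n /=; rewrite (@lin_on_sum R _ _ X U n t (fun j => T (ldelta A j)) hX Ul); last by move=> i; have [] := TX (ldelta A i) I.
  by apply: eq_bigr => i _; have [_ ->] := TX (ldelta A i) I.
move=> /(lcvg_ccvg j A0 Ap) h; apply: (ccvg_unique h) => e e0; exists j.+1 => n jn.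
rewrite lambda2_sum (bigD1 (Ordinal jn))// big1 => [|i ij].
  by rewrite ldeltaZ eqxx mulr1 /= addr0 subrr normc0.
rewrite ldeltaZ (_ : (j == i :> nat) = false) ?mulr0//.
by apply/negbTE; apply: contraNN ij => /eqP h1; apply/eqP/val_inj.
Qed.

(** The factors l_j are eliminated as follows: a_q^2 <= C a_(q') <= C' l_j b_r
    and l_j <= l_j b_0 <= C'' a_p, whence a <= C b after cancelling one factor
    a; entries at least 1 and the domination of squares are used on both
    sides. *)
Lemma submult_scale A B (sigma : nat -> nat) (l : nat -> R) : submult A -> submult B ->
  (forall j, 0 < l j) ->
  (forall q, exists r (c : R), 0 <= c /\ forall j, l j * B (sigma j) q <= c * A j r) ->
  (forall q, exists r (c : R), 0 <= c /\ forall j, A j q <= c * (l j * B (sigma j) r)) ->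
  kothe_equiv A (kothe_perm sigma B).
Proof.
move=> gA gB l0 BA AB; have [Am A1 Asq] := gA; have [Bm B1 Bsq] := gB.
have Ap j q : 0 < A j q by exact: lt_le_trans (submult_ge1 j q gA).
have Bp j q : 0 < B j q by exact: lt_le_trans (submult_ge1 j q gB).
split=> q.
  have [p [c [c0 hc]]] := BA 0%N.
  have [q1 [d d0 hd]] := Asq (maxn q p).
  have [r [f [f0 hf]]] := AB q1.
  exists r, (d * f * c + 1); first by rewrite ltr_wpDl// !mulr_ge0// ltW.
  move=> j; apply: le_trans (kothe_mono_homo j Am (leq_maxl q p)) _.
  set a := A j (maxn q p); have a0 : 0 < a by exact: Ap.
  rewrite -(ler_pM2l a0) -expr2; apply: le_trans (hd j) _.
  apply: le_trans (_ : d * (f * (l j * B (sigma j) r)) <= _); first by rewrite ler_wpM2l// ltW.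
  have lj : l j <= c * a.
    apply: le_trans (_ : l j * B (sigma j) 0%N <= _); first by rewrite ler_peMr// ltW.
    by apply: le_trans (hc j) _; rewrite ler_wpM2l// kothe_mono_homo// leq_maxr.
  have b0 := Bp (sigma j) r; rewrite /kothe_perm; move: (B (sigma j) r) b0 => b b0.
  apply: (@le_trans _ _ (d * (f * (c * a * b)))).
    by rewrite !ler_wpM2l ?(ltW d0)// ler_wpM2r// ltW.
  have -> : d * (f * (c * a * b)) = a * (d * f * c * b) by ring.
  by rewrite ler_wpM2l ?(ltW a0)// ler_wpM2r ?(ltW b0)//; lra.
have [p [c [c0 hc]]] := AB 0%N.
have [q1 [d d0 hd]] := Bsq (maxn q p).
have [r [f [f0 hf]]] := BA q1.
exists r, (d * f * c + 1); first by rewrite ltr_wpDl// !mulr_ge0// ltW.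
move=> j; rewrite /kothe_perm; apply: le_trans (kothe_mono_homo (sigma j) Bm (leq_maxl q p)) _.
set b := B (sigma j) (maxn q p); have b0 : 0 < b by exact: Bp.
rewrite -(ler_pM2l b0) -expr2; apply: le_trans (hd (sigma j)) _.
have h1 : B (sigma j) q1 <= f * A j r / l j by rewrite ler_pdivlMr// mulrC.
apply: le_trans (_ : d * (f * A j r / l j) <= _); first by rewrite ler_wpM2l// ltW.
have lj : (l j)^-1 <= c * b.
  rewrite -(ler_pM2l (l0 j)) mulfV ?gt_eqF//; apply: le_trans (A1 j) _.
  apply: le_trans (hc j) _; rewrite mulrCA ler_wpM2l ?(ltW (l0 j))// ler_wpM2l//.
  by rewrite kothe_mono_homo// leq_maxr.
have a0 := Ap j r; move: (A j r) a0 => a a0.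
apply: (@le_trans _ _ (d * (f * a * (c * b)))).
  by rewrite !ler_wpM2l ?(ltW d0)// mulr_ge0// ltW.
have -> : d * (f * a * (c * b)) = b * (d * f * c * a) by ring.
by rewrite ler_wpM2l ?(ltW b0)// ler_wpM2r ?(ltW a0)//; lra.
Qed.

(** Transport the quasi-equivalence to an isomorphism of the two matrix spaces
    that maps e_j to a multiple of e_(sigma j), and read off its estimates on
    the unit vectors. *)
Lemma quasi_equiv_matrices A B (X : set S) T U T' U' : linear_subspace X ->
  submult A -> submult B ->
  tame_iso [set: lambda2 A] (fun q => @lnorm R A q) X (fun q => @lnorm R _ q) T U ->
  tame_iso [set: lambda2 B] (fun q => @lnorm R B q) X (fun q => @lnorm R _ q) T' U' ->
  quasi_equivalent X (fun j => T (ldelta A j)) (fun j => T' (ldelta B j)) ->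
  exists2 sigma, bijective sigma & kothe_equiv A (kothe_perm sigma B).
Proof.
move=> hX gA gB TU TU' [sigma [l [bs l0 [Q QX Ql]]]]; exists sigma => //.
have gX := graded_s hX.
have [Q' QQ'] := frechet_tame gX gX QX.
have hA := lambda2_full A; have hB := lambda2_full B.
have W := tame_trans (tame_trans TU QQ') (tame_sym hB hX TU').
have [Wl WW W'W Wb W'b] := W.
have [T'l T'X _ _ _] := TU'.
have U'l := inv_lin hB hX TU'.
have Wd j : (U' \o (Q \o T)) (ldelta A j) = l j *: ldelta B (sigma j).
  rewrite /= Ql (lin_onZ _ hX U'l); last by have [] := T'X (ldelta B (sigma j)) I.
  by have [_ ->] := T'X (ldelta B (sigma j)) I.
have [Am _ _] := gA; have [Bm _ _] := gB.
have A0 j q : 0 <= A j q by have /andP[] := Am j q.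
have B0 j q : 0 <= B j q by have /andP[] := Bm j q.
have nl j : 0 < normc (l j).
  by rewrite lt_neqAle normc_ge0 andbT eq_sym; apply: contraNN (l0 j) => /eqP/eq0_normc->.
apply: (submult_scale gA gB nl) => q.
  have [r [c [c0 hc]]] := Wb q; exists r, c; split=> // j.
  by have := hc (ldelta A j) I; rewrite Wd lnormZ !lnorm_ldelta.
have [r [c [c0 hc]]] := W'b q; exists r, c; split=> // j.
have [_ Wi] := WW (ldelta A j) I.
have := hc ((U' \o (Q \o T)) (ldelta A j)) I; rewrite Wi Wd lnormZ.
by rewrite !lnorm_ldelta.
Qed.

End matrices.

(** * Algebra isomorphisms and permutations of minimal projections *)

Section star_isomorphisms.
Context {R : realType}.
Local Notation S := (s_space R).
Local Notation L := (Lss R).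
Implicit Types (A B : nat -> nat -> R) (q k j n m : nat) (T U : L).
Hint Resolve s_weight_ge0 s_weight_gt0 s_l2 : core.
Local Notation hs0p := (fun q (T : L) => hs q 0 T).

Lemma spectral_scal_inj (E : set L) (e : nat -> L) j (c d : R[i]) : spectral E e ->
  c *: e j = d *: e j -> c = d.
Proof.
move=> [h _ _ _] /eqP; rewrite -subr_eq0 -scalerBl scaler_eq0 subr_eq0.
by have [_ _ e0] := h j; move=> /orP[/eqP//|/eqP /e0].
Qed.

Lemma spectral_inj (E : set L) (e : nat -> L) : spectral E e -> injective e.
Proof.
move=> [h h1 _ _] i j eij; apply/eqP; apply: contrapT => /negP ij.
have [_ [ee _] e0] := h i; apply: e0; rewrite -ee {2}eij; exact: h1.
Qed.

(** In spectral coordinates the product and the adjoint are the coordinatewise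
    product and conjugation, so the coordinate permutation is a star
    isomorphism. *)
Lemma star_iso_of_equiv (E F : set L) (e f : nat -> L) sigma :
  closed_commutative_star_subalgebra E -> closed_commutative_star_subalgebra F ->
  spectral E e -> spectral F f -> bijective sigma ->
  kothe_equiv (smatrix e) (kothe_perm sigma (smatrix f)) -> frechet_star_iso E F.
Proof.
move=> cE cF se sf [tau st ts] eqv.
have [Pe [Ae [ie pe ae]]] := spectral_model cE se.
have [Pf [Af [jf pf af]]] := spectral_model cF sf.
have A0 (g : nat -> L) j q : 0 <= smatrix g j q by exact: hs_ge0.
have [T [U [iT TE]]] := perm_iso st ts (A0 e) (A0 f) eqv.
have hA := lambda2_full (smatrix e); have hB := lambda2_full (smatrix f).
have hE := alg_lin cE; have hF := alg_lin cF.
have W := tame_trans (tame_trans (tame_sym hA hE ie) iT) jf.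
have [_ WF _ _ _] := W.
pose Phi := Pf \o (T \o Ae).
have PhiF x : E x -> F (Phi x) by move=> /WF[].
have coef x j : E x -> Lss_mul (f (sigma j)) (Phi x) = Ae x j *: f (sigma j).
  by move=> Ex; rewrite pf TE.
have ext x y : F x -> F y ->
    (forall j, Lss_mul (f (sigma j)) x = Lss_mul (f (sigma j)) y) -> x = y.
  move=> Fx Fy h; apply: (spectral_ext cF sf Fx Fy) => k.
  by rewrite -(ts k) h.
have aeM x y j : E x -> E y -> Ae (Lss_mul x y) j = Ae x j * Ae y j.
  move=> Ex Ey; apply: (spectral_scal_inj (j := j) se).
  rewrite -(ae _ j (alg_mul cE Ex Ey)) LmulA (ae x j Ex) LmulZl (ae y j Ey).
  by rewrite scalerA.
have aeJ x y j : E x -> E y -> Lss_adjoint x y -> Ae y j = (Ae x j)^*.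
  move=> Ex Ey xy; apply: (spectral_scal_inj (j := j) se).
  have [h _ _ _] := se; have [Ej [_ sj] _] := h j.
  have h1 := LadjM xy sj; rewrite (alg_comm cE Ex Ej) (ae x j Ex) (ae y j Ey) in h1.
  exact: (adj_unique h1 (LadjZ (Ae x j) sj)).
exists Phi; split.
- exact: (tame_frechet (alg_graded cE) (alg_graded cF) W).
- move=> x y Ex Ey; apply: ext => [||j].
  + by apply: PhiF; exact: (alg_mul cE).
  + by apply: (alg_mul cF); exact: PhiF.
  rewrite (coef _ j (alg_mul cE Ex Ey)) LmulA (coef x j Ex) LmulZl (coef y j Ey).
  by rewrite scalerA aeM.
- move=> x y Ex Ey xy; have [z Fz Pz] := alg_adj cF (PhiF x Ex).
  have -> // : Phi y = z.
  apply: ext => [||j]; [exact: PhiF|exact: Fz|].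
  have [h _ _ _] := sf; have [Fj [_ sj] _] := h (sigma j).
  have h1 := LadjM Pz sj.
  rewrite (alg_comm cF (PhiF x Ex) Fj) (coef x j Ex) in h1.
  have h2 := adj_unique h1 (LadjZ (Ae x j) sj).
  by rewrite h2 (coef y j Ey) (aeJ x y j Ex Ey xy).
Qed.

(** The image u of e_j is idempotent and nonzero, so some f_k does not
    annihilate it and f_k u = f_k; pulling f_k back gives an element of the
    line spanned by e_j, so f_k is a multiple of u, and idempotency makes the
    factor 1. *)
Lemma mult_iso_spectral (E F : set L) (e f : nat -> L) Phi Psi :
  closed_commutative_star_subalgebra E -> closed_commutative_star_subalgebra F ->
  spectral E e -> spectral F f ->
  (forall x, E x -> F (Phi x) /\ Psi (Phi x) = x) ->
  (forall y, F y -> E (Psi y) /\ Phi (Psi y) = y) ->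
  lin_on E Phi ->
  (forall x y, E x -> E y -> Phi (Lss_mul x y) = Lss_mul (Phi x) (Phi y)) ->
  forall j, exists k, Phi (e j) = f k.
Proof.
move=> cE cF se sf PF PE Pl PM j; have hE := alg_lin cE; have hF := alg_lin cF.
have [he he1 he2 he3] := se; have [hf hf1 hf2 hf3] := sf.
have [Ej [ee _] e0] := he j.
pose u := Phi (e j).
have Fu : F u by have [] := PF _ Ej.
have uu : Lss_mul u u = u by rewrite /u -PM// ee.
have u0 : u <> 0.
  move=> h; apply: e0; have [_ <-] := PF _ Ej; rewrite -/u h.
  by have [E0 _] := hE; have [_ h0] := PF _ E0; rewrite (lin_on0 hE Pl) in h0.
have [k fk] : exists k, Lss_mul (f k) u <> 0.
  apply: contrapT => h; apply: u0; apply: hf3 => // k.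
  by apply: contrapT => hk; apply: h; exists k.
exists k; have [Fk [ff _] f0] := hf k.
have [b hb] := hf2 k u Fu.
have b0 : b != 0 by apply: contra_notN fk => /eqP b0; rewrite hb b0 scale0r.
(* The scalar b is idempotent and nonzero. *)
have fu : Lss_mul (f k) u = f k.
  have : Lss_mul (f k) (Lss_mul u u) = Lss_mul (f k) u by rewrite uu.
  rewrite LmulA hb LmulZl hb scalerA => /(spectral_scal_inj sf) bb.
  have -> : b = 1 by apply: (mulfI b0); rewrite bb mulr1.
  by rewrite scale1r.
have [Ev Pv] := PE _ Fk; set v := Psi (f k) in Ev Pv.
have ev : Lss_mul (e j) v = v.
  have [_ <-] := PF _ (alg_mul cE Ej Ev); rewrite PM// Pv -/u.
  by rewrite (alg_comm cF Fu Fk) fu.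
have [c hc] := he2 j v Ev.
have fc : f k = c *: u by rewrite -Pv -ev hc (lin_onZ _ hE Pl Ej).
have c0 : c != 0 by apply: contra_notN f0 => /eqP c0; rewrite fc c0 scale0r.
move: ff; rewrite fc LmulZl LmulZr uu scalerA => /eqP.
rewrite -subr_eq0 -scalerBl scaler_eq0 => /orP[|/eqP //].
rewrite -[X in _ - X]mulr1 -mulrBr mulf_eq0 (negbTE c0) /= subr_eq0 => /eqP ->.
by rewrite scale1r.
Qed.

(** A multiplicative isomorphism permutes the spectral bases; its continuity
    in both directions is the equivalence of the matrices. *)
Lemma mult_iso_perm (E F : set L) (e f : nat -> L) Phi Psi :
  closed_commutative_star_subalgebra E -> closed_commutative_star_subalgebra F ->
  spectral E e -> spectral F f ->
  tame_iso E hs0p F hs0p Phi Psi ->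
  (forall x y, E x -> E y -> Phi (Lss_mul x y) = Lss_mul (Phi x) (Phi y)) ->
  exists2 sigma, bijective sigma & kothe_equiv (smatrix e) (kothe_perm sigma (smatrix f)).
Proof.
move=> cE cF se sf PP PM; have hE := alg_lin cE; have hF := alg_lin cF.
have [Pl PF PE Pb Qb] := PP; have Ql := inv_lin hE hF PP.
have QM x y : F x -> F y -> Psi (Lss_mul x y) = Lss_mul (Psi x) (Psi y).
  move=> Fx Fy; have [Ex xx] := PE x Fx; have [Ey yy] := PE y Fy.
  by have [_ <-] := PF _ (alg_mul cE Ex Ey); rewrite PM// xx yy.
have /choice[sigma hs_] := mult_iso_spectral cE cF se sf PF PE Pl PM.
have /choice[tau ht_] := mult_iso_spectral cF cE sf se PE PF Ql QM.
have [he _ _ _] := se; have [hf _ _ _] := sf.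
have st j : tau (sigma j) = j.
  apply: (spectral_inj se); rewrite -ht_ -hs_; have [Ej _ _] := he j.
  by have [_ ->] := PF _ Ej.
have ts k : sigma (tau k) = k.
  apply: (spectral_inj sf); rewrite -hs_ -ht_; have [Fk _ _] := hf k.
  by have [_ ->] := PE _ Fk.
exists sigma; first by exists tau.
split=> q.
  have [r [c [c0 h]]] := Qb q; exists r, (c + 1); first by lra.
  move=> j; have [Fk _ _] := hf (sigma j); have := h _ Fk.
  rewrite ht_ st /kothe_perm /smatrix => /le_trans; apply.
  by rewrite ler_wpM2r ?hs_ge0// lerDl.
have [r [c [c0 h]]] := Pb q; exists r, (c + 1); first by lra.
move=> j; have [Ej _ _] := he j; have := h _ Ej.
rewrite hs_ /kothe_perm /smatrix => /le_trans; apply.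
by rewrite ler_wpM2r ?hs_ge0// lerDl.
Qed.

(** A finite spanning family of E would be mapped to one of X. *)
Lemma infinite_dim_transfer (E : set L) (X : set S) Phi Psi :
  linear_subspace E -> infinite_dimensional X ->
  tame_iso E hs0p X (fun q => @lnorm R _ q) Phi Psi ->
  ~ (exists n (v : nat -> L), (forall i, E (v i)) /\
     forall T, E T -> exists c : nat -> R[i], T = \sum_(i < n) c i *: v i).
Proof.
move=> hE infX [Pl PX XP _ _] [n [v [Ev hv]]]; apply: infX.
exists n, (fun i : 'I_n => Phi (v i)) => x Xx.
have [Ex <-] := XP x Xx; have [c ->] := hv _ Ex.
exists n, (fun i : 'I_n => c i), (fun i : 'I_n => Phi (v i)); split.
  by move=> i; exists i.
exact: (@lin_on_sum R _ _ E Phi n c v hE Pl Ev).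
Qed.

(** The spectral bases of two algebras isomorphic to X yield bases of X, and
    quasi-equivalence of these gives equivalence of the matrices. *)
Lemma quasi_equivalence_algebras (X : set S) :
  linear_subspace X -> infinite_dimensional X ->
  (forall x y : nat -> S, schauder_basis X x -> schauder_basis X y -> quasi_equivalent X x y) ->
  forall E F : set L,
    closed_commutative_star_subalgebra E -> closed_commutative_star_subalgebra F ->
    frechet_iso E F -> frechet_iso F X -> frechet_star_iso E F.
Proof.
move=> hX infX qe E F cE cF [T0 iEF] [T1 iFX].
have gE := alg_graded cE; have gF := alg_graded cF; have gX := graded_s hX.
have hE := alg_lin cE; have hF := alg_lin cF.
have [U0 i0] := frechet_tame gE gF iEF; have [U1 i1] := frechet_tame gF gX iFX.
have [e se] := spectral_exists cE (infinite_dim_transfer hE infX (tame_trans i0 i1)).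
have [f sf] := spectral_exists cF (infinite_dim_transfer hF infX i1).
have [Pe [Ae [ie _ _]]] := spectral_model cE se.
have [Pf [Af [jf _ _]]] := spectral_model cF sf.
have iA := tame_trans ie (tame_trans i0 i1); have iB := tame_trans jf i1.
have gA := smatrix_submult se; have gB := smatrix_submult sf.
have [sigma bs eqv] := quasi_equiv_matrices hX gA gB iA iB
  (qe _ _ (ldelta_basis gA hX iA) (ldelta_basis gB hX iB)).
exact: star_iso_of_equiv cE cF se sf bs eqv.
Qed.

End star_isomorphisms.

(** * The algebra of an orthonormal sequence *)

Section projection_algebras.
Context {R : realType}.
Local Notation S := (s_space R).
Local Notation L := (Lss R).
Implicit Types (q k j n m : nat) (T U : L) (x y : S).
Hint Resolve s_weight_ge0 s_weight_gt0 s_l2 : core.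

Lemma opcvg_closure (E : set L) (u : nat -> L) T : (forall n, E (u n)) -> opcvg u T -> closure E T.
Proof.
move=> Eu; apply: Lss_closed; first exact: closed_closure.
by move=> n; exact: subset_closure.
Qed.

Section span.
Context (p : nat -> L).
Hypothesis pp : forall j, is_proj (p j).
Hypothesis po : forall i j, i != j -> Lss_mul (p i) (p j) = 0.

(** The algebra generated by the projections, before taking the closure. *)
Definition pspan : set L := [set T | exists n (c : nat -> R[i]), T = \sum_(i < n) c i *: p i].

Lemma pspan_pad n m (c : nat -> R[i]) : (n <= m)%N ->
  \sum_(i < n) c i *: p i = \sum_(i < m) (if (i < n)%N then c i else 0) *: p i.
Proof.
move=> nm; rewrite -(subnKC nm); elim: (m - n)%N => [|d IH].
  by rewrite addn0; apply: eq_bigr => i _; rewrite ltn_ord.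
by rewrite addnS big_ord_recr /= -IH ltnNge leq_addr /= scale0r addr0.
Qed.

Lemma pspan_common T U : pspan T -> pspan U -> exists n (c d : nat -> R[i]),
  T = \sum_(i < n) c i *: p i /\ U = \sum_(i < n) d i *: p i.
Proof.
move=> [n [c ->]] [m [d ->]].
exists (maxn n m), (fun i => if (i < n)%N then c i else 0), (fun i => if (i < m)%N then d i else 0).
by rewrite -!pspan_pad ?leq_maxl ?leq_maxr.
Qed.

Lemma pspan_mulj n (c : nat -> R[i]) j : (j < n)%N ->
  Lss_mul (p j) (\sum_(i < n) c i *: p i) = c j *: p j.
Proof.
move=> jn; rewrite (@Lmul_sumr _ _ n (fun i => c i *: p i)) (bigD1 (Ordinal jn))//= big1.
  by have [pj _] := pp j; rewrite LmulZr pj addr0.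
move=> i ij; rewrite LmulZr po ?scaler0//; apply: contraNN ij => /eqP h.
by apply/eqP/val_inj.
Qed.

Lemma pspan_lin : linear_subspace pspan.
Proof.
split; first by exists 0%N, (fun=> 0); rewrite big_ord0.
move=> a T U hT hU; have [n [c [d [-> ->]]]] := pspan_common hT hU.
exists n, (fun i => a * c i + d i); rewrite scaler_sumr -big_split.
by apply: eq_bigr => i _; rewrite scalerA scalerDl.
Qed.

Lemma pspan_mul T U : pspan T -> pspan U -> pspan (Lss_mul T U) /\ Lss_mul T U = Lss_mul U T.
Proof.
move=> hT hU; have [n [c [d [-> ->]]]] := pspan_common hT hU.
have E (c' d' : nat -> R[i]) : Lss_mul (\sum_(i < n) c' i *: p i) (\sum_(i < n) d' i *: p i) =
    \sum_(i < n) (c' i * d' i) *: p i.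
  rewrite (@Lmul_suml _ _ n (fun i => c' i *: p i)); apply: eq_bigr => i _.
  by rewrite LmulZl pspan_mulj// scalerA.
rewrite !E; split; first by exists n, (fun i => c i * d i).
by apply: eq_bigr => i _; rewrite mulrC.
Qed.

Lemma pspan_adj T : pspan T -> exists2 T', pspan T' & Lss_adjoint T T'.
Proof.
move=> [n [c ->]]; exists (\sum_(i < n) Num.conj (c i) *: p i).
  by exists n, (fun i => Num.conj (c i)).
elim: n => [|n IH]; first by rewrite !big_ord0; exact: Ladj0.
rewrite !big_ord_recr /=; apply: LadjD => //; apply: LadjZ.
by have [] := pp n.
Qed.

Lemma pspan_normal T T' x : pspan T -> pspan T' -> Lss_adjoint T T' ->
  lnorm 0 (app T x) = lnorm 0 (app T' x).
Proof.
move=> ET ET' h; apply/eqP; rewrite -(@eqrXn2 _ 2) ?lnorm_ge0//; apply/eqP.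
rewrite !lnorm0_sqr (Lss_adj _ _ h) (Lss_adj _ _ (adj_sym h)).
by rewrite -!app_mul (pspan_mul ET ET').2.
Qed.

Lemma pspan_balanced T : pspan T -> balanced T.
Proof.
move=> ET k j; have [T' ET' h] := pspan_adj ET.
have /adjointP -> := h; rewrite normc_conj; apply: le_trans (entry_le0 _ _) _.
by rewrite -!app_es (pspan_normal _ ET ET' h).
Qed.

Lemma pspan_adj_hs T T' q : pspan T -> pspan T' -> Lss_adjoint T T' ->
  hs q q T' <= 4 * hs (q.+1 + q.+1) 0 T.
Proof.
move=> ET ET' h; apply: le_trans (balanced_hs q (pspan_balanced ET')) _.
rewrite ler_wpM2l// -[leRHS]mul1r; apply: hs_mono => // k.
by rewrite mul1r -!app_es (pspan_normal _ ET ET' h).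
Qed.

Lemma closure_commute T u v : closure pspan T -> opcvg u v -> (forall n, pspan (u n)) ->
  (forall n, Lss_mul T (u n) = Lss_mul (u n) T) -> Lss_mul T v = Lss_mul v T.
Proof.
move=> cT uv pu h; apply: (opcvg_unique (opcvg_mulr T uv)).
move=> r q e e0; have [n0 hn] := opcvg_mull T uv r q e0; exists n0 => n n0n.
by rewrite h; exact: hn.
Qed.

(** Product and commutation pass to the closure by continuity, one factor at a
    time. Adjunction does because on the span the norms of the adjoint are
    bounded by those of the operator, by normality. *)
Lemma closure_pspan_algebra : closed_commutative_star_subalgebra (closure pspan).
Proof.
have comm1 T U : closure pspan T -> pspan U -> Lss_mul T U = Lss_mul U T.
  move=> /Lss_closureP[u pu uT] pU; apply: (opcvg_unique (opcvg_mull U uT)).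
  move=> r q e e0; have [n0 hn] := opcvg_mulr U uT r q e0; exists n0 => n n0n.
  by rewrite (pspan_mul (pu n) pU).2; exact: hn.
have mul1 T U : closure pspan T -> pspan U -> closure pspan (Lss_mul T U).
  move=> /Lss_closureP[u pu uT] pU.
  by apply: (opcvg_closure _ (opcvg_mull U uT)) => n; have [] := pspan_mul (pu n) pU.
split; last exact: closed_closure.
- split.
  + split; first by apply: subset_closure; have [] := pspan_lin.
    move=> a T U /Lss_closureP[u pu uT] /Lss_closureP[v pv vU].
    by apply: (opcvg_closure _ (opcvg_lin a uT vU)) => n; apply: pspan_lin.2.
  + move=> T U cT /Lss_closureP[v pv vU].
    apply: (Lss_closed (@closed_closure _ pspan) _ (opcvg_mulr T vU)) => n.
    exact: mul1.
  + move=> T /Lss_closureP[u pu uT].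
    have /choice[w hw] : forall n, exists T', pspan T' /\ Lss_adjoint (u n) T'.
      by move=> n; have [T' ? ?] := pspan_adj (pu n); exists T'.
    have [T' wT'] : exists T', opcvg w T'.
      apply: Lss_complete => q e e0; have e40 : 0 < e / 4 / 2 by rewrite !divr_gt0.
      have [n0 h] := uT (q.+1 + q.+1)%N 0%N _ e40; exists n0 => n m n0n n0m.
      have [pn an] := hw n; have [pm am] := hw m.
      apply: le_trans (pspan_adj_hs q (subspaceB pspan_lin (pu n) (pu m)) (subspaceB pspan_lin pn pm) (LadjB an am)) _.
      rewrite mulrC -ler_pdivlMr// (splitr (e / 4)).
      have -> : u n - u m = (u n - T) - (u m - T) by rewrite opprB addrA subrK.
      apply: le_trans (hsD _ _ (u n - T) (- (u m - T))) _; rewrite (hsN _ _ (u m - T)).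
      by apply: lerD; [exact: (h n n0n)|exact: (h m n0m)].
    exists T'; first by apply: (opcvg_closure _ wT') => n; have [] := hw n.
    by apply: (adj_lim _ uT wT') => n; have [] := hw n.
- move=> T U cT /Lss_closureP[v pv vU].
  by apply: (closure_commute cT vU pv) => n; exact: comm1.
Qed.

(** On the span, p_j T is a multiple of p_j; this passes to limits since a
    line is closed, which is seen on one nonvanishing matrix entry. An element
    T annihilated by all p_j has columns orthogonal to those of the span,
    hence to its own columns. *)
Lemma closure_pspan_spectral : (forall j, p j <> 0) -> spectral (closure pspan) p.
Proof.
move=> p0.
have pin j : pspan (p j).
  exists j.+1, (fun i => (i == j)%:R).
  rewrite big_ord_recr /= eqxx scale1r big1 ?add0r// => i _.
  by rewrite (_ : (i == j :> nat) = false) ?scale0r//; apply/negbTE; rewrite neq_ltn ltn_ord.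
split=> //.
- by move=> j; split=> //; exact: subset_closure.
- move=> j T /Lss_closureP[u pu uT].
  have /choice[c hc] : forall n, exists c : R[i], Lss_mul (p j) (u n) = c *: p j.
    move=> n; have [m [c ->]] := pu n.
    exists (if (j < m)%N then c j else 0); rewrite (pspan_pad c (leq_maxl m j.+1)).
    by rewrite (@pspan_mulj _ (fun i => if (i < m)%N then c i else 0))// leq_maxr.
  have [k hk] : exists k, ecol (p j) k <> 0.
    apply: contrapT => h; apply: (p0 j); apply: Lss_ext => k; rewrite ecol0.
    by apply: contrapT => hk; apply: h; exists k.
  have [i hi] : exists i, ecol (p j) k i != 0.
    apply: contrapT => h; apply: hk; apply: lambda2_ext => i; rewrite lambda20.
    by apply/eqP; apply: contrapT => /negP hi; apply: h; exists i.
  have lim := opcvg_mulr (p j) uT.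
  have entry k' i' : ccvg (fun n => c n * ecol (p j) k' i') (ecol (Lss_mul (p j) T) k' i').
    apply: ccvg_eq (opcvg_entry k' i' lim) _ => n.
    by rewrite hc ecolZ lambda2Z.
  pose d := ecol (Lss_mul (p j) T) k i / ecol (p j) k i.
  have cd : ccvg c d.
    have := ccvg_lin (ecol (p j) k i)^-1 (entry k i) (ccvg_cst 0).
    rewrite addr0 mulrC -/d => /ccvg_eq; apply => n.
    by rewrite addr0 mulrC mulfK.
  exists d; apply: Lss_ext => k'; apply: lambda2_ext => i'; rewrite ecolZ lambda2Z.
  apply: (ccvg_unique (entry k' i')).
  have := ccvg_lin (ecol (p j) k' i') cd (ccvg_cst 0).
  by rewrite addr0 mulrC => /ccvg_eq; apply => n; rewrite addr0 mulrC.
- move=> T /Lss_closureP[u pu uT] hT; apply: Lss_ext => k; rewrite ecol0.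
  have z n : l2_dot (ecol (u n) k) (ecol T k) = 0.
    have [m [c ->]] := pu n; rewrite (@ecol_sum _ m (fun i => c i *: p i)).
    elim: m => [|m IH]; first by rewrite big_ord0 sdot0l.
    rewrite (big_ord_recr m (fun i : 'I_m.+1 => ecol (c i *: p i) k)) sdotAl.
    rewrite [X in X + _]IH add0r ecolZ sdotZl -!app_es.
    have [_ am] := pp m; rewrite (Lss_adj _ _ am) -app_mul hT app_es ecol0.
    by rewrite sdot_conj sdot0l rmorph0 mulr0.
  have h := scvg_dot (opcvg_col k uT) (s_l2 (ecol T k)).
  have h0 : l2_dot (ecol T k) (ecol T k) = 0.
    apply: (ccvg_unique h); apply: ccvg_eq (ccvg_cst 0) _ => n; by rewrite z.
  apply: lnorm0_eq0; rewrite -(@ler_pXn2r _ 2) ?nnegrE ?lnorm_ge0//.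
  by rewrite lnorm0_sqr h0 expr0n.
Qed.

End span.

Lemma rank_one_exists (f : S) : exists T : L, forall k, ecol T k = (f k)^* *: f.
Proof.
apply: Lss_of_columns => q; exists (lnorm q f * lnorm q f) => k.
rewrite lnormZ mulrA ler_wpM2r ?lnorm_ge0// mulrC normc_conj; exact: entry_le.
Qed.

(** The operator mapping x to its scalar product with f times f. *)
Definition rank_one (f : S) : L := projT1 (cid (rank_one_exists f)).

Lemma rank_oneE (f : S) k : ecol (rank_one f) k = (f k)^* *: f.
Proof. by rewrite /rank_one; case: cid. Qed.

Lemma rank_one_app (f : S) x : app (rank_one f) x = l2_dot x f *: f.
Proof.
apply: (scvg_unique (app_sum (rank_one f) x)).
have -> : (fun n => \sum_(k < n) x k *: ecol (rank_one f) k) =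
    (fun n => (\sum_(k < n) x k * (f k)^*) *: f).
  apply/funext => n; rewrite scaler_suml; apply: eq_bigr => k _.
  by rewrite rank_oneE scalerA.
move=> q e e0; have [d d0 hd] := eps_lin e0 (lnorm_ge0 q f).
have [n0 h] := dot_ccvg (s_l2 x) (s_l2 f) d0; exists n0 => n n0n.
rewrite -scalerBl lnormZ mulrC -[leLHS]addr0.
exact: hd (normc_ge0 _) (ltW (h n n0n)) (ltW d0).
Qed.

Lemma rank_one_proj (f : S) : l2_dot f f = 1 -> is_proj (rank_one f).
Proof.
move=> f1; split.
  apply: Lss_ext => k; rewrite ecol_mul !rank_oneE appZ rank_one_app f1.
  by rewrite scale1r.
apply/adjointP => k j; rewrite !rank_oneE !lambda2Z rmorphM /= mulrC.
by congr (_ * _); rewrite conjcK.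
Qed.

(** The columns are the conjugate coordinates of f times the unit vector f. *)
Lemma rank_one_hs (f : S) q : l2_dot f f = 1 -> hs q 0 (rank_one f) = lnorm q f.
Proof.
move=> f1; have l1 : lnorm 0 f = 1.
  by apply/eqP; rewrite -(@eqrXn2 _ 2) ?lnorm_ge0// lnorm0_sqr f1 expr1n.
rewrite hsE /lnorm /wnorm /wsum; congr (Num.sqrt (fine _)).
apply: eq_eseriesr => k _; rewrite normc_lnorm rank_oneE lnormZ l1 mulr1.
by rewrite normc_conj.
Qed.

Lemma orthonormal_algebra (f : nat -> S) : orthonormal_seq f ->
  exists E (e : nat -> L), [/\ closed_commutative_star_subalgebra E, spectral E e &
    smatrix e = norm_matrix f].
Proof.
move=> fo; have f1 j : l2_dot (f j) (f j) = 1 by rewrite fo eqxx.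
pose p j := rank_one (f j).
have pp j : is_proj (p j) by exact: rank_one_proj.
have po i j : i != j -> Lss_mul (p i) (p j) = 0.
  move=> ij; apply: Lss_ext => k; rewrite ecol_mul /p rank_oneE appZ rank_one_app.
  by rewrite fo eq_sym (negbTE ij) scale0r scaler0 ecol0.
have p0 j : p j <> 0.
  move=> h; have := rank_one_hs 0 (f1 j); rewrite -/(p j) h hs0 => h0.
  have : l2_dot (f j) (f j) = 0 by rewrite sdotxx -h0 expr0n.
  by rewrite f1 => /eqP; rewrite oner_eq0.
exists (closure (pspan p)), p; split.
- exact: closure_pspan_algebra.
- exact: closure_pspan_spectral.
- by apply/funext => j; apply/funext => q; rewrite /smatrix rank_one_hs.
Qed.

Lemma norm_matrix_mono (f : nat -> S) : kothe_mono (norm_matrix f).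
Proof.
by move=> j q; rewrite /norm_matrix lnorm_ge0 /=; exact: (lnorm_homo (f j) (leqnSn q)).
Qed.

(** The algebras of the two orthonormal sequences have spectral matrices equal
    to the norm matrices. *)
Lemma algebras_orthonormal (X : set S) : linear_subspace X ->
  (forall E F : set L,
      closed_commutative_star_subalgebra E ->
      closed_commutative_star_subalgebra F ->
      frechet_iso E F -> frechet_iso F X ->
      frechet_star_iso E F) ->
  forall f g : nat -> S, orthonormal_seq f -> orthonormal_seq g ->
      frechet_iso [set: lambda2 (norm_matrix f)] [set: lambda2 (norm_matrix g)] ->
      frechet_iso [set: lambda2 (norm_matrix g)] X ->
      exists2 sigma : nat -> nat, bijective sigma &
        kothe_equiv (norm_matrix f) (kothe_perm sigma (norm_matrix g)).
Proof.
move=> hX iso f g fo go [T0 iAB] [T1 iBX].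
have [E [e [cE se eA]]] := orthonormal_algebra fo.
have [F [h [cF sh hB]]] := orthonormal_algebra go.
have [Pe [Ae [ie _ _]]] := spectral_model cE se.
have [Ph [Ah [ih _ _]]] := spectral_model cF sh.
rewrite eA in Pe Ae ie; rewrite hB in Ph Ah ih.
have gA := graded_lambda2 (norm_matrix_mono f); have gB := graded_lambda2 (norm_matrix_mono g).
have gX := graded_s hX; have gE := alg_graded cE; have gF := alg_graded cF.
have hA := lambda2_full (norm_matrix f); have hB' := lambda2_full (norm_matrix g).
have hE := alg_lin cE; have hF := alg_lin cF.
have [U0 i0] := frechet_tame gA gB iAB; have [U1 i1] := frechet_tame gB gX iBX.
have iEF : frechet_iso E F.
  eexists; apply: (tame_frechet gE gF).
  exact: (tame_trans (tame_trans (tame_sym hA hE ie) i0) ih).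
have iFX : frechet_iso F X.
  eexists; apply: (tame_frechet gF gX).
  exact: (tame_trans (tame_sym hB' hF ih) i1).
have [Phi [iPhi PM _]] := iso E F cE cF iEF iFX.
have [Psi PP] := frechet_tame gE gF iPhi.
by have := mult_iso_perm cE cF se sh PP PM; rewrite eA hB.
Qed.

End projection_algebras.

(** * Counting biorthogonal systems in s *)

Section counting.
Context {R : realType}.
Local Notation S := (s_space R).
Implicit Types (q k j n m r : nat) (x y : S).
Hint Resolve s_weight_ge0 s_weight_gt0 s_l2 : core.

(** Vanishing of the first N coordinates improves every norm against the next
    but one by a factor (N+1)^-2. *)
Lemma lnorm_vanish x N r : (forall i, (i < N)%N -> x i = 0) ->
  N.+1%:R ^+ 2 * lnorm r x <= lnorm r.+2 x.
Proof.
move=> hx; have N0 : 0 < N.+1%:R ^+ 2 :> R by rewrite exprn_gt0.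
rewrite mulrC -ler_pdivlMr// mulrC.
have iN : 0 <= (N.+1%:R ^+ 2)^-1 :> R by rewrite invr_ge0 ltW.
have := @wnorm_mono R (fun j => j.+1%:R ^+ r) (fun j => j.+1%:R ^+ r.+2) x x
  (N.+1%:R ^+ 2)^-1 (lambda2_lty r.+2 x) iN; case; last by [].
move=> j; rewrite mulr_ge0 ?normc_ge0 ?exprn_ge0//=.
have [jN|Nj] := ltnP j N; first by rewrite hx// normc0 !mul0r mulr0.
rewrite mulrCA; apply: ler_wpM2l; rewrite ?normc_ge0// mulrC ler_pdivlMr// -(addn2 r) exprD.
by apply: ler_wpM2l; rewrite ?exprn_ge0// lerXn2r ?nnegrE// ler_nat ltnS.
Qed.

(** There are n linear conditions on n+1 coefficients. *)
Lemma combination_vanish n (v : nat -> S) : exists xi : nat -> R[i],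
  (exists2 i, (i < n.+1)%N & xi i != 0) /\
  forall k, (k < n)%N -> (\sum_(i < n.+1) xi i *: v i) k = 0.
Proof.
pose M : 'M[R[i]]_(n.+1, n) := \matrix_(i, k) v i k.
have : kermx M != 0.
  rewrite kermx_eq0 /row_free; apply: contraTneq (rank_leq_col M) => ->.
  by rewrite -ltnNge.
move=> /rowV0Pn[u /sub_kermxP uM u0].
exists (fun i => u 0 (inord i)); split.
  have [i ui] : exists i, u 0 i != 0.
    apply: contrapT => h; move/eqP : u0; apply; apply/rowP => i; rewrite mxE.
    by apply/eqP; apply: contrapT => /negP hi; apply: h; exists i.
  by exists i; rewrite ?ltn_ord// inord_val.
move=> k kn; move/rowP/(_ (Ordinal kn)) : uM; rewrite !mxE => h; apply: etrans h.
rewrite lambda2_sum; apply: eq_bigr => i _.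
by rewrite lambda2Z mxE inord_val.
Qed.

Lemma sum_leq_index (F : nat -> R) n : exists i0, (i0 < n.+1)%N /\
  (forall i, (i < n.+1)%N -> F i <= F i0).
Proof.
elim: n => [|n [i0 [hi h]]]; first by exists 0%N; split=> // -[|i].
have [le|/ltW le] := leP (F n.+1) (F i0).
  exists i0; split=> [|i]; first exact: ltnW.
  by rewrite ltnS leq_eqVlt => /predU1P[->//|]; exact: h.
exists n.+1; split=> // i; rewrite ltnS leq_eqVlt => /predU1P[->//|/h].
by move=> /le_trans; apply.
Qed.

Section biorthogonal.
Context (X : set S) (v : nat -> S) (t : nat -> S -> R[i]) (w : nat -> R) (C : R) (r : nat).
Hypothesis C0 : 0 <= C.
Hypotheses (hX : linear_subspace X) (Xv : forall j, X (v j)).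
Hypothesis tlin : forall j a x y, X x -> X y -> t j (a *: x + y) = a * t j x + t j y.
Hypothesis tv : forall j k, t j (v k) = (j == k)%:R.
Hypothesis tb : forall j y, X y -> normc (t j y) * w j <= C * lnorm r y.

Lemma biorthogonal0 j : t j 0 = 0.
Proof.
have [X0 _] := hX; have := tlin j 1 X0 X0; rewrite scale1r addr0 mul1r => h.
by apply/(addrI (t j 0)); rewrite -h addr0.
Qed.

Lemma biorthogonal_sum j n (xi : nat -> R[i]) (s : nat -> nat) :
  t j (\sum_(i < n) xi i *: v (s i)) = \sum_(i < n) xi i * (j == s i)%:R.
Proof.
elim: n => [|n IH]; first by rewrite !big_ord0 biorthogonal0.
have Xs : X (\sum_(i < n) xi i *: v (s i)).
  by apply: subspace_sum => // i _; exact: subspaceZ.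
by rewrite !big_ord_recr/= addrC tlin// IH tv addrC.
Qed.

Lemma biorthogonal_gt0 j q : 0 < lnorm q (v j).
Proof.
rewrite lt_def lnorm_ge0 andbT; apply/negP => /eqP h.
have v0 : v j = 0.
  by apply: lnorm0_eq0; apply: le_trans (lnorm_homo (v j) (leq0n q)) _; rewrite h.
by have /eqP := tv j j; rewrite v0 biorthogonal0 eqxx eq_sym oner_eq0.
Qed.

(** Some nonzero combination of any n+1 of the v_j has its first n coordinates
    equal to 0, so its norm of order r is smaller than the one of order r+2 by
    the factor (n+1)^-2. The sum over n+1 terms only costs a factor n+1.
    Comparing with the coefficient for which |xi_j| |v_j| is largest leaves a
    gain n+1. *)
Lemma biorthogonal_small (s : seq nat) n : uniq s -> size s = n.+1 ->
  exists2 j, j \in s & n.+1%:R * w j <= C * lnorm r.+2 (v j).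
Proof.
move=> us ss; pose sg i := nth 0%N s i.
(* The combination kills the first n coordinates; i0 below is the index of its
   dominant term. *)
have [xi [[i1 i1n xi1] hx]] := combination_vanish n (fun i => v (sg i)).
have [i0 [i0n hi]] := sum_leq_index (fun i => normc (xi i) * lnorm r.+2 (v (sg i))) n.
exists (sg i0); first by rewrite mem_nth// ss.
pose x : S := \sum_(i < n.+1) xi i *: v (sg i).
have Xx : X x by apply: subspace_sum => // i _; exact: subspaceZ.
have M0 : 0 < normc (xi i0) * lnorm r.+2 (v (sg i0)).
  apply: lt_le_trans (hi _ i1n); rewrite mulr_gt0 ?biorthogonal_gt0//.
  by rewrite lt_def normc_ge0 andbT; apply: contraNneq xi1 => /eq0_normc ->.
have xi0 : 0 < normc (xi i0) by move: M0; rewrite pmulr_lgt0 ?biorthogonal_gt0.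
have tx : t (sg i0) x = xi i0.
  rewrite biorthogonal_sum (bigD1 (Ordinal i0n))//= eqxx mulr1 big1 ?addr0// => i ii0.
  rewrite /sg nth_uniq ?ss ?ltn_ord// eq_sym (_ : (i == i0 :> nat) = false) ?mulr0//.
  by apply: contraNF ii0 => /eqP h; apply/eqP/val_inj.
have := tb (sg i0) Xx; rewrite tx => hb.
have h1 : lnorm r.+2 x <= n.+1%:R * (normc (xi i0) * lnorm r.+2 (v (sg i0))).
  apply: le_trans (lnorm_sum _ _ _ _) _.
  rewrite mulr_natl -[n.+1 in leRHS]card_ord -sumr_const; apply: ler_sum => i _.
  by rewrite lnormZ; exact: hi.
have h2 := lnorm_vanish r hx.
have n0 : 0 < n.+1%:R :> R by [].
move: h1 h2 hb; rewrite -/x; move: (lnorm r.+2 x) (lnorm r x) => a b h1 h2 hb.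
have h3 : n.+1%:R * b <= normc (xi i0) * lnorm r.+2 (v (sg i0)).
  by rewrite -(ler_pM2l n0) mulrA -expr2; apply: le_trans h2 h1.
rewrite -(ler_pM2l xi0) mulrCA.
apply: (@le_trans _ _ (n.+1%:R * (C * b))); first by rewrite ler_pM2l.
by rewrite mulrCA (mulrCA _ C) ler_wpM2l.
Qed.

Hypothesis w0 : forall j, 0 <= w j.

(** Repeatedly removing an index with smallest quotient, the k-th smallest
    quotient is at most C/(k+1). *)
Lemma biorthogonal_square_sum n :
  \sum_(j < n) (w j / lnorm r.+2 (v j)) ^+ 2 <= 2 * C ^+ 2.
Proof.
have key m (s : seq nat) : uniq s -> size s = m ->
    \sum_(j <- s) (w j / lnorm r.+2 (v j)) ^+ 2 <= C ^+ 2 * \sum_(k < m) k.+1%:R ^- 2.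
  elim: m s => [|m IH] s us; first by move/size0nil ->; rewrite big_nil big_ord0 mulr0.
  move=> ss; have [j js hj] := biorthogonal_small us ss.
  have u0 := biorthogonal_gt0 j r.+2.
  rewrite (perm_big _ (perm_to_rem js)) big_cons big_ord_recr/= mulrDr addrC.
  apply: lerD; first by apply: IH; rewrite ?rem_uniq// size_rem// ss.
  rewrite -exprVn -exprMn lerXn2r ?nnegrE ?mulr_ge0 ?invr_ge0 ?w0 ?(ltW u0)//.
  by rewrite ler_pdivrMr// mulrAC ler_pdivlMr// mulrC.
have := key _ (index_iota 0 n) (iota_uniq _ _) (size_iota _ _).
rewrite big_mkord => /le_trans; apply.
by rewrite mulrC ler_wpM2r ?sqr_ge0 ?sum_inv_sqr.
Qed.

End biorthogonal.
End counting.

(** * Growth of the matrices of subspaces of s *)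

Section kothe_bounds.
Context {R : realType}.
Local Notation S := (s_space R).
Implicit Types (q k j n m r : nat) (x y : S) (A B : nat -> nat -> R).
Hint Resolve s_weight_ge0 s_weight_gt0 s_l2 : core.

(** Cauchy-Schwarz. This is the property which all subspaces of s inherit. *)
Lemma lnorm_interpolation x q : lnorm q x ^+ 2 <= lnorm 0 x * lnorm (q + q) x.
Proof.
have h0 : 0 <= lnorm 0 x * lnorm (q + q) x by rewrite mulr_ge0 ?lnorm_ge0.
rewrite -[leRHS]sqr_sqrtr// lerXn2r ?nnegrE ?lnorm_ge0 ?sqrtr_ge0//.
apply: (wnorm_leP (lambda2_lty q x) (sqrtr_ge0 _)).2 => n; rewrite sqr_sqrtr//.
have h1 : \sum_(k < n) normc (x k) ^+ 2 <= lnorm 0 x ^+ 2.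
  apply: le_trans (wpsum_le_wnorm n (lambda2_lty 0 x)); rewrite /wpsum.
  by under [leRHS]eq_bigr do rewrite expr0 mulr1.
have h2 := wpsum_le_wnorm n (lambda2_lty (q + q) x).
have := @fin_CS R n (fun k => normc (x k)) (fun k => normc (x k) * k.+1%:R ^+ (q + q))
  (lnorm 0 x) (lnorm (q + q) x) (lnorm_ge0 _ _) (lnorm_ge0 _ _) h1 h2.
apply: le_trans; apply: ler_sum => k _.
by rewrite exprMn -exprM muln2 -addnn mulrA expr2.
Qed.

Lemma kothe_matrix_mono A : kothe_matrix A -> kothe_mono A.
Proof. by move=> [h0 _ h1] j q; rewrite h0 h1. Qed.

Lemma kothe_equiv_sym A B : kothe_equiv A B -> kothe_equiv B A.
Proof. by case. Qed.

Lemma kothe_prec_trans A B (C : nat -> nat -> R) : kothe_prec A B -> kothe_prec B C -> kothe_prec A C.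
Proof.
move=> AB BC q; have [r [c c0 hc]] := AB q; have [p [d d0 hd]] := BC r.
exists p, (c * d) => [|j]; first exact: mulr_gt0.
by rewrite -mulrA; apply: le_trans (hc j) _; rewrite ler_wpM2l// ltW.
Qed.

Lemma kothe_equiv_trans A B (C : nat -> nat -> R) : kothe_equiv A B -> kothe_equiv B C -> kothe_equiv A C.
Proof.
by move=> [AB BA] [BC CB]; split; [exact: kothe_prec_trans AB BC|exact: kothe_prec_trans CB BA].
Qed.

Lemma kothe_equiv_perm A B sigma : kothe_equiv A B ->
  kothe_equiv (kothe_perm sigma A) (kothe_perm sigma B).
Proof.
move=> [AB BA]; split=> q.
  by have [r [c c0 h]] := AB q; exists r, c => // j; exact: h.
by have [r [c c0 h]] := BA q; exists r, c => // j; exact: h.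
Qed.

Section embedded.
Context (A : nat -> nat -> R) (X : set S) (T : lambda2 A -> S) (U : S -> lambda2 A).
Hypotheses (KA : kothe_matrix A) (AA : kothe_equiv A (kothe_sqr A)) (hX : linear_subspace X).
Hypothesis TU : tame_iso [set: lambda2 A] (fun q => @lnorm R A q) X (fun q => @lnorm R _ q) T U.

Lemma tame_ldelta_gt0 j q : 0 < lnorm q (T (ldelta A j)).
Proof.
have [Tl TX UX Tb Ub] := TU.
rewrite lt_def lnorm_ge0 andbT; apply/negP => /eqP h.
have v0 : T (ldelta A j) = 0.
  by apply: lnorm0_eq0; apply: le_trans (lnorm_homo (T (ldelta A j)) (leq0n q)) _; rewrite h.
have [_ Uv] := TX (ldelta A j) I.
have Ul := inv_lin (lambda2_full A) hX TU.
have : ldelta A j j = 0 by rewrite -Uv v0 (lin_on0 hX Ul) lambda20.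
by move/eqP; rewrite /= /delta eqxx oner_eq0.
Qed.

(** Interpolation gives a_q^2 <= C a_p a_r for one fixed p, and two
    applications of the domination of A by its square give a_p <= C a_q^4.
    Together 1 <= C a_q^2 a_r. *)
Lemma kothe_bounded_below : exists p c, 0 < c /\ forall j, c <= A j p.
Proof.
have Am := kothe_matrix_mono KA; have [A0 _ _] := KA.
have [Tl TX UX Tb Ub] := TU; have [A_le_sqr sqr_le_A] := AA.
have [p [C [C0 hC]]] := Tb 0%N.
have Ap j : 0 < A j p.
  have : 0 < C * lnorm p (ldelta A j).
    exact: lt_le_trans (tame_ldelta_gt0 j 0) (hC _ I).
  by rewrite lnorm_ldelta//; have := A0 j p; nra.
have [p1 [c1 c10 h1]] := A_le_sqr p; have [q [c2 c20 h2]] := A_le_sqr p1.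
have [q' [c3 [c30 h3]]] := Ub q; have [r [c4 [c40 h4]]] := Tb (q' + q')%N.
(* The exponent 3 collects a_q^2 a_r under the larger index. *)
have key j : 1 <= c3 ^+ 2 * C * c4 * c1 * c2 ^+ 2 * (A j (maxn q r)) ^+ 3.
  have b4 : A j p <= c1 * (c2 * A j q ^+ 2) ^+ 2.
    apply: le_trans (h1 j) _; rewrite ler_wpM2l ?(ltW c10)// lerXn2r ?nnegrE ?A0//.
    by rewrite mulr_ge0 ?sqr_ge0// ltW.
  have q0 : 0 < A j q.
    rewrite lt_def A0 andbT; apply/negP => /eqP h.
    by have := Ap j; move: b4; rewrite h; nra.
  have b3 : A j q ^+ 2 <= c3 ^+ 2 * ((C * A j p) * (c4 * A j r)).
    have [_ Uv] := TX (ldelta A j) I.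
    have := h3 (T (ldelta A j)) (TX (ldelta A j) I).1; rewrite Uv lnorm_ldelta// => b.
    apply: (@le_trans _ _ ((c3 * lnorm q' (T (ldelta A j))) ^+ 2)).
      by rewrite lerXn2r ?nnegrE ?A0 ?mulr_ge0 ?lnorm_ge0.
    rewrite exprMn ler_wpM2l ?sqr_ge0//; apply: le_trans (lnorm_interpolation _ _) _.
    have := hC (ldelta A j) I; have := h4 (ldelta A j) I; rewrite !lnorm_ldelta// => e1 e2.
    by apply: ler_pM; rewrite ?lnorm_ge0.
  have hq : A j q <= A j (maxn q r) by exact: (kothe_mono_homo j Am (leq_maxl q r)).
  have hr : A j r <= A j (maxn q r) by exact: (kothe_mono_homo j Am (leq_maxr q r)).
  have r0 := A0 j r; move: hq hr b3 b4 q0 r0 (Ap j).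
  move: (A j q) (A j r) (A j p) (A j (maxn q r)) => a b d M hq hr b3 b4 q0 r0 d0.
  have a2 : 0 < a ^+ 2 by rewrite exprn_gt0.
  rewrite -(ler_pM2l a2) mulr1; apply: (le_trans b3).
  apply: (@le_trans _ _ (c3 ^+ 2 * (C * (c1 * (c2 * a ^+ 2) ^+ 2) * (c4 * M)))).
    apply: ler_wpM2l; first exact: sqr_ge0.
    by apply: ler_pM; rewrite ?mulr_ge0 ?(ltW d0)//; apply: ler_wpM2l.
  have -> : c3 ^+ 2 * (C * (c1 * (c2 * a ^+ 2) ^+ 2) * (c4 * M)) =
     (c3 ^+ 2 * C * c4 * c1 * c2 ^+ 2 * M * a ^+ 2) * a ^+ 2 by ring.
  have -> : a ^+ 2 * (c3 ^+ 2 * C * c4 * c1 * c2 ^+ 2 * M ^+ 3) =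
     (c3 ^+ 2 * C * c4 * c1 * c2 ^+ 2 * M * M ^+ 2) * a ^+ 2 by ring.
  apply: ler_wpM2r; first exact: ltW.
  have M0 : 0 <= M by apply: le_trans hq; exact: ltW.
  apply: ler_wpM2l; last by rewrite lerXn2r ?nnegrE// ltW.
  by rewrite !mulr_ge0 ?sqr_ge0// ltW.
move: key; set K := _ * c2 ^+ 2 => key.
have K0 : 0 <= K by rewrite /K !mulr_ge0 ?sqr_ge0// ltW.
exists (maxn q r), (K + 1)^-1; split; first by rewrite invr_gt0; lra.
move=> j; have := key j; have := A0 j (maxn q r); move: (A j _) => a a0 h.
have K1 : 0 < K + 1 by lra.
rewrite -[leLHS]mul1r ler_pdivrMr//.
(* For a < 1 the cube is at most a. *)
have [a1|a1] := leP 1 a; first by nra.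
have : a ^+ 3 <= a by rewrite exprS -[leRHS]mulr1 ler_wpM2l// expr2; nra.
by nra.
Qed.

(** The count of biorthogonal systems, applied to the images of the unit
    vectors with the column of A that is bounded below as weights. *)
Lemma kothe_inverse_square_summable : exists s K, 0 <= K /\
  (forall j, 0 < A j s) /\ forall n, \sum_(j < n) (A j s) ^- 2 <= K.
Proof.
have Am := kothe_matrix_mono KA; have [A0 _ _] := KA.
have [p [c [c0 hp]]] := kothe_bounded_below.
have [Tl TX UX Tb Ub] := TU.
have [r [C [C0 hC]]] := Ub p; have [s [D [D0 hD]]] := Tb r.+2.
pose s' := maxn s p.
have As j : c <= A j s' by apply: le_trans (hp j) _; exact: (kothe_mono_homo j Am (leq_maxr s p)).
have Ul := inv_lin (lambda2_full A) hX TU.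
have hsum := @biorthogonal_square_sum R X (fun j => T (ldelta A j)) (fun j y => U y j)
  (fun j => A j p) C r C0 hX (fun j => (TX (ldelta A j) I).1).
have {}hsum n : \sum_(j < n) (A j p / lnorm r.+2 (T (ldelta A j))) ^+ 2 <= 2 * C ^+ 2.
  apply: hsum => [j a x y Xx Xy|j k|j y Xy|j]; last exact: A0.
  - by rewrite Ul// lambda2D lambda2Z.
  - by have [_ ->] := TX (ldelta A k) I.
  - by apply: le_trans (hC y Xy); exact: (normc_le_wnorm j (lambda2_lty p (U y))).
pose E := (D + 1) / c; have E0 : 0 < E by rewrite divr_gt0//; lra.
exists s', (E ^+ 2 * (2 * C ^+ 2)); split; first by apply: mulr_ge0; [exact: sqr_ge0|apply: mulr_ge0 => //; exact: sqr_ge0].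
split=> [j|n]; first exact: lt_le_trans c0 (As j).
apply: (@le_trans _ _ (E ^+ 2 * \sum_(j < n) (A j p / lnorm r.+2 (T (ldelta A j))) ^+ 2)); last first.
  by apply: ler_wpM2l; [exact: sqr_ge0|exact: hsum].
rewrite mulr_sumr; apply: ler_sum => j _.
have a0 : 0 < A j s' by exact: lt_le_trans c0 (As j).
have u0 := tame_ldelta_gt0 j r.+2.
have uD : lnorm r.+2 (T (ldelta A j)) <= (D + 1) * A j s'.
  have := hD (ldelta A j) I; rewrite lnorm_ldelta// => /le_trans; apply.
  have := kothe_mono_homo j Am (leq_maxl s p : (s <= s')%N); have := A0 j s.
  by move: (A j s) (A j s') => e1 e2; nra.
have key : (A j s')^-1 <= E * (A j p / lnorm r.+2 (T (ldelta A j))).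
  rewrite mulrA ler_pdivlMr// mulrC ler_pdivrMr//; apply: le_trans uD _.
  rewrite ler_wpM2r ?(ltW a0)// /E mulrAC ler_pdivlMr//.
  by apply: ler_wpM2l; [lra|exact: hp].
have i0 : 0 <= (A j s')^-1 by rewrite invr_ge0 ltW.
by rewrite -exprVn -exprMn lerXn2r ?nnegrE//; exact: le_trans key.
Qed.

End embedded.
End kothe_bounds.

(** * Disjoint blocks of indices *)

Section blocks.
Context {R : realType}.
Implicit Types (q k j n m r : nat).

(** A pairing of polynomial growth, so that codes of quantities dominated by
    the matrix are dominated as well. *)
Definition pair_code (x y : nat) : nat := ((x + y) ^ 2 + x)%N.

Lemma pair_code_inj x y x' y' : pair_code x y = pair_code x' y' -> x = x' /\ y = y'.
Proof.
have lt a b c d : (c <= a)%N -> (a < b)%N -> (a ^ 2 + c < b ^ 2 + d)%N.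
  move=> ca ab; apply: leq_trans (leq_addr d (b ^ 2)).
  apply: (@leq_trans (a.+1 ^ 2)); last by rewrite leq_exp2r.
  by rewrite -!mulnn; nia.
rewrite /pair_code => h.
have hs : (x + y)%N = (x' + y')%N.
  have [l|l|//] := ltngtP (x + y)%N (x' + y')%N.
    by have := lt _ _ _ x' (leq_addr y x) l; rewrite h ltnn.
  by have := lt _ _ _ x (leq_addr y' x') l; rewrite h ltnn.
by move: h; rewrite hs => /eqP; rewrite eqn_add2l => /eqP hx; split=> //; lia.
Qed.

Lemma pair_code_ger x y : (y <= pair_code x y)%N.
Proof. rewrite /pair_code; nia. Qed.

Section coded.
Context (A : nat -> nat -> R).
Hypotheses (A0 : forall j q, 0 <= A j q) (Am : kothe_mono A) (AA : kothe_prec (kothe_sqr A) A).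
Context (s : nat) (K : R).
Hypotheses (K0 : 0 <= K) (As : forall j, 0 < A j s)
  (AK : forall n, \sum_(j < n) (A j s) ^- 2 <= K).

(** Functions of the row index bounded by a column of the matrix. Since the
    squares of the entries are dominated, this class is closed under sums,
    products and hence polynomials. *)
Definition dominated (F : nat -> R) : Prop :=
  exists r c, 0 < c /\ forall j, F j <= c * A j r.

Lemma dominated_le F G : (forall j, F j <= G j) -> dominated G -> dominated F.
Proof.
by move=> FG [r [c [c0 h]]]; exists r, c; split=> // j; exact: le_trans (FG j) (h j).
Qed.

Lemma dominated_A k : dominated (fun j => A j k).
Proof. by exists k, 1; split=> // j; rewrite mul1r. Qed.

(** The summability bound keeps the column s away from 0. *)
Lemma dominated_cst b : dominated (fun=> b).
Proof.
exists s, (`|b| * (K + 1) + 1); split.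
  by rewrite ltr_wpDl// mulr_ge0// addr_ge0.
move=> j; have a0 := As j.
have h : (A j s) ^- 2 <= K.
  apply: le_trans (AK j.+1); rewrite big_ord_recr/= lerDr.
  by apply: sumr_ge0 => i _; rewrite invr_ge0 sqr_ge0.
have {}h : 1 <= K * A j s ^+ 2 by rewrite -ler_pdivrMr ?exprn_gt0// mul1r.
have h1 : 1 <= (K + 1) * A j s.
  move: (A j s) a0 h => a a0 h; have [a1|a1] := leP 1 a; nra.
apply: le_trans (ler_norm b) _; rewrite mulrDl mul1r -mulrA.
apply: (@le_trans _ _ (`|b| * ((K + 1) * A j s))); last by rewrite lerDl ltW.
by rewrite ler_peMr.
Qed.

Lemma dominatedD F G : dominated F -> dominated G -> dominated (fun j => F j + G j).
Proof.
move=> [r [c [c0 h]]] [r' [c' [c'0 h']]]; exists (maxn r r'), (c + c'); split.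
  exact: addr_gt0.
move=> j; rewrite mulrDl; apply: lerD.
  by apply: le_trans (h j) _; apply: ler_wpM2l; [exact: ltW|exact: (kothe_mono_homo j Am (leq_maxl r r'))].
by apply: le_trans (h' j) _; apply: ler_wpM2l; [exact: ltW|exact: (kothe_mono_homo j Am (leq_maxr r r'))].
Qed.

Lemma dominatedM F G : (forall j, 0 <= F j) -> (forall j, 0 <= G j) ->
  dominated F -> dominated G -> dominated (fun j => F j * G j).
Proof.
move=> F0 G0 [r [c [c0 h]]] [r' [c' [c'0 h']]].
have [p [d d0 hd]] := AA (maxn r r'); exists p, (c * c' * d); split; first by rewrite !mulr_gt0.
move=> j; apply: (@le_trans _ _ ((c * A j (maxn r r')) * (c' * A j (maxn r r')))).
  apply: ler_pM => //.
    by apply: le_trans (h j) _; apply: ler_wpM2l; [exact: ltW|exact: (kothe_mono_homo j Am (leq_maxl r r'))].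
  by apply: le_trans (h' j) _; apply: ler_wpM2l; [exact: ltW|exact: (kothe_mono_homo j Am (leq_maxr r r'))].
rewrite mulrACA -expr2 -[leRHS]mulrA; apply: ler_wpM2l; first by rewrite mulr_ge0// ltW.
exact: hd.
Qed.

Lemma dominatedX F n : (forall j, 0 <= F j) -> dominated F -> dominated (fun j => F j ^+ n).
Proof.
move=> F0 hF; elim: n => [|n IH].
  by apply: dominated_le (dominated_cst 1) => j; rewrite expr0.
apply: dominated_le (dominatedM F0 _ hF IH) => [j|j]; first by rewrite exprS.
exact: exprn_ge0.
Qed.

Lemma dominated_sum n (F : nat -> nat -> R) : (forall k, dominated (F k)) ->
  dominated (fun j => \sum_(k < n) F k j).
Proof.
move=> hF; elim: n => [|n IH].
  by apply: dominated_le (dominated_cst 0) => j; rewrite big_ord0.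
by apply: dominated_le (dominatedD IH (hF n)) => j; rewrite big_ord_recr.
Qed.

Lemma dominated_code (F G : nat -> nat) : dominated (fun j => (F j)%:R) ->
  dominated (fun j => (G j)%:R) -> dominated (fun j => (pair_code (F j) (G j))%:R).
Proof.
move=> hF hG; have hs := dominatedX 2 (fun j => _) (dominatedD hF hG).
apply: dominated_le (dominatedD (hs _) hF) => j; last by rewrite addr_ge0.
by rewrite /pair_code natrD natrX natrD.
Qed.

Definition level j k : nat := (Num.truncn (A j k)).+1.

Lemma le_level j k : A j k <= (level j k)%:R.
Proof. by apply: ltW; exact: truncnS_gt. Qed.

Lemma dominated_level k : dominated (fun j => (level j k)%:R).
Proof.
apply: dominated_le (dominatedD (dominated_A k) (dominated_cst 1)) => j.
by rewrite /level -natr1 lerD2r truncn_le.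
Qed.

(** The index j itself is not bounded in terms of the entries of the row j,
    but its position among the rows of equal level is, by summability;
    together with the level it determines j. *)
Definition level_rank j : nat := \sum_(i < j) (level i s == level j s).

Lemma level_rank_lt i j : (i < j)%N -> level i s = level j s -> (level_rank i < level_rank j)%N.
Proof.
move=> ij e; rewrite /level_rank -e.
have key d : (\sum_(k < i) (level k s == level i s) <
    \sum_(k < i.+1 + d) (level k s == level i s))%N.
  elim: d => [|d IH]; first by rewrite addn0 big_ord_recr/= eqxx addn1 ltnS.
  by rewrite addnS big_ord_recr/= (leq_trans IH)// leq_addr.
by have := key (j - i.+1)%N; rewrite subnKC.
Qed.

(** Each row of the same level t contributes at least t^-2 to the convergent
    sum, so there are at most K t^2 of them. *)
Lemma dominated_rank : dominated (fun j => (level_rank j)%:R).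
Proof.
have h := dominatedX 2 (fun j => ler0n _ (level j s)) (dominated_level s).
apply: dominated_le (dominatedM _ _ (dominated_cst K) h) => [j|//|j]; last exact: sqr_ge0.
have l0 : 0 < (level j s)%:R ^+ 2 :> R by rewrite exprn_gt0.
rewrite -ler_pdivrMr//; apply: le_trans (AK j).
rewrite /level_rank natr_sum mulr_suml; apply: ler_sum => i _.
have [e|_] := eqVneq (level i s) (level j s); last by rewrite mul0r invr_ge0 sqr_ge0.
rewrite mul1r lef_pV2 ?posrE ?exprn_gt0//.
by rewrite lerXn2r ?nnegrE// -e le_level.
Qed.

(** The place of the unit vector that represents the entry (j,k): these are
    distinct, at least as large as the entry, and bounded by a polynomial in
    the entries of the row j. *)
Definition block j k : nat :=
  pair_code (pair_code (level j s) (level_rank j)) (pair_code k (level j k)).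

Lemma block_inj j k j' k' : block j k = block j' k' -> j = j' /\ k = k'.
Proof.
move=> /pair_code_inj[/pair_code_inj[hl hr] /pair_code_inj[-> _]]; split=> //.
have [lt|lt|//] := ltngtP j j'.
  by have := level_rank_lt lt hl; rewrite hr ltnn.
by have := level_rank_lt lt (esym hl); rewrite hr ltnn.
Qed.

Lemma le_block j k : A j k <= (block j k)%:R.
Proof.
apply: le_trans (le_level j k) _; rewrite ler_nat /block.
exact: leq_trans (pair_code_ger k (level j k)) (pair_code_ger _ _).
Qed.

Lemma dominated_block k : dominated (fun j => (block j k)%:R).
Proof.
apply: dominated_code; apply: dominated_code.
- exact: dominated_level.
- exact: dominated_rank.
- exact: dominated_cst.
- exact: dominated_level.
Qed.

End coded.
End blocks.

(** * Sequences with disjoint supports *)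

Section disjoint_supports.
Context {R : realType}.
Local Notation S := (s_space R).
Implicit Types (q k j n r i : nat) (x y : S).
Hint Resolve s_weight_ge0 s_weight_gt0 s_l2 : core.

Lemma s_closureP (E : set S) y : closure E y ->
  exists2 u : nat -> S, forall n, E (u n) & scvg u y.
Proof.
move=> cy.
have /choice[u uP] : forall n : nat, exists x : S, E x /\ lnorm n (x - y) < n.+1%:R^-1.
  move=> n; have : nbhs y [set x : S | lnorm n (x - y) < n.+1%:R^-1].
    by apply/s_nbhsP; exists n, (n.+1%:R^-1).
  by move=> /cy[x []]; exists x.
exists u => [n|q e e0]; first by have [] := uP n.
pose m := Num.bound e^-1; exists (maxn q m) => n.
rewrite geq_max => /andP[qn mn].
apply: le_trans (lnorm_homo (u n - y) qn) _; have [_ /ltW h] := uP n.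
apply: le_trans h _; rewrite -[leRHS]invrK lef_pV2 ?posrE ?invr_gt0//.
apply: le_trans (_ : m%:R <= _); last by rewrite ler_nat; exact: leqW.
by apply/ltW/archi_boundP; rewrite invr_ge0 ltW.
Qed.

(** Every element of the closed span is, on the support of each f_j, a
    multiple of f_j, and vanishes outside the supports; partial sums of its
    expansion are restrictions of it to unions of supports, which converge. *)
Lemma disjoint_basic (f : nat -> S) :
  (forall i j j', f j i != 0 -> f j' i != 0 -> j = j') -> (forall j, exists i, f j i != 0) ->
  basic_sequence f.
Proof.
move=> fd /choice[p fp].
split=> [j|y cy].
  apply: subset_closure; exists 1%N, (fun=> 1), (fun=> f j); split; first by move=> _; exists j.
  by rewrite big_ord1 scale1r.
have serE (t : nat -> R[i]) : series (fun j => t j *: f j) = (fun n => \sum_(j < n) t j *: f j).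
  by apply/funext => n; rewrite /series /= big_mkord.
have partial (t : nat -> R[i]) n j i : f j i != 0 ->
    (\sum_(j < n) t j *: f j) i = if (j < n)%N then t j * f j i else 0.
  move=> fji; rewrite lambda2_sum; have z (k : 'I_n) : k != j :> nat -> (t k *: f k) i = 0.
    move=> kj; rewrite lambda2Z; have [->|h] := eqVneq (f k i) 0; first by rewrite mulr0.
    by move: kj; rewrite (fd _ _ _ h fji) eqxx.
  case: ifP => [jn|jn].
    by rewrite (bigD1 (Ordinal jn))//= big1 ?addr0 ?lambda2Z// => k kj; apply: z.
  rewrite big1// => k _; apply: z; apply: contraFN jn => /eqP <-; exact: ltn_ord.
have partial0 (t : nat -> R[i]) n i : (forall j, f j i = 0) -> (\sum_(j < n) t j *: f j) i = 0.
  by move=> h; rewrite lambda2_sum big1// => k _; rewrite lambda2Z h mulr0.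
have [u Eu uy] := s_closureP cy.
(* Written without division, as an identity that is preserved by
   coordinatewise limits. *)
have span x : lin_span (range f) x ->
    (forall i, (forall j, f j i = 0) -> x i = 0) /\
    forall j i, f j i != 0 -> x i * f j (p j) = x (p j) * f j i.
  move=> [n [a [v [hv ->]]]]; split=> [i h|j i fji].
    by rewrite lambda2_sum big1// => k _; have [j _ <-] := hv k; rewrite lambda2Z h mulr0.
  rewrite !lambda2_sum !mulr_suml; apply: eq_bigr => k _.
  have [l _ <-] := hv k; rewrite !lambda2Z.
  have [->|h] := eqVneq l j; first by rewrite mulrAC.
  have z i' : f j i' != 0 -> f l i' = 0.
    move=> h1; apply/eqP; apply: contrapT => /negP h2.
    by move: h; rewrite (fd _ _ _ h2 h1) eqxx.
  by rewrite !z// !mulr0 !mul0r.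
have y0 i : (forall j, f j i = 0) -> y i = 0.
  move=> h; apply: (ccvg_unique (scvg_ccvg i uy)); apply: ccvg_eq (ccvg_cst 0) _ => n.
  by rewrite (span _ (Eu n)).1.
have yp j i : f j i != 0 -> y i = y (p j) / f j (p j) * f j i.
  move=> h; apply: (mulIf (fp j)); rewrite mulrAC divfK ?fp//.
  apply: (@ccvg_unique _ (fun n => u n i * f j (p j))).
    have := ccvg_lin (f j (p j)) (scvg_ccvg i uy) (ccvg_cst 0).
    by rewrite addr0 mulrC => /ccvg_eq; apply => n; rewrite addr0 mulrC.
  have := ccvg_lin (f j i) (scvg_ccvg (p j) uy) (ccvg_cst 0).
  rewrite addr0 mulrC => /ccvg_eq; apply => n; rewrite addr0 mulrC.
  by rewrite (span _ (Eu n)).2.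
pose t j := y (p j) / f j (p j).
exists t; split.
  rewrite serE; apply/scvgP => q e e0.
  (* Once the supports meeting the first N coordinates are exhausted, the
     remainder vanishes there and lnorm_vanish applies. *)
  pose N := Num.bound (lnorm q.+2 y / e).
  have /choice[w hw] : forall i : nat, exists j : nat, (exists j', f j' i != 0) -> f j i != 0.
    by move=> i; have [[j h]|h] := pselect (exists j', f j' i != 0); [exists j|exists 0%N].
  exists (\max_(i < N) w i).+1 => n hn.
  have xz i : (i < N)%N -> (\sum_(j < n) t j *: f j - y) i = 0.
    move=> iN; rewrite lambda2B.
    have [hx|hx] := pselect (exists j', f j' i != 0); last first.
      have z j : f j i = 0 by apply/eqP; apply: contrapT => /negP h; apply: hx; exists j.
      by rewrite (partial0 t n i z) y0// subrr.
    have fo := hw i hx; rewrite (partial t n _ _ fo) ifT; first by rewrite (yp _ _ fo) subrr.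
    by apply: leq_trans hn; rewrite ltnS; exact: (leq_bigmax (Ordinal iN)).
  have xy i : normc ((\sum_(j < n) t j *: f j - y) i) <= normc (y i).
    rewrite lambda2B.
    have [[j hx]|hx] := pselect (exists j', f j' i != 0); last first.
      have z j : f j i = 0 by apply/eqP; apply: contrapT => /negP h; apply: hx; exists j.
      by rewrite (partial0 t n i z) y0// subrr.
    rewrite (partial t n _ _ hx); case: ifP => _; last by rewrite add0r normcN.
    by rewrite -/(t j) -(yp _ _ hx) subrr normc0 normc_ge0.
  have h1 : lnorm q.+2 (\sum_(j < n) t j *: f j - y) <= lnorm q.+2 y.
    have := @wnorm_mono R (fun j => j.+1%:R ^+ q.+2) (fun j => j.+1%:R ^+ q.+2)
      (\sum_(j < n) t j *: f j - y) y 1 (lambda2_lty q.+2 y) ler01.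
    rewrite mul1r => -[i|_]; last exact.
    rewrite mul1r mulr_ge0 ?normc_ge0 ?exprn_ge0//=; apply: ler_wpM2r; first by rewrite exprn_ge0.
    exact: xy.
  have h2 := lnorm_vanish q xz.
  have hN : lnorm q.+2 y <= N%:R * e.
    rewrite -ler_pdivrMr//; apply/ltW/archi_boundP.
    by rewrite divr_ge0 ?lnorm_ge0// ltW.
  have N1 : 1 <= N.+1%:R :> R by rewrite ler1n.
  have := lnorm_ge0 q (\sum_(j < n) t j *: f j - y).
  move: h1 h2 hN; rewrite -natr1 in N1 *.
  have := ler0n R N; move: (lnorm q.+2 _) (lnorm q _) (lnorm q.+2 y) N%:R N1 => a b d M M1 M0 h1 h2 h3 b0.
  nra.
move=> t'; rewrite serE => /scvgP ty; apply/funext => j.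
have fj := fp j; apply: (mulIf fj); rewrite /t divfK//.
apply: (ccvg_unique (scvg_ccvg (p j) ty)) => e e0; exists j.+1 => n jn.
by rewrite (partial t' n _ _ fj) jn subrr normc0.
Qed.

(** The coefficient at m_k decreases like (m_k+1)^-k. In the norm of order q,
    the terms with k >= q are summable because of the factor (k+1)^-2, and the
    finitely many others are bounded by (m_k+1)^q; the norm of order k+1 is at
    least of the size of m_k. *)
Lemma block_vector (m : nat -> nat) : injective m -> exists x : S,
  [/\ forall k, x (m k) = (k.+1%:R ^- 2 * (m k).+1%:R ^- k)%:C,
      forall i, (forall k, m k <> i) -> x i = 0 &
      forall q, lnorm q x <= 2 + \sum_(k < q) (m k).+1%:R ^+ q].
Proof.
move=> mi; pose c k : R := k.+1%:R ^- 2 * (m k).+1%:R ^- k.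
have c0 k : 0 <= c k by rewrite mulr_ge0 ?invr_ge0 ?exprn_ge0.
pose v k : S := (c k)%:C *: es (m k).
have vn q k : lnorm q (v k) = c k * (m k).+1%:R ^+ q.
  by rewrite lnormZ lnorm_es normcR ger0_norm.
have bd q n : \sum_(k < n) lnorm q (v k) <= 2 + \sum_(k < q) (m k).+1%:R ^+ q.
  have h k : lnorm q (v k) <= k.+1%:R ^- 2 + (if (k < q)%N then (m k).+1%:R ^+ q else 0).
    have m1 : 1 <= (m k).+1%:R :> R by rewrite ler1n.
    have m0 : 0 < (m k).+1%:R :> R by [].
    have k1 : 0 <= k.+1%:R ^- 2 :> R by rewrite invr_ge0 exprn_ge0.
    have k2 : k.+1%:R ^- 2 <= 1 :> R by rewrite invf_le1 ?exprn_gt0// exprn_ege1// ler1n.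
    rewrite vn /c -mulrA; case: ltnP => [kq|qk].
      have i0 : 0 <= (m k).+1%:R ^- k :> R by rewrite invr_ge0 exprn_ge0.
      have i1 : (m k).+1%:R ^- k <= 1 :> R by rewrite invf_le1 ?exprn_gt0// exprn_ege1.
      apply: (le_trans _ (ler_wpDl k1 (lexx _))).
      have M0 : 0 <= (m k).+1%:R ^+ q :> R by rewrite exprn_ge0.
      by rewrite mulrA; apply: ler_piMl => //; apply: mulr_ile1.
    rewrite addr0 ler_piMr// mulrC ler_pdivrMr ?exprn_gt0// mul1r.
    by rewrite ler_weXn2l.
  apply: (@le_trans _ _ (\sum_(k < n) (k.+1%:R ^- 2 + (if (k < q)%N then (m k).+1%:R ^+ q else 0)))).
    by apply: ler_sum => k _; exact: h.
  rewrite big_split/=; apply: lerD; first exact: sum_inv_sqr.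
  rewrite -(big_mkord xpredT (fun k => if (k < q)%N then (m k).+1%:R ^+ q else 0)) -big_mkcond/=.
  apply: (@le_trans _ _ (\sum_(0 <= k < maxn n q | (k < q)%N) (m k).+1%:R ^+ q)).
    rewrite (big_cat_nat (leq0n n) (leq_maxl n q))/= lerDl.
    by apply: sumr_ge0 => k _; rewrite exprn_ge0.
  rewrite (big_cat_nat (leq0n q) (leq_maxr n q))/= [X in _ + X]big1_seq; last first.
    by move=> k; rewrite mem_index_iota => /and3P[h1 h2 _]; move: h1; rewrite ltnNge h2.
  rewrite addr0 big_mkcond big_mkord; apply: ler_sum => k _.
  by rewrite ltn_ord.
have [x vx] := @lcvg_series R _ v (@s_weight_ge0 R) (fun j => ex_intro _ 0%N (@s_weight_gt0 R j 0%N)) (fun q => ex_intro _ _ (bd q)).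
exists x; split=> [k|i hi|q].
- apply: (ccvg_unique (scvg_ccvg (m k) vx)) => e e0; exists k.+1 => n kn.
  have -> : (\sum_(l < n) v l) (m k) = (c k)%:C.
    rewrite lambda2_sum (bigD1 (Ordinal kn))// big1 => [|l lk].
      by rewrite esZ eqxx mulr1; exact: addr0.
    rewrite esZ (_ : (m k == m l) = false) ?mulr0//.
    by apply: contraNF lk => /eqP /mi h; apply/eqP/val_inj => /=; exact: esym.
  by rewrite subrr normc0.
- apply: (ccvg_unique (scvg_ccvg i vx)); apply: ccvg_eq (ccvg_cst 0) _ => n.
  rewrite lambda2_sum big1// => l _; rewrite esZ (_ : (i == m l) = false) ?mulr0//.
  by apply/negbTE/eqP => h; apply: (hi l).
- apply: (lcvg_le vx); exists 0%N => n _; apply: le_trans (bd q n).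
  exact: lnorm_sum.
Qed.

End disjoint_supports.

(** * Koethe matrices as norm matrices of orthonormal sequences *)

Section realization.
Context {R : realType}.
Local Notation S := (s_space R).
Implicit Types (q k j n r i : nat) (x y : S).
Hint Resolve s_weight_ge0 s_weight_gt0 s_l2 : core.

(** The normalised block vectors have disjoint supports, so they are
    orthonormal and basic. Their norm matrix dominates A since the block of
    (j,k) is at least a_(j,k), and it is dominated by A since the blocks are. *)
Lemma kothe_realization (A : nat -> nat -> R) (X : set S) T U :
  kothe_matrix A -> kothe_equiv A (kothe_sqr A) -> linear_subspace X ->
  tame_iso [set: lambda2 A] (fun q => @lnorm R A q) X (fun q => @lnorm R _ q) T U ->
  exists f : nat -> S,
    [/\ basic_sequence f, orthonormal_seq f & kothe_equiv A (norm_matrix f)].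
Proof.
move=> KA AA hX TU; have Am := kothe_matrix_mono KA; have [A0 _ _] := KA.
have [s [K [K0 [As AK]]]] := kothe_inverse_square_summable KA AA hX TU.
have [_ A2] := AA.
pose m := block A s.
have mi j : injective (m j) by move=> k k' /block_inj[].
have /choice[x xP] := fun j => block_vector (R := R) (mi j).
have xm j k : x j (m j k) = (k.+1%:R ^- 2 * (m j k).+1%:R ^- k)%:C by have [] := xP j.
have xz j i : (forall k, m j k <> i) -> x j i = 0 by have [_ h _] := xP j; exact: h.
have xle j q : lnorm q (x j) <= 2 + \sum_(k < q) (m j k).+1%:R ^+ q by have [_ _ ->] := xP j.
pose N j := lnorm 0 (x j).
have N1 j : 1 <= N j.
  have := entry_le0 (x j) (m j 0%N); rewrite xm expr0 expr1n !invr1 mulr1.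
  by rewrite normc1.
have N2 j : N j <= 2 by have := xle j 0%N; rewrite big_ord0 addr0.
have N0 j : 0 < N j by exact: lt_le_trans (N1 j).
pose f j : S := (N j)^-1%:C *: x j.
have fn j q : lnorm q (f j) = (N j)^-1 * lnorm q (x j).
  by rewrite lnormZ normcR ger0_norm// invr_ge0 ltW.
have supp j i : f j i != 0 -> exists k, m j k = i.
  move=> h; apply: contrapT => hk; move/eqP : h; apply; rewrite lambda2Z xz ?mulr0//.
  by move=> k e; apply: hk; exists k.
have fd i j j' : f j i != 0 -> f j' i != 0 -> j = j'.
  by move=> /supp[k <-] /supp[k' /block_inj[]].
exists f; split.
- apply: disjoint_basic fd _ => j; exists (m j 0%N).
  rewrite lambda2Z xm expr0 expr1n !invr1 mulr1 mulr1.
  by rewrite (_ : 0 = 0%:C)// (inj_eq (@complexI R)) invr_eq0 gt_eqF.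
- move=> j k; have [<-|jk] := eqVneq j k.
    by rewrite sdotxx fn mulVf ?gt_eqF// expr1n.
  apply: dot_eq => //; apply: ccvg_eq (ccvg_cst 0) _ => n.
  rewrite big1// => i _; have [->|h] := eqVneq (f j i) 0; first by rewrite mul0r.
  have [->|h'] := eqVneq (f k i) 0; first by rewrite rmorph0 mulr0.
  by move: jk; rewrite (fd _ _ _ h h') eqxx.
- split=> q.
    (* The factor 2 comes from the normalisation and the other one from the
       coefficient at the block of (j,q). *)
    exists q.+1, (2 * q.+1%:R ^+ 2) => [|j]; first by rewrite mulr_gt0// exprn_gt0.
    apply: le_trans (le_block A s j q) _; rewrite -/(m j q).
    have := entry_le (x j) (m j q) q.+1; rewrite xm normcR => h.
    have q0 : 0 < q.+1%:R ^+ 2 :> R by rewrite exprn_gt0.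
    have M0 : 0 < (m j q).+1%:R ^+ q :> R by rewrite exprn_gt0.
    rewrite /norm_matrix fn; apply: (@le_trans _ _ (m j q).+1%:R); first by rewrite ler_nat.
    have {}h : (m j q).+1%:R <= q.+1%:R ^+ 2 * lnorm q.+1 (x j).
      rewrite -ler_pdivrMl//; apply: le_trans h; rewrite ger0_norm.
        by rewrite (exprSr ((m j q).+1%:R : R) q) -!mulrA mulKf// gt_eqF.
      by rewrite mulr_ge0// invr_ge0 ltW.
    apply: (le_trans h); rewrite -mulrA mulrCA; apply: ler_wpM2l; first exact: ltW.
    rewrite mulrA; apply: ler_peMl; first exact: lnorm_ge0.
    by rewrite ler_pdivlMr// mul1r.
  have [r [c [c0 hc]]] : dominated A (fun j => 2 + \sum_(k < q) (m j k).+1%:R ^+ q).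
    apply: (dominatedD Am); first exact: (dominated_cst K0 As AK).
    apply: (@dominated_sum R A Am s K K0 As AK q (fun k j => (m j k).+1%:R ^+ q)) => k.
    apply: (dominatedX Am A2 K0 As AK) => //.
    apply: dominated_le (dominatedD Am (dominated_block A0 Am A2 K0 As AK k) (dominated_cst K0 As AK 1)) => j.
    by rewrite natr1.
  exists r, c => // j; rewrite /norm_matrix fn; apply: le_trans (hc j).
  apply: le_trans (xle j q); apply: ler_piMl; first exact: lnorm_ge0.
  by rewrite invf_le1.
Qed.

Lemma kothe_equiv_tame (A B : nat -> nat -> R) : kothe_mono A -> kothe_mono B -> kothe_equiv A B ->
  exists T S, tame_iso [set: lambda2 A] (fun q => @lnorm R _ q)
                       [set: lambda2 B] (fun q => @lnorm R _ q) T S.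
Proof.
move=> Am Bm AB.
have A0 j q : 0 <= A j q by have /andP[] := Am j q.
have B0 j q : 0 <= B j q by have /andP[] := Bm j q.
have [T [S' [TS _]]] := @perm_iso R A B id id (fun _ => erefl) (fun _ => erefl) A0 B0 AB.
by exists T, S'.
Qed.

(** Replace both matrices by equivalent norm matrices of orthonormal
    sequences. *)
Lemma orthonormal_kothe (X : set S) : linear_subspace X ->
  (forall f g : nat -> S,
      basic_sequence f -> basic_sequence g -> orthonormal_seq f -> orthonormal_seq g ->
      frechet_iso [set: lambda2 (norm_matrix f)] [set: lambda2 (norm_matrix g)] ->
      frechet_iso [set: lambda2 (norm_matrix g)] X ->
      exists2 sigma : nat -> nat, bijective sigma &
        kothe_equiv (norm_matrix f) (kothe_perm sigma (norm_matrix g))) ->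
  forall A B : nat -> nat -> R, kothe_matrix A -> kothe_matrix B ->
      kothe_equiv A (kothe_sqr A) -> kothe_equiv B (kothe_sqr B) ->
      frechet_iso [set: lambda2 A] [set: lambda2 B] ->
      frechet_iso [set: lambda2 B] X ->
      exists2 sigma : nat -> nat, bijective sigma & kothe_equiv A (kothe_perm sigma B).
Proof.
move=> hX h A B KA KB AA BB [T0 iAB] [T1 iBX].
have gA := graded_lambda2 (kothe_matrix_mono KA); have gB := graded_lambda2 (kothe_matrix_mono KB).
have gX := graded_s hX.
have [U0 i0] := frechet_tame gA gB iAB; have [U1 i1] := frechet_tame gB gX iBX.
have [f [bf of_ eAf]] := kothe_realization KA AA hX (tame_trans i0 i1).
have [g [bg og eBg]] := kothe_realization KB BB hX i1.
have fm := norm_matrix_mono f; have gm := norm_matrix_mono g.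
have gf := graded_lambda2 fm; have gg := graded_lambda2 gm.
have [P [Q PQ]] := kothe_equiv_tame fm (kothe_matrix_mono KA) (kothe_equiv_sym eAf).
have [P' [Q' PQ']] := kothe_equiv_tame (kothe_matrix_mono KB) gm eBg.
have [|| sigma bs e] := h f g bf bg of_ og.
- eexists; apply: (tame_frechet gf gg); exact: (tame_trans (tame_trans PQ i0) PQ').
- eexists; apply: (tame_frechet gg gX).
  exact: (tame_trans (tame_sym (lambda2_full B) (lambda2_full (norm_matrix g)) PQ') i1).
exists sigma => //; apply: (kothe_equiv_trans eAf); apply: (kothe_equiv_trans e).
by apply: kothe_equiv_perm; exact: kothe_equiv_sym.
Qed.

End realization.

(** * Continuity of countably subadditive systems of seminorms *)

Section seminorm_continuity.
Context {R : realType}.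
Local Notation S := (s_space R).
Implicit Types (q k j n r p i : nat) (x y z : S).
Hint Resolve s_weight_ge0 s_weight_gt0 s_l2 : core.

Lemma s_closed (X : set S) (u : nat -> S) y : closed X -> (forall n, X (u n)) -> scvg u y -> X y.
Proof.
move=> cX Xu uy; apply: cX => B /s_nbhsP[n [e e0 h]].
have e20 : 0 < e / 2 by rewrite divr_gt0.
have [n0 /(_ n0 (leqnn _)) h1] := uy n _ e20.
by exists (u n0); split=> //; apply: h; apply: le_lt_trans h1 _; lra.
Qed.

Lemma lnorm_split (x y z : S) q : lnorm q (x - z) <= lnorm q (x - y) + lnorm q (y - z).
Proof.
have -> : x - z = (x - y) + (y - z) by rewrite addrA subrK.
exact: lnormD.
Qed.

Context (X : set S) (N : nat -> S -> R).
Hypotheses (hX : linear_subspace X) (cX : closed X).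
Hypothesis N0 : forall q x, X x -> 0 <= N q x.
Hypothesis ND : forall q x y, X x -> X y -> N q (x + y) <= N q x + N q y.
Hypothesis NZ : forall q a x, X x -> N q (a *: x) = normc a * N q x.
Hypothesis Nm : forall q r x, X x -> (q <= r)%N -> N q x <= N r x.
Hypothesis Ncount : forall (z : nat -> S) y, (forall i, X (z i)) ->
  (forall p, exists M, forall n, \sum_(i < n) N p (z i) <= M) ->
  scvg (fun n => \sum_(i < n) z i) y ->
  forall q M, (forall n, \sum_(i < n) N q (z i) <= M) -> N q y <= M.

(** One step of the category argument. A triple (x, r, e) stands for the
    closed ball with centre x and radius e in the norm of order r; the new
    ball lies in the old one, is small, and avoids the set where N q is at
    most k. *)
Definition ball_step q k (a b : S * nat * R) : Prop :=
  [/\ X b.1.1, 0 < b.2, (k <= b.1.2)%N /\ b.2 <= k.+1%:R^-1,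
      forall z, lnorm b.1.2 (z - b.1.1) <= b.2 -> lnorm a.1.2 (z - a.1.1) <= a.2 &
      forall z, X z -> lnorm b.1.2 (z - b.1.1) <= b.2 -> k%:R < N q z].

(** Baire's theorem in X: the sets where N q is at most k cover X, so the
    closure of one of them has interior points. Otherwise nested balls shrink
    to a point of X where N q is infinite. *)
Lemma somewhere_dense q : exists (k : R) x r (e : R), [/\ X x, 0 < e &
  forall y, X y -> lnorm r (y - x) < e -> forall p d, 0 < d ->
    exists2 z, X z & N q z <= k /\ lnorm p (z - y) < d].
Proof.
apply: contrapT => nd.
have step k (a : S * nat * R) : exists b, X a.1.1 -> 0 < a.2 -> ball_step q k a b.
  have [[Xa a0]|h] := pselect (X a.1.1 /\ 0 < a.2); last by exists a => ? ?; case: h.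
  have [y [Xy ya [p [d [d0 hd]]]]] : exists y, [/\ X y, lnorm a.1.2 (y - a.1.1) < a.2 &
      exists p d, 0 < d /\ forall z, X z -> N q z <= k%:R -> ~ lnorm p (z - y) < d].
    apply: contrapT => h; apply: nd; exists k%:R, a.1.1, a.1.2, a.2; split=> // y Xy ya p d d0.
    apply: contrapT => h2; apply: h; exists y; split=> //; exists p, d; split=> // z Xz Nz zy.
    by apply: h2; exists z.
  (* The new norm dominates the old one, the one in which the bad set is
     separated, and the k-th one, as needed for the Cauchy property. *)
  pose r := maxn (maxn a.1.2 p) k.
  pose g := a.2 - lnorm a.1.2 (y - a.1.1).
  have g0 : 0 < g by rewrite subr_gt0.
  have k0 : 0 < k.+1%:R^-1 :> R by rewrite invr_gt0.
  pose e := Num.min (Num.min (d / 2) g) k.+1%:R^-1.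
  have e0 : 0 < e by rewrite !lt_min k0 g0 divr_gt0.
  have ed : e <= d / 2 by rewrite !ge_min lexx.
  have eg : e <= g by rewrite !ge_min lexx orbT.
  have ek : e <= k.+1%:R^-1 by rewrite !ge_min lexx !orbT.
  have ra : (a.1.2 <= r)%N by rewrite /r !leq_max leqnn.
  have rp : (p <= r)%N by rewrite /r !leq_max leqnn !orbT.
  exists (y, r, e) => _ _; rewrite /ball_step; cbn [fst snd]; split.
  - exact: Xy.
  - exact: e0.
  - by split=> //; rewrite /r leq_max leqnn orbT.
  - move=> z zy; apply: le_trans (lnorm_split z y a.1.1 a.1.2) _.
    have h1 := lnorm_homo (z - y) ra; rewrite -[leRHS](subrK (lnorm a.1.2 (y - a.1.1))).
    by rewrite lerD2r; apply: le_trans h1 _; apply: le_trans zy eg.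
  - move=> z Xz zy; rewrite ltNge; apply/negP => Nz; apply: (hd z Xz Nz).
    apply: le_lt_trans (lnorm_homo (z - y) rp) _; apply: le_lt_trans zy _.
    by apply: le_lt_trans ed _; rewrite ltr_pdivrMr// ltr_pMr// ltr1n.
have /choice[g gP] : forall k, exists g, forall a : S * nat * R, X a.1.1 -> 0 < a.2 -> ball_step q k a (g a).
  by move=> k; have /choice[h hP] := step k; exists h.
pose fix st k : S * nat * R := if k is k'.+1 then g k' (st k') else (0, 0%N, 1).
have st_ok k : X (st k).1.1 /\ 0 < (st k).2.
  elim: k => [|k [h1 h2]]; first by split=> //=; have [] := hX.
  by have [] := gP k _ h1 h2.
have stP k : ball_step q k (st k) (st k.+1) by have [h1 h2] := st_ok k; exact: gP.
have nested k n z : (k <= n)%N -> lnorm (st n).1.2 (z - (st n).1.1) <= (st n).2 ->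
    lnorm (st k).1.2 (z - (st k).1.1) <= (st k).2.
  move=> kn; rewrite -(subnKC kn); elim: (n - k)%N => [|d IH]; first by rewrite addn0.
  by rewrite addnS => h; apply: IH; have [_ _ _ h' _] := stP (k + d)%N; exact: h'.
have inball k n : (k <= n)%N -> lnorm (st k).1.2 ((st n).1.1 - (st k).1.1) <= (st k).2.
  by move=> kn; apply: (nested k n _ kn); rewrite subrr lnorm0 ltW//; have [] := st_ok n.
have [y hy] : exists y, scvg (fun n => (st n).1.1) y.
  apply: lambda2_complete => //; first by move=> j; exists 0%N; exact: s_weight_gt0.
  move=> p e e0; pose k := maxn p (Num.bound (2 / e)); exists k.+1 => n m kn km.
  have [_ _ [h1 h2] _ _] := stP k.
  have pk : (p <= (st k.+1).1.2)%N by apply: leq_trans h1; exact: leq_maxl.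
  have hn := inball _ _ kn; have hm := inball _ _ km.
  apply: le_trans (lnorm_homo ((st n).1.1 - (st m).1.1) pk) _.
  apply: le_trans (lnorm_split _ (st k.+1).1.1 _ _) _.
  rewrite (lnormB _ (st k.+1).1.1).
  apply: (@le_trans _ _ (k.+1%:R^-1 + k.+1%:R^-1)).
    by apply: lerD; [exact: le_trans hn h2|exact: le_trans hm h2].
  have k0 : 0 < k.+1%:R :> R by [].
  have -> : k.+1%:R^-1 + k.+1%:R^-1 = 2 / k.+1%:R :> R by rewrite mulrDl mul1r.
  rewrite ler_pdivrMr// mulrC -ler_pdivrMr//.
  apply: le_trans (_ : (Num.bound (2 / e))%:R <= _).
    by apply/ltW/archi_boundP; rewrite divr_ge0// ltW.
  by rewrite ler_nat; apply: leqW; exact: leq_maxr.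
have Xy : X y by apply: (s_closed cX _ hy) => n; have [] := st_ok n.
have big k : k%:R < N q y.
  have [_ _ _ _ h] := stP k; apply: h => //.
  have l : scvg (fun n => (st n).1.1 - (st k.+1).1.1) (y - (st k.+1).1.1).
    by move=> p e e0; have [n0 h] := hy p e e0; exists n0 => n /h; rewrite opprB addrA subrK.
  by apply: (lcvg_le l); exists k.+1 => n; exact: inball.
have := big (Num.bound (N q y)); have := archi_boundP (N0 q Xy).
by move=> h1 h2; have := lt_trans h1 h2; rewrite ltxx.
Qed.

(** Differences of points near x show that the closure of the set where N q is
    at most 2k contains a ball around 0; rescale. *)
Lemma dense_image q : exists r (D : R), 0 <= D /\ forall y, X y -> forall p d, 0 < d ->
  exists2 z, X z & N q z <= D * lnorm r y /\ lnorm p (y - z) <= d.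
Proof.
have [X0 _] := hX.
have [k [x [r [e [Xx e0 h]]]]] := somewhere_dense q.
have xx : lnorm r (x - x) < e by rewrite subrr lnorm0.
have k0 : 0 <= k.
  by have [z Xz [Nz _]] := h x Xx xx 0%N 1 ltr01; exact: le_trans (N0 q Xz) Nz.
exists r, (4 * k / e); split; first by rewrite !mulr_ge0// invr_ge0 ltW.
move=> y Xy p d d0.
have [y0|ny] := eqVneq (lnorm r y) 0.
  have -> : y = 0.
    by apply: lnorm0_eq0; apply: le_trans (lnorm_homo y (leq0n r)) _; rewrite y0.
  exists 0 => //; split; last by rewrite subrr lnorm0 ltW.
  by have := NZ q 0 X0; rewrite scale0r normc0 mul0r => ->; rewrite lnorm0 mulr0.
have {ny}a0 : 0 < lnorm r y by rewrite lt_def lnorm_ge0 andbT.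
(* The factor that puts the multiple of y into the ball of radius e; half of
   it keeps the inequality strict. *)
pose c := e / 2 / lnorm r y.
have c0 : 0 < c by rewrite !divr_gt0.
have nc : normc c%:C = c by rewrite normcR ger0_norm// ltW.
have nci : normc c^-1%:C = c^-1 by rewrite normcR ger0_norm// invr_ge0 ltW.
have d0' : 0 < c * d / 2 by rewrite divr_gt0// mulr_gt0.
have Xcy : X (x + c%:C *: y) by apply: (subspaceD hX Xx); exact: subspaceZ.
have cy : lnorm r (x + c%:C *: y - x) < e.
  by rewrite addrAC subrr add0r lnormZ nc /c divfK ?gt_eqF// ltr_pdivrMr// ltr_pMr// ltr1n.
have [z1 Xz1 [Nz1 hz1]] := h _ Xcy cy p _ d0'.
have [z0 Xz0 [Nz0 hz0]] := h _ Xx xx p _ d0'.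
exists (c^-1%:C *: (z1 - z0)).
  by apply: (subspaceZ _ hX); exact: subspaceB.
have NN x' : X x' -> N q (- x') = N q x'.
  by move=> Xx'; rewrite -scaleN1r NZ// normcN normc1 mul1r.
split.
  rewrite NZ ?nci; last exact: subspaceB.
  have Xn : X (- z0) by rewrite -scaleN1r; exact: subspaceZ.
  have hN := ND q Xz1 Xn; rewrite NN// in hN.
  have -> : 4 * k / e * lnorm r y = c^-1 * (k + k).
    by rewrite /c; field; rewrite !gt_eqF.
  apply: ler_wpM2l; first by rewrite invr_ge0 ltW.
  by apply: le_trans hN _; exact: lerD.
have -> : y - c^-1%:C *: (z1 - z0) = c^-1%:C *: ((x + c%:C *: y - z1) - (x - z0)).
  have -> : (x + c%:C *: y - z1) - (x - z0) = c%:C *: y - (z1 - z0).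
    rewrite -(addrA x) (addrC x) (opprB x z0) addrACA subrr addr0.
    by rewrite (opprB z1 z0) -addrA (addrC (- z1)).
  rewrite [in RHS]scalerBr scalerA -rmorphM mulVf ?gt_eqF//.
  by rewrite scale1r.
rewrite lnormZ nci ler_pdivrMl//; apply: le_trans (lnorm_subD _ _ _) _.
rewrite (lnormB p _ z1) (lnormB p _ z0).
by rewrite (splitr (c * d)); apply: lerD; exact: ltW.
Qed.

(** A version of Zabreiko's lemma for an increasing system of seminorms. As in
    the open mapping theorem, y is split into a series of z_i, each
    approximating the remainder up to an error so small that the next term is
    tiny for a seminorm N of higher index; therefore the series converges for
    all N at once, and countable subadditivity applies. *)
Lemma seminorm_continuous q : exists r (C : R), 0 <= C /\
  forall y, X y -> N q y <= C * lnorm r y.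
Proof.
have [X0 _] := hX.
have /choice[r /choice[D hD]] := dense_image.
have D0 p : 0 <= D p by have [] := hD p.
exists (r q), (D q); split=> // y Xy.
apply/ler_addgt0Pr => eta eta0.
(* The first bound makes the next term small for the seminorm of the next
   index, the second one makes the remainders tend to 0. *)
pose e0 i : R := Num.min (eta / 2 * i.+2%:R ^- 2 / (D (q + i).+1 + 1)) i.+1%:R^-1.
have D1 i : 0 < D i + 1 by rewrite ltr_wpDl.
have e00 i : 0 < e0 i by rewrite lt_min invr_gt0 ltr0n andbT divr_gt0// mulr_gt0 ?divr_gt0// invr_gt0 exprn_gt0.
have step i (w : S) : exists z, X w -> [/\ X z, N (q + i) z <= D (q + i)%N * lnorm (r (q + i)%N) w &
    lnorm (maxn (r (q + i).+1) i) (w - z) <= e0 i].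
  have [Xw|h] := pselect (X w); last by exists 0.
  have [_ h] := hD (q + i)%N.
  by have [z Xz [h1 h2]] := h w Xw (maxn (r (q + i).+1) i) (e0 i) (e00 i); exists z.
have /choice[g gP] : forall i, exists g, forall w, X w -> [/\ X (g w),
    N (q + i) (g w) <= D (q + i)%N * lnorm (r (q + i)%N) w &
    lnorm (maxn (r (q + i).+1) i) (w - g w) <= e0 i].
  by move=> i; have /choice[h hP] := step i; exists h.
pose fix w i : S := if i is i'.+1 then w i' - g i' (w i') else y.
have Xw i : X (w i).
  elim: i => [//|i IH] /=; apply: (subspaceB hX IH); by have [] := gP i _ IH.
pose z i := g i (w i).
have Xz i : X (z i) by have [] := gP i _ (Xw i).
have wS i : w i.+1 = w i - z i by [].
have zsum n : \sum_(i < n) z i = y - w n.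
  elim: n => [|n IH]; first by rewrite big_ord0 subrr.
  have -> : \sum_(i < n.+1) z i = \sum_(i < n) z i + z n by rewrite big_ord_recr.
  by rewrite IH wS opprB -addrA (addrC (- w n)).
have wsmall i : lnorm (maxn (r (q + i).+1) i) (w i.+1) <= e0 i.
  by rewrite wS; have [] := gP i _ (Xw i).
have zsmall i : N (q + i.+1) (z i.+1) <= eta / 2 * i.+2%:R ^- 2.
  have [_ h _] := gP i.+1 _ (Xw i.+1); apply: (le_trans h); rewrite addnS.
  have h1 : lnorm (r (q + i).+1) (w i.+1) <= e0 i.
    by apply: le_trans (wsmall i); apply: (lnorm_homo (w i.+1)); exact: leq_maxl.
  have h2 : e0 i <= eta / 2 * i.+2%:R ^- 2 / (D (q + i).+1 + 1) by rewrite ge_min lexx.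
  have {h1 h2} h1 := le_trans h1 h2; rewrite ler_pdivlMr// in h1.
  apply: le_trans h1; rewrite mulrC mulrDr mulr1 lerDl; exact: lnorm_ge0.
(* Only the term of index 0 is not small by construction; it carries the bound
   that is to be proved. *)
have zb p i : (p <= q + i)%N -> N p (z i) <= eta / 2 * i.+1%:R ^- 2 + (if i is 0 then D q * lnorm (r q) y else 0).
  move=> pi; apply: le_trans (Nm (Xz i) pi) _; case: i pi => [|i] pi; last first.
    by rewrite addr0; exact: zsmall.
  have [_ h _] := gP 0%N _ (Xw 0%N); rewrite addn0 in h *.
  apply: (le_trans h); rewrite lerDr.
  by rewrite mulr_ge0 ?invr_ge0 ?exprn_ge0// divr_ge0// ltW.
have total n : \sum_(i < n) (eta / 2 * i.+1%:R ^- 2 + (if i : nat is 0 then D q * lnorm (r q) y else 0))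
     <= D q * lnorm (r q) y + eta.
  have a0 : 0 <= D q * lnorm (r q) y by rewrite mulr_ge0// lnorm_ge0.
  rewrite big_split/= -mulr_sumr addrC; apply: lerD.
    case: n => [|n]; first by rewrite big_ord0.
    by rewrite big_ord_recl big1 ?addr0.
  have h := sum_inv_sqr (R := R) n; rewrite -[leRHS](divfK (_ : 2 != 0 :> R)) ?pnatr_eq0//.
  by apply: ler_wpM2l => //; rewrite divr_ge0// ltW.
apply: (Ncount Xz) => [p||n].
- exists (\sum_(i < p) N p (z i) + (D q * lnorm (r q) y + eta)) => n.
  apply: (@le_trans _ _ (\sum_(i < n) (if (i < p)%N then N p (z i) else 0) +
     \sum_(i < n) (eta / 2 * i.+1%:R ^- 2 + (if i : nat is 0 then D q * lnorm (r q) y else 0)))).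
    rewrite -big_split/=; apply: ler_sum => i _; case: ltnP => [ip|pi].
      rewrite lerDl addr_ge0//; first by rewrite mulr_ge0 ?invr_ge0 ?exprn_ge0// divr_ge0// ltW.
      by case: (i : nat) => [|?]; rewrite ?mulr_ge0 ?lnorm_ge0 ?lexx.
    by rewrite add0r; apply: zb; apply: leq_trans pi (leq_addl _ _).
  apply: lerD => //.
  rewrite -(big_mkord xpredT (fun k => if (k < p)%N then N p (z k) else 0)) -big_mkcond/=.
  apply: (@le_trans _ _ (\sum_(0 <= k < maxn n p | (k < p)%N) N p (z k))).
    rewrite (big_cat_nat (leq0n n) (leq_maxl n p))/= lerDl.
    by apply: sumr_ge0 => k _; exact: N0.
  rewrite (big_cat_nat (leq0n p) (leq_maxr n p))/= [X in _ + X]big1_seq; last first.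
    by move=> k; rewrite mem_index_iota => /and3P[h1 h2 _]; move: h1; rewrite ltnNge h2.
  rewrite addr0 big_mkcond big_mkord; apply: ler_sum => k _.
  by rewrite ltn_ord.
- move=> p e ep; exists (maxn p (Num.bound e^-1)).+1 => -[//|n].
  rewrite ltnS geq_max => /andP[pn en].
  rewrite zsum addrAC subrr add0r lnormN.
  apply: le_trans (_ : lnorm (maxn (r (q + n).+1) n) (w n.+1) <= _).
    by apply: (lnorm_homo (w n.+1)); rewrite leq_max pn orbT.
  apply: le_trans (wsmall n) _; apply: (@le_trans _ _ n.+1%:R^-1); first by rewrite ge_min lexx orbT.
  rewrite -[leRHS]invrK lef_pV2 ?posrE ?invr_gt0//.
  apply: le_trans (_ : (Num.bound e^-1)%:R <= _); last by rewrite ler_nat; exact: leqW.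
  by apply/ltW/archi_boundP; rewrite invr_ge0 ltW.
- apply: le_trans (total n); apply: ler_sum => i _; apply: zb; exact: leq_addr.
Qed.

End seminorm_continuity.

(** * Equicontinuity of basis expansions *)

Section schauder.
Context {R : realType}.
Local Notation S := (s_space R).
Implicit Types (q k j n r p i : nat) (y z : S).
Hint Resolve s_weight_ge0 s_weight_gt0 s_l2 : core.

Definition expansion (x : nat -> S) (t : nat -> R[i]) n : S := \sum_(j < n) t j *: x j.

Lemma expansionS x t n : expansion x t n.+1 = expansion x t n + t n *: x n.
Proof. by rewrite /expansion big_ord_recr. Qed.

Lemma expansion_series x t y : series (fun j => t j *: x j) @ \oo --> y <-> scvg (expansion x t) y.
Proof.
rewrite -scvgP; have -> // : series (fun j => t j *: x j) = expansion x t.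
by apply/funext => n; rewrite /series /= big_mkord.
Qed.

Lemma expansion_lin x a (c d : nat -> R[i]) n :
  expansion x (fun j => a * c j + d j) n = a *: expansion x c n + expansion x d n.
Proof.
elim: n => [|n IH]; first by rewrite /expansion !big_ord0 scaler0 addr0.
by rewrite !expansionS IH scalerDl -scalerA scalerDr addrACA.
Qed.

(** The coefficients as a function on all of s, of which only the values on X
    matter. *)
Lemma schauder_coef (X : set S) x : schauder_basis X x ->
  exists t : S -> nat -> R[i], (forall y, X y -> scvg (expansion x (t y)) y) /\
    forall c y, X y -> scvg (expansion x c) y -> c = t y.
Proof.
move=> [_ h].
have /choice[t ht] : forall y, exists t : nat -> R[i], X y -> scvg (expansion x t) y /\
    forall c, scvg (expansion x c) y -> c = t.
  move=> y; have [Xy|nX] := pselect (X y); last by exists (fun=> 0).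
  have [t [h1 h2]] := h y Xy; exists t => _; split; first exact/expansion_series.
  by move=> c hc; apply/esym/h2; apply/expansion_series.
by exists t; split=> [y /ht[]//|c y /ht[_]]; exact.
Qed.

Lemma scvg_ext (u v : nat -> S) y : u =1 v -> scvg u y -> scvg v y.
Proof. by move=> /funext ->. Qed.

Section basis.
Context (X : set S) (x : nat -> S) (t : S -> nat -> R[i]).
Hypotheses (hX : linear_subspace X) (cX : closed X) (Xx : forall j, X (x j)).
Hypothesis tx : forall y, X y -> scvg (expansion x (t y)) y.
Hypothesis tu : forall c y, X y -> scvg (expansion x c) y -> c = t y.

Lemma expansion_in c n : X (expansion x c n).
Proof. by apply: subspace_sum => // i _; exact: subspaceZ. Qed.

Lemma coef_lin a y z j : X y -> X z -> t (a *: y + z) j = a * t y j + t z j.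
Proof.
move=> Xy Xz; have -> // : t (a *: y + z) = fun j => a * t y j + t z j.
apply/esym/tu; first exact: hX.2.
by apply: scvg_ext (lcvg_lin a (tx Xy) (tx Xz)) => n; rewrite expansion_lin.
Qed.

Lemma coef0 j : t 0 j = 0.
Proof.
have [X0 _] := hX; have := coef_lin 1 j X0 X0; rewrite scale1r addr0 mul1r => h.
by apply/(addrI (t 0 j)); rewrite -h addr0.
Qed.

Lemma coef_basis j k : t (x k) j = (j == k)%:R.
Proof.
have <- // : (fun j => (j == k)%:R) = t (x k).
apply: tu => // q e e0; exists k.+1 => n kn.
have -> : expansion x (fun j => (j == k)%:R) n = x k.
  rewrite /expansion (bigD1 (Ordinal kn))//= eqxx scale1r big1 ?addr0// => i ik.
  rewrite (_ : (i == k :> nat) = false) ?scale0r//.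
  by apply: contraNF ik => /eqP h; apply/eqP/val_inj.
by rewrite subrr lnorm0 ltW.
Qed.

Lemma expansion_bounded q y : X y -> exists M, forall n, lnorm q (expansion x (t y) n) <= M.
Proof.
move=> Xy; have [n0 h] := tx Xy q ltr01.
exists (\sum_(k < n0) lnorm q (expansion x (t y) k) + (1 + lnorm q y)) => n.
have [n0n|nn0] := leqP n0 n.
  rewrite -[leLHS]add0r; apply: lerD; first by apply: sumr_ge0 => k _; exact: lnorm_ge0.
  rewrite -{1}(subrK y (expansion x (t y) n)); apply: le_trans (lnormD _ _ _) _.
  by rewrite lerD2r; exact: h.
rewrite (bigD1 (Ordinal nn0))//= -addrA lerDl addr_ge0 ?addr_ge0 ?lnorm_ge0//.
by apply: sumr_ge0 => k _; exact: lnorm_ge0.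
Qed.

(** Equicontinuity of the expansions is the continuity of these seminorms. *)
Definition sup_norm q y : R := sup (range (fun n => lnorm q (expansion x (t y) n))).

Lemma expansion_le q y n : X y -> lnorm q (expansion x (t y) n) <= sup_norm q y.
Proof.
move=> Xy; apply: ub_le_sup; last by exists n.
by have [M hM] := expansion_bounded q Xy; exists M => _ [k _ <-].
Qed.

Lemma sup_norm_le q y M : (forall n, lnorm q (expansion x (t y) n) <= M) -> sup_norm q y <= M.
Proof.
move=> h; apply: ge_sup; last by move=> _ [n _ <-].
by exists (lnorm q (expansion x (t y) 0)); exists 0%N.
Qed.

Lemma lnorm_le_sup_norm q y : X y -> lnorm q y <= sup_norm q y.
Proof. by move=> Xy; apply: (lcvg_le (tx Xy)); exists 0%N => n _; exact: expansion_le. Qed.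

Lemma sup_norm_ge0 q y : X y -> 0 <= sup_norm q y.
Proof. by move=> Xy; apply: le_trans (lnorm_ge0 q y) (lnorm_le_sup_norm q Xy). Qed.

Lemma coef_expansion_lin a y z n : X y -> X z ->
  expansion x (t (a *: y + z)) n = a *: expansion x (t y) n + expansion x (t z) n.
Proof.
by move=> Xy Xz; rewrite -expansion_lin; apply: eq_bigr => j _; rewrite coef_lin.
Qed.

Lemma coef_expansion0 n : expansion x (t 0) n = 0.
Proof. by rewrite /expansion big1// => j _; rewrite coef0 scale0r. Qed.

Lemma sup_normD q y z : X y -> X z -> sup_norm q (y + z) <= sup_norm q y + sup_norm q z.
Proof.
move=> Xy Xz; apply: sup_norm_le => n; rewrite -{1}(scale1r y) coef_expansion_lin// scale1r.
by apply: le_trans (lnormD _ _ _) _; apply: lerD; exact: expansion_le.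
Qed.

Lemma sup_normZ q a y : X y -> sup_norm q (a *: y) = normc a * sup_norm q y.
Proof.
have [X0 _] := hX.
have le b w : X w -> sup_norm q (b *: w) <= normc b * sup_norm q w.
  move=> Xw; apply: sup_norm_le => n; rewrite -(addr0 (b *: w)) coef_expansion_lin//.
  rewrite coef_expansion0 addr0 lnormZ; apply: ler_wpM2l; first exact: normc_ge0.
  exact: expansion_le.
move=> Xy; apply/eqP; rewrite eq_le le//=.
have [->|a0] := eqVneq a 0; first by rewrite normc0 mul0r sup_norm_ge0// scale0r.
have na : normc a != 0 by apply: contraNneq a0 => /eq0_normc ->.
have na0 : 0 < normc a by rewrite lt_def na normc_ge0.
have := le a^-1 (a *: y) (subspaceZ a hX Xy); rewrite scalerA mulVf// scale1r normcV.
by rewrite ler_pdivlMl.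
Qed.

Lemma sup_norm_homo q r y : X y -> (q <= r)%N -> sup_norm q y <= sup_norm r y.
Proof.
move=> Xy qr; apply: sup_norm_le => n.
by apply: le_trans (lnorm_homo (expansion x (t y) n) qr) _; exact: expansion_le.
Qed.

Lemma coef_sum (z : nat -> S) m n : (forall i, X (z i)) ->
  expansion x (t (\sum_(i < m) z i)) n = \sum_(i < m) expansion x (t (z i)) n.
Proof.
move=> Xz; elim: m => [|m IH]; first by rewrite !big_ord0 coef_expansion0.
have Xs : X (\sum_(i < m) z i) by apply: subspace_sum.
rewrite !big_ord_recr/= addrC -{1}(scale1r (z m)) coef_expansion_lin// IH scale1r addrC.
by [].
Qed.

Lemma basis_neq0 j : x j <> 0.
Proof. by move=> h; have := coef_basis j j; rewrite h coef0 eqxx => /eqP; rewrite eq_sym oner_eq0. Qed.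

(** If the norms of the z_i are summable for every index p, the partial
    expansions of the z_i sum up to expansions with fixed coefficients c,
    which converge to y: a tail of the series is small uniformly in n, and
    finitely many terms converge. Uniqueness identifies c with the
    coefficients of y. *)
Lemma sup_norm_count (z : nat -> S) y : (forall i, X (z i)) ->
  (forall p, exists M, forall n, \sum_(i < n) sup_norm p (z i) <= M) ->
  scvg (fun n => \sum_(i < n) z i) y ->
  forall q M, (forall n, \sum_(i < n) sup_norm q (z i) <= M) -> sup_norm q y <= M.
Proof.
move=> Xz hz zy.
have Xs n : X (\sum_(i < n) z i) by apply: subspace_sum.
have Xy : X y by exact: (s_closed cX Xs zy).
have bd n q M : (forall m, \sum_(i < m) sup_norm q (z i) <= M) ->
    forall m, \sum_(i < m) lnorm q (expansion x (t (z i)) n) <= M.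
  by move=> h m; apply: le_trans (h m); apply: ler_sum => i _; exact: expansion_le.
have /choice[Q hQ] : forall n, exists Q, scvg (fun m => \sum_(i < m) expansion x (t (z i)) n) Q.
  move=> n; apply: (@lcvg_series R _ (fun i => expansion x (t (z i)) n)) => //.
    by move=> j; exists 0%N; exact: s_weight_gt0.
  by move=> q; have [M hM] := hz q; exists M; exact: bd.
have Q0 : Q 0%N = 0.
  apply: (scvg_unique (hQ 0%N)) => q e e0; exists 0%N => m _.
  by rewrite subr0 big1 ?lnorm0 ?ltW// => i _; rewrite /expansion big_ord0.
have QS n : exists c : R[i], Q n.+1 = Q n + c *: x n.
  have [k xk] : exists k, x n k != 0.
    apply: contrapT => h; apply: (@basis_neq0 n); apply: lambda2_ext => k; rewrite lambda20.
    by apply/eqP; apply: contrapT => /negP hk; apply: h; exists k.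
  have lim : scvg (fun m => (\sum_(i < m) t (z i) n) *: x n) (Q n.+1 - Q n).
    have := lcvg_lin (-1) (hQ n) (hQ n.+1); rewrite scaleN1r addrC.
    apply: scvg_ext => m; rewrite scaleN1r addrC -sumrB scaler_suml.
    by apply: eq_bigr => i _; rewrite expansionS addrAC subrr add0r.
  have limk l := scvg_ccvg l lim.
  (* The difference is a limit of multiples of x_n; the factor is read off at
     a coordinate where x_n does not vanish. *)
  exists ((Q n.+1 - Q n) k / x n k); apply/eqP; rewrite addrC -subr_eq; apply/eqP.
  apply: lambda2_ext => l; apply: (ccvg_unique (limk l)); rewrite lambda2Z.
  have := ccvg_lin (x n l / x n k) (limk k) (ccvg_cst 0).
  rewrite addr0 (_ : _ * (Q n.+1 - Q n) k = (Q n.+1 - Q n) k / x n k * x n l); last by ring.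
  move/ccvg_eq; apply => m; rewrite addr0 !lambda2Z.
  by rewrite mulrCA -!mulrA mulVf// mulr1.
have /choice[c hc] := QS.
have QE n : Q n = expansion x c n.
  by elim: n => [|n IH]; [rewrite Q0 /expansion big_ord0|rewrite hc IH expansionS].
have Qy : scvg (expansion x c) y.
  move=> p e e0; have [M hM] := hz p.
  have e40 : 0 < e / 4 by rewrite divr_gt0.
  have mono m : \sum_(i < m) sup_norm p (z i) <= \sum_(i < m.+1) sup_norm p (z i).
    by rewrite big_ord_recr/= lerDl; exact: sup_norm_ge0.
  have [I hI] := mono_tail mono hM e40.
  have [n0 hn0] := tx (Xs I) p e40.
  exists n0 => n n0n; rewrite -QE.
  have l : scvg (fun m => \sum_(i < m) expansion x (t (z i)) n - \sum_(i < m) z i) (Q n - y).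
    have := lcvg_lin (-1) zy (hQ n); rewrite scaleN1r addrC.
    by apply: scvg_ext => m; rewrite scaleN1r addrC.
  apply: (lcvg_le l); exists I => m Im.
  have h1 : lnorm p (\sum_(i < I) expansion x (t (z i)) n - \sum_(i < I) z i) <= e / 4.
    by rewrite -coef_sum//; exact: hn0.
  (* Beyond I each term contributes at most twice its supremum norm, uniformly
     in n. *)
  have h2 : lnorm p (\sum_(i < m) expansion x (t (z i)) n - \sum_(i < m) z i) <=
     lnorm p (\sum_(i < I) expansion x (t (z i)) n - \sum_(i < I) z i) +
     2 * (\sum_(i < m) sup_norm p (z i) - \sum_(i < I) sup_norm p (z i)).
    rewrite -(subnKC Im); elim: (m - I)%N => [|d IH].
      by rewrite addn0 subrr mulr0 addr0.
    rewrite addnS !big_ord_recr/= opprD addrACA; apply: le_trans (lnormD _ _ _) _.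
    have h3 : lnorm p (expansion x (t (z (I + d)%N)) n - z (I + d)%N) <= 2 * sup_norm p (z (I + d)%N).
      apply: le_trans (lnorm_subD _ _ _) _; rewrite mulr_natl mulr2n.
      by apply: lerD; [exact: expansion_le|exact: lnorm_le_sup_norm].
    apply: le_trans (lerD IH h3) _; rewrite -addrA lerD2l -mulrDr addrAC; exact: lexx.
  apply: le_trans h2 _; move: h1 (hI m Im) e0.
  move: (lnorm p _) (\sum_(i < m) sup_norm p (z i) - _) => a b h1 h2 h3; lra.
have ct : c = t y by exact: tu.
move=> q M hM; apply: sup_norm_le => n; rewrite -ct -QE.
apply: (lcvg_le (hQ n)); exists 0%N => m _; apply: le_trans (lnorm_sum _ _ _ _) _.
exact: bd.
Qed.

Lemma expansion_equicontinuous q : exists r (C : R), 0 <= C /\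
  forall y n, X y -> lnorm q (expansion x (t y) n) <= C * lnorm r y.
Proof.
have [r [C [C0 h]]] := seminorm_continuous hX cX sup_norm_ge0 sup_normD sup_normZ
  sup_norm_homo sup_norm_count q.
by exists r, C; split=> // y n Xy; apply: le_trans (expansion_le q n Xy) (h y Xy).
Qed.

End basis.
End schauder.

(** * The theorem of Dynin and Mityagin and quasi-equivalence *)

Section dynin_mityagin.
Context {R : realType}.
Local Notation S := (s_space R).
Implicit Types (q k j n r p i : nat) (y z : S).
Hint Resolve s_weight_ge0 s_weight_gt0 s_l2 : core.

Section model.
Context (X : set S) (x : nat -> S) (t : S -> nat -> R[i]).
Hypotheses (hX : linear_subspace X) (cX : closed X) (Xx : forall j, X (x j)).
Hypothesis tx : forall y, X y -> scvg (expansion x (t y)) y.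
Hypothesis tu : forall c y, X y -> scvg (expansion x c) y -> c = t y.
Local Notation A := (norm_matrix x).

Lemma basis_gt0 j q : 0 < lnorm q (x j).
Proof.
rewrite lt_def lnorm_ge0 andbT; apply/negP => /eqP h; apply: (@basis_neq0 R X x t hX Xx tx tu j).
by apply: lnorm0_eq0; apply: le_trans (lnorm_homo (x j) (leq0n q)) _; rewrite h.
Qed.

Lemma coef_bound q : exists r (C : R), 0 <= C /\
  forall j y, X y -> normc (t y j) * lnorm q (x j) <= C * lnorm r y.
Proof.
have [r [C [C0 h]]] := expansion_equicontinuous hX cX Xx tx tu q.
exists r, (C + C); split=> [|j y Xy]; first exact: addr_ge0.
rewrite -lnormZ; have -> : t y j *: x j = expansion x (t y) j.+1 - expansion x (t y) j.
  by rewrite expansionS addrAC subrr add0r.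
by apply: le_trans (lnorm_subD _ _ _) _; rewrite mulrDl; apply: lerD; exact: h.
Qed.

(** The count of biorthogonal systems with weights |x_j|_q: by equicontinuity,
    the coordinate of y at x_j times x_j is bounded by a norm of y. *)
Lemma basis_nuclear q : exists r (K : R), 0 <= K /\
  forall n, \sum_(j < n) (lnorm q (x j) / lnorm r (x j)) ^+ 2 <= K ^+ 2.
Proof.
have [r [C [C0 h]]] := coef_bound q.
exists r.+2, (2 * C); split=> [|n]; first exact: mulr_ge0.
have := @biorthogonal_square_sum R X x (fun j y => t y j) (fun j => lnorm q (x j)) C r C0 hX Xx.
move=> /(_ (fun j a y z => @coef_lin R X x t hX tx tu a y z j)).
move=> /(_ (@coef_basis R X x t Xx tu) h (fun j => lnorm_ge0 q (x j)) n) /le_trans; apply.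
by rewrite exprMn; apply: ler_wpM2r; [exact: sqr_ge0|rewrite expr2 ler_peMl// ler1n].
Qed.

(** Nuclearity upgrades square summability of the weighted coefficients to
    absolute convergence of the series. *)
Lemma synthesis_bound q : exists r (K : R), 0 <= K /\ forall (xi : lambda2 A) n,
  \sum_(j < n) lnorm q (xi j *: x j) <= K * lnorm r xi.
Proof.
have [r [K [K0 h]]] := basis_nuclear q; exists r, K; split=> // xi n.
have h1 := wpsum_le_wnorm n (lambda2_lty r xi).
have := @fin_CS R n (fun j => normc (xi j) * lnorm r (x j)) (fun j => lnorm q (x j) / lnorm r (x j))
  (lnorm r xi) K (lnorm_ge0 _ _) K0 h1 (h n).
rewrite mulrC; apply: le_trans; apply: ler_sum => j _.
by rewrite lnormZ -mulrA; have g := basis_gt0 j r; rewrite (mulrC (lnorm r _)) divfK// gt_eqF.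
Qed.

Lemma synthesis_exists (xi : lambda2 A) : exists y, scvg (expansion x xi) y.
Proof.
apply: (@lcvg_series R _ (fun j => xi j *: x j)) => //; first by move=> j; exists 0%N; exact: s_weight_gt0.
by move=> q; have [r [K [_ h]]] := synthesis_bound q; exists (K * lnorm r xi).
Qed.

(** Conversely it upgrades boundedness of the weighted coefficients to square
    summability. *)
Lemma analysis_bound q : exists r (K : R), 0 <= K /\ forall y n, X y ->
  wpsum (A ^~ q) (t y) n <= (K * lnorm r y) ^+ 2.
Proof.
have [r [K [K0 hK]]] := basis_nuclear q; have [p [C [C0 hC]]] := coef_bound r.
exists p, (C * K); split=> [|y n Xy]; first exact: mulr_ge0.
rewrite mulrAC exprMn; apply: le_trans (ler_wpM2l (sqr_ge0 _) (hK n)).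
rewrite /wpsum mulr_sumr; apply: ler_sum => j _; rewrite -exprMn.
have g := basis_gt0 j r.
have e : normc (t y j) * lnorm q (x j) =
    normc (t y j) * lnorm r (x j) * (lnorm q (x j) / lnorm r (x j)).
  by rewrite -mulrA; rewrite (mulrC (lnorm r _)) divfK// gt_eqF.
have q0 : 0 <= lnorm q (x j) / lnorm r (x j) by rewrite divr_ge0 ?lnorm_ge0.
rewrite /norm_matrix e lerXn2r ?nnegrE//.
- by rewrite mulr_ge0// mulr_ge0 ?normc_ge0 ?lnorm_ge0.
- by rewrite mulr_ge0// mulr_ge0 ?lnorm_ge0.
- by apply: ler_wpM2r => //; exact: hC.
Qed.

(** The theorem of Dynin and Mityagin for subspaces of s: bases are absolute,
    and X is the sequence space of the norms of the basis. *)
Lemma basis_model : exists T U,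
  tame_iso [set: lambda2 A] (fun q => @lnorm R A q) X (fun q => @lnorm R _ q) T U /\
  forall j, T (ldelta A j) = x j.
Proof.
have /choice[T hT] := synthesis_exists.
have XT xi : X (T xi).
  by apply: (s_closed cX _ (hT xi)) => n; apply: (@expansion_in R X x hX Xx).
have tT xi : t (T xi) = xi by rewrite (tu (XT xi) (hT xi)).
have mem y : X y -> t y \in lambda2_mem A.
  move=> Xy; apply/asboolP => q; have [r [K [_ h]]] := analysis_bound q.
  by apply: wsum_lty => n; exact: h.
have /choice[U hU] : forall y, exists xi : lambda2 A, X y -> forall j, xi j = t y j.
  move=> y; have [Xy|nX] := pselect (X y); last by exists 0.
  by exists (Lambda2 (mem y Xy)).
have TU y : X y -> T (U y) = y.
  move=> Xy; apply: (scvg_unique (hT (U y))).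
  by apply: scvg_ext (tx Xy) => n; apply: eq_bigr => j _; rewrite (hU y Xy).
exists T, U; split; last first.
  move=> j; apply: (scvg_unique (hT (ldelta A j))).
  apply: scvg_ext (tx (Xx j)) => n; apply: eq_bigr => k _.
  by rewrite (@coef_basis R X x t Xx tu).
split.
- move=> a xi zeta _ _; apply: (scvg_unique (hT (a *: xi + zeta))).
  apply: scvg_ext (lcvg_lin a (hT xi) (hT zeta)) => n; rewrite -expansion_lin.
  by apply: eq_bigr => j _; rewrite lambda2D lambda2Z.
- move=> xi _; split=> //; apply: lambda2_ext => j.
  by rewrite (hU (T xi) (XT xi)) tT.
- by move=> y Xy; split=> //; exact: TU.
- move=> q; have [r [K [K0 h]]] := synthesis_bound q; exists r, K; split=> // xi _.
  apply: (lcvg_le (hT xi)); exists 0%N => n _; apply: le_trans (h xi n).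
  exact: lnorm_sum.
- move=> q; have [r [K [K0 h]]] := analysis_bound q; exists r, K; split=> // y Xy.
  apply: (wnorm_leP (lambda2_lty q (U y)) _).2; first by rewrite mulr_ge0 ?lnorm_ge0.
  move=> n; apply: le_trans (h y n Xy); apply: ler_sum => j _.
  by rewrite (hU y Xy).
Qed.

End model.

Lemma schauder_scale (X : set S) x (l : nat -> R[i]) : linear_subspace X ->
  (forall j, l j != 0) -> schauder_basis X x -> schauder_basis X (fun j => l j *: x j).
Proof.
move=> hX l0 [Xx h]; split=> [j|y Xy]; first exact: subspaceZ.
have e (c : nat -> R[i]) : (fun j => c j *: (l j *: x j)) = (fun j => (c j * l j) *: x j).
  by apply/funext => j; rewrite scalerA.
have [c [hc uc]] := h y Xy; exists (fun j => c j / l j); split.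
  rewrite e; have -> // : (fun j => (c j / l j * l j) *: x j) = (fun j => c j *: x j).
  by apply/funext => j; rewrite divfK.
move=> d; rewrite e => /uc hd; apply/funext => j.
by rewrite (congr1 (@^~ j) hd) mulfK.
Qed.

(** With norms |x_j|_0 = 1 the entries are at least 1, so the matrix is
    dominated by its square, and interpolation gives the converse. *)
Lemma normalized_basis (X : set S) x : linear_subspace X -> closed X -> schauder_basis X x ->
  exists (l : nat -> R[i]) T U,
  [/\ forall j, l j != 0,
      kothe_matrix (norm_matrix (fun j => l j *: x j)),
      kothe_equiv (norm_matrix (fun j => l j *: x j)) (kothe_sqr (norm_matrix (fun j => l j *: x j))),
      tame_iso [set: lambda2 (norm_matrix (fun j => l j *: x j))] (fun q => @lnorm R _ q)
        X (fun q => @lnorm R _ q) T U &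
      forall j, T (ldelta _ j) = l j *: x j].
Proof.
move=> hX cX bx; have [t [tx tu]] := schauder_coef bx; have [Xx _] := bx.
have g := @basis_gt0 X x t hX Xx tx tu.
pose l j : R[i] := (lnorm 0 (x j))^-1%:C.
have l0 j : l j != 0.
  by rewrite /l (_ : 0 = 0%:C)// (inj_eq (@complexI R)) invr_eq0 gt_eqF.
have bx' := schauder_scale hX l0 bx; have [t' [tx' tu']] := schauder_coef bx'.
have [Xx' _] := bx'.
have [T [U [TU Td]]] := basis_model hX cX Xx' tx' tu'.
have n0 j : lnorm 0 (l j *: x j) = 1.
  by rewrite lnormZ normcR ger0_norm ?invr_ge0 ?lnorm_ge0// mulVf// gt_eqF.
have n1 j q : 1 <= lnorm q (l j *: x j).
  by have := lnorm_homo (l j *: x j) (leq0n q); rewrite n0.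
exists l, T, U; split=> //.
- split=> [j q|j|j q]; first exact: lnorm_ge0.
    by exists 0%N; exact: lt_le_trans (n1 j 0%N).
  exact: (lnorm_homo (l j *: x j) (leqnSn q)).
- split=> q.
    exists q, 1 => // j; rewrite mul1r /kothe_sqr /norm_matrix expr2.
    by apply: ler_peMr; [exact: lnorm_ge0|exact: n1].
  exists (q + q)%N, 1 => // j; rewrite mul1r /kothe_sqr /norm_matrix.
  by apply: le_trans (lnorm_interpolation _ _) _; rewrite n0 mul1r.
Qed.

(** Both bases, once normalised, identify X with a matrix space; the
    permutation that relates the matrices relates the bases. *)
Lemma kothe_quasi_equivalence (X : set S) : linear_subspace X -> closed X ->
  (forall A B : nat -> nat -> R, kothe_matrix A -> kothe_matrix B ->
      kothe_equiv A (kothe_sqr A) -> kothe_equiv B (kothe_sqr B) ->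
      frechet_iso [set: lambda2 A] [set: lambda2 B] ->
      frechet_iso [set: lambda2 B] X ->
      exists2 sigma : nat -> nat, bijective sigma & kothe_equiv A (kothe_perm sigma B)) ->
  forall x y : nat -> S, schauder_basis X x -> schauder_basis X y -> quasi_equivalent X x y.
Proof.
move=> hX cX h x y bx byB.
have [l [T [U [l0 KA AA TU Td]]]] := normalized_basis hX cX bx.
have [m [T' [U' [m0 KB BB TU' Td']]]] := normalized_basis hX cX byB.
set A := norm_matrix (fun j => l j *: x j) in T U KA AA TU Td *.
set B := norm_matrix (fun j => m j *: y j) in T' U' KB BB TU' Td' *.
have gA := graded_lambda2 (kothe_matrix_mono KA); have gB := graded_lambda2 (kothe_matrix_mono KB).
have gX := graded_s hX; have hA := lambda2_full A; have hB := lambda2_full B.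
have UT' := tame_sym hB hX TU'; have UT := tame_sym hA hX TU.
have [||sigma bs e] := h A B KA KB AA BB.
- by eexists; apply: (tame_frechet gA gB); exact: (tame_trans TU UT').
- by eexists; apply: (tame_frechet gB gX); exact: TU'.
have [tau st ts] := bs.
have A0 j q : 0 <= A j q by have [] := KA.
have B0 j q : 0 <= B j q by have [] := KB.
have [P [Q [PQ Pe]]] := perm_iso st ts A0 B0 e.
have Pd j : P (ldelta A j) = ldelta B (sigma j).
  apply: lambda2_ext => k; rewrite -(ts k) Pe /= /delta.
  by rewrite (inj_eq (can_inj st)).
exists sigma, (fun j => m (sigma j) / l j); split=> //.
  by move=> j; rewrite mulf_neq0// invr_eq0.
have iso := tame_trans (tame_trans UT PQ) TU'.
exists (T' \o (P \o U)); first exact: (tame_frechet gX gX iso).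
move=> j; have [Xx _] := bx.
have [il _ _ _ _] := iso; have [_ TX _ _ _] := TU.
have Uj : U (l j *: x j) = ldelta A j by rewrite -Td; have [_ ->] := TX (ldelta A j) I.
have -> : x j = (l j)^-1 *: (l j *: x j) by rewrite scalerA mulVf// scale1r.
rewrite (lin_onZ _ hX il); last exact: subspaceZ.
by rewrite /= Uj Pd Td' scalerA mulrC.
Qed.

End dynin_mityagin.

(** * The four equivalent conditions *)

Theorem theorem15 (R : realType) (X : set (s_space R)) :
  linear_subspace X -> closed X -> infinite_dimensional X ->
  [<->
    (forall E F : set (Lss R),
      closed_commutative_star_subalgebra E ->
      closed_commutative_star_subalgebra F ->
      frechet_iso E F -> frechet_iso F X ->
      frechet_star_iso E F);
    (forall f g : nat -> s_space R,
      basic_sequence f -> basic_sequence g ->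
      orthonormal_seq f -> orthonormal_seq g ->
      frechet_iso [set: lambda2 (norm_matrix f)]
                  [set: lambda2 (norm_matrix g)] ->
      frechet_iso [set: lambda2 (norm_matrix g)] X ->
      exists2 sigma : nat -> nat, bijective sigma &
        kothe_equiv (norm_matrix f) (kothe_perm sigma (norm_matrix g)));
    (forall A B : nat -> nat -> R,
      kothe_matrix A -> kothe_matrix B ->
      kothe_equiv A (kothe_sqr A) -> kothe_equiv B (kothe_sqr B) ->
      frechet_iso [set: lambda2 A] [set: lambda2 B] ->
      frechet_iso [set: lambda2 B] X ->
      exists2 sigma : nat -> nat, bijective sigma &
        kothe_equiv A (kothe_perm sigma B));
    (forall x y : nat -> s_space R,
      schauder_basis X x -> schauder_basis X y ->
      quasi_equivalent X x y)].
Proof.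
move=> hX cX infX.
have h12 := algebras_orthonormal hX.
have h23 := orthonormal_kothe hX.
have h34 := kothe_quasi_equivalence hX cX.
have h41 := quasi_equivalence_algebras hX infX.
tfae; [|exact: h23|exact: h34|exact: h41].
by move=> h f g _ _; exact: h12.
Qed.
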